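(* Let $p\in(0,1)$, let $\mu_0$ be a compactly supported Borel probability measure on $\mathbb{H}$ with $\mu_0\ll\mathcal{L}^3$, and let $q_0=(x_0,y_0,z_0)\in\mathbb{H}$. The right-translation $R_{q_0}:\mathbb{H}\to\mathbb{H}$, $R_{q_0}(q)=q\cdot q_0$, is a forward optimal transport map from $\mu_0$ to $(R_{q_0})_\sharp\mu_0$ if and only if $z_0=0$ and $(x+x_0,y+y_0)\in\tilde I^+(x,y)$ for $\mu_0$-a.e. $(x,y,z)\in\mathbb{H}$.
   Context: $\mathbb{H}=\mathbb{R}^3$ with group law $(x,y,z)\cdot(x',y',z')=(x+x',y+y',z+z'+\tfrac12(xy'-x'y))$, Lebesgue measure $\mathcal{L}^3$, and left-invariant vector fields $X=\partial_x-\tfrac y2\partial_z$, $Y=\partial_y+\tfrac x2\partial_z$. A horizontal curve is an absolutely continuous $\gamma:[0,T]\to\mathbb{H}$ with $\dot\gamma=u_1X(\gamma)+u_2Y(\gamma)$ a.e., $u\in L^\infty([0,T],\mathbb{R}^2)$; it is future-directed causal if $u_1\ge|u_2|$ and $u_1>0$ a.e., and its length is $\int_0^T\sqrt{u_1^2-u_2^2}\,dt$. The time-separation $\tau(q,q')$ is the supremum of the lengths of future-directed causal curves from $q$ to $q'$, and $0$ if there is none. $c_p=\tau^p/p$. A forward optimal transport map from $\mu$ to $\nu$ is a maximiser of $T\mapsto\int c_p(q,T(q))\,d\mu(q)$ among measurable maps $T:\mathbb{H}\to\mathbb{H}$ with $T_\sharp\mu=\nu$ and $\tau(q,T(q))>0$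 for $\mu$-a.e. $q$ (in particular it satisfies these two constraints). $\tilde I^+(x,y)=\{(x',y')\in\mathbb{R}^2:-(x'-x)^2+(y'-y)^2<0,\ x'-x>0\}$ is the chronological future of $(x,y)$ in the Minkowski plane. *)

(* Defs.v *)
From HB Require Import structures.
From mathcomp Require Export all_boot all_order all_algebra.
From mathcomp Require Export all_classical all_reals all_analysis.
Export Order.TTheory GRing.Theory Num.Theory.
Export numFieldNormedType.Exports.

Set Implicit Arguments.
Unset Strict Implicit.
Unset Printing Implicit Defensive.

Local Open Scope classical_set_scope.
Local Open Scope ring_scope.

(* A point ((x, y), z); a notation rather than a definition, so that the product
   Borel sigma-algebra, topology and norm are found on it. *)
Notation heis R := (R * R * R)%type.

Definition heis_mul (R : realType) (q q' : heis R) : heis R :=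
  let: (x, y, z) := q in let: (x', y', z') := q' in
  (x + x', y + y', z + z' + 2^-1 * (x * y' - x' * y)).

Definition right_translation (R : realType) (q0 q : heis R) : heis R :=
  heis_mul q q0.

Definition heis_lebesgue (R : realType) : set (heis R) -> \bar R :=
  ((@lebesgue_measure R \x @lebesgue_measure R) \x @lebesgue_measure R)%E.

Definition heis_X (R : realType) (q : heis R) : heis R :=
  let: (x, y, z) := q in (1, 0, - (y / 2)).

Definition heis_Y (R : realType) (q : heis R) : heis R :=
  let: (x, y, z) := q in (0, 1, x / 2).

Definition absolutely_continuous (R : realType) (V : normedModType R)
    (a b : R) (f : R -> V) : Prop :=
  forall e : R, 0 < e -> exists2 d : R, 0 < d &
    forall (n : nat) (s t : 'I_n -> R),
      (forall i, [/\ a <= s i, s i < t i & t i <= b]) ->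
      trivIset [set: 'I_n] (fun i => `]s i, t i[%classic) ->
      \sum_(i < n) (t i - s i) < d ->
      \sum_(i < n) `|f (t i) - f (s i)| < e.

Definition ae_on (R : realType) (T : R) (P : R -> Prop) : Prop :=
  {ae @lebesgue_measure R, forall t, t \in `[0, T] -> P t}.

(* Membership in L^oo([0, T], R^2), through a Borel representative. *)
Definition ess_bounded (R : realType) (T : R) (u : R -> R * R) : Prop :=
  measurable_fun `[0, T] u /\ exists M : R, ae_on T (fun t => `|u t| <= M).

(* Curves on [0, T] are functions on R whose values outside [0, T] are
   irrelevant: the two-sided derivative is only required almost everywhere. *)
Definition horizontal_curve (R : realType) (T : R) (g : R -> heis R)
    (u : R -> R * R) : Prop :=
  [/\ absolutely_continuous 0 T g,
      ess_bounded T u &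
      ae_on T (fun t => is_derive t (1 : R) g
        ((u t).1 *: heis_X (g t) + (u t).2 *: heis_Y (g t)))].

Definition future_causal_curve (R : realType) (T : R) (g : R -> heis R)
    (u : R -> R * R) : Prop :=
  horizontal_curve T g u /\
  ae_on T (fun t => `|(u t).2| <= (u t).1 /\ 0 < (u t).1).

Definition curve_length (R : realType) (T : R) (u : R -> R * R) : \bar R :=
  (\int[@lebesgue_measure R]_(t in `[0%R, T])
     (Num.sqrt ((u t).1 ^+ 2 - (u t).2 ^+ 2))%:E)%E.

Definition causal_lengths (R : realType) (q q' : heis R) : set (\bar R) :=
  [set l | exists (T : R) (g : R -> heis R) (u : R -> R * R),
    [/\ 0 < T, future_causal_curve T g u, g 0 = q, g T = q' &
        l = curve_length T u]].

Definition time_separation (R : realType) (q q' : heis R) : \bar R :=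
  if `[< causal_lengths q q' !=set0 >] then ereal_sup (causal_lengths q q')
  else 0%E.

Definition cost (R : realType) (p : R) (q q' : heis R) : \bar R :=
  (time_separation q q' `^ p * (p^-1)%:E)%E.

Definition admissible_map (R : realType) (mu : probability (heis R) R)
    (nu : set (heis R) -> \bar R) (T : heis R -> heis R) : Prop :=
  [/\ measurable_fun [set: heis R] T,
      forall A, measurable A -> pushforward mu T A = nu A &
      {ae mu, forall q, (0 < time_separation q (T q))%E}].

Definition transport_cost (R : realType) (p : R) (mu : probability (heis R) R)
    (T : heis R -> heis R) : \bar R :=
  (\int[mu]_q cost p q (T q))%E.

Definition forward_optimal_map (R : realType) (p : R)
    (mu : probability (heis R) R) (nu : set (heis R) -> \bar R)
    (T : heis R -> heis R) : Prop :=
  admissible_map mu nu T /\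
  forall S, admissible_map mu nu S ->
    (transport_cost p mu S <= transport_cost p mu T)%E.

Definition measure_support (R : realType) (mu : probability (heis R) R) :
    set (heis R) :=
  [set q | forall U, open U -> U q -> (0 < mu U)%E].

Definition compactly_supported (R : realType) (mu : probability (heis R) R) :
    Prop :=
  compact (measure_support mu).

Definition minkowski_future (R : realType) (v : R * R) : set (R * R) :=
  [set v' | - (v'.1 - v.1) ^+ 2 + (v'.2 - v.2) ^+ 2 < 0 /\ 0 < v'.1 - v.1].

(* Main.v *)
Require Import Defs.
From mathcomp Require Import measurable_realfun ring lra.
Set Implicit Arguments.
Unset Strict Implicit.
Unset Printing Implicit Defensive.
Local Open Scope classical_set_scope.
Local Open Scope ring_scope.

(* By left invariance tau(q, q q0) is the constant tau(0, q0), where 0 is the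
   identity of the group.

   Sufficiency: tau(q, q')^p is at most (s t)^(p/2), where s and t are the
   increments of x + y and x - y from q to q', with equality for a horizontal
   translation.  This function of (s, t) is concave, hence bounded by its tangent
   at (x0 + y0, x0 - y0), and the integral of an affine function of (x, y)
   along an admissible map depends on the two marginals only.

   Necessity: if z0 <> 0, then h |-> tau(0, h q0)^p / p is bounded below, near
   h = 0, by a function F + A a + B b + k c - C (a^2 + b^2 + c^2) of
   h = (a, b, c) which is sharp at h = 0 and has k <> 0.  Let h_i be the
   increments, in the group, between the successive vertices q_i of a small
   horizontal regular polygon.  Their horizontal parts add up to 0 while their
   vertical parts add up to minus the enclosed area, which dominates the
   quadratic error when the polygon has many sides; for the right orientation
   the average of tau(0, h_i q0)^p / p thus exceeds F.  As mu_0 << L^3, a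
   Steinhaus argument places such a polygon in the support of mu_0.  Moving
   small sets of equal mass cyclically from one vertex to the next, by
   measure-preserving maps, and then translating by q0, is a better competitor. *)

(** * Monotonicity of absolutely continuous functions *)

(** The polygon gains only a second-order amount over F, so the lower bound must equal the cost at h
    = 0, and tau(0, q0) has to be known exactly. With z0 <> 0 the calibration f = k + w S gives the
    upper bound and an arc with S' = a exp(w t), N' = b exp(- w t) the lower one; they meet because
    f = sqrt(S' / N') is affine in S along the arc. The slope of tau in the height is then - w / m,
    and w <> 0 because z0 <> 0. Nearby endpoints are reached by adding a constant c to N', which
    gives three free parameters; replacing the square root by its tangent makes the error quadratic
    in the displacement.

    Shrinking the polygon cannot beat the quadratic error, as vertical parts and squared sides both
    scale like the square of the radius. For a side seen under the angle t, the area is of order t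
    and the error of order t^2: a large number of sides decides, and this number is fixed before the
    radius, as the Steinhaus argument requires. *)

Lemma real_induction (R : realType) (x y : R) (P : R -> Prop) : x <= y -> P x ->
  (forall c, x <= c <= y -> exists2 d : R, 0 < d &
     forall u v, x <= u -> u <= c -> c <= v -> v <= y -> u < v ->
       c - u < d -> v - c < d -> P u -> P v) ->
  P y.
Proof.
move=> xy Px step.
pose S := [set c | x <= c <= y /\ P c].
have Sx : S x by split=> //; rewrite lexx xy.
have ubS : ubound S y by move=> c [/andP[]].
have hS : has_sup S by split; [exists x|exists y].
have supx : x <= sup S by apply: ub_le_sup => //; case: hS.
have supy : sup S <= y by apply: ge_sup => //; exists x.
(* The step is taken at the supremum of the points reached: from a reached point just before it one
   passes beyond it, or arrives at [y]. It straddles [c] because a derivative gives information at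
   the single point [c]. *)
have [d d0 hd] := step (sup S) (introT andP (conj supx supy)).
have [u [/andP[xu uy] Pu] du] := sup_adherent d0 hS.
have us : u <= sup S by apply: ub_le_sup => //; [case: hS|split=> //; rewrite xu uy].
have [sy|/(conj supy)/andP] := ltP (sup S) y; last first.
  rewrite -eq_le => /eqP sy.
  have [uy'|yu] := ltP u y; last by rewrite (_ : y = u)//; apply/eqP; rewrite eq_le yu uy.
  by apply: (hd u y) => //; rewrite ?sy ?lexx ?subrr //; rewrite sy in du *; lra.
pose v := Num.min y (sup S + d / 2).
have sv : sup S < v by rewrite lt_min sy; lra.
have vy : v <= y by rewrite ge_min lexx.
have vd : v <= sup S + d / 2 by rewrite ge_min lexx orbT.
have Pv : P v.
  by apply: (hd u v) => //; lra.
have : v <= sup S.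
  apply: ub_le_sup; first by case: hS.
  by split=> //; rewrite vy andbT; lra.
lra.
Qed.

(* Bad set covered by an open set of small measure: there absolute continuity
   bounds the total variation, elsewhere the derivative controls increments. *)
Lemma AC_nondecreasing (R : realType) (T : R) (h : R -> R) :
  absolutely_continuous 0 T h ->
  ae_on T (fun t => exists2 d : R, 0 <= d & is_derive t (1 : R) h d) ->
  forall x y : R, 0 <= x -> x <= y -> y <= T -> h x <= h y.
Proof.
move=> hAC [N [mN N0 badN]] x y x0 xy yT.
suff key : forall e, 0 < e -> h x - h y <= e * (y - x) + e.
  rewrite leNgt; apply/negP => hlt.
  have := key ((h x - h y) / (2 * (y - x + 1))).
  have p0 : 0 < y - x + 1 by lra.
  have -> : 0 < (h x - h y) / (2 * (y - x + 1)) by rewrite divr_gt0//; lra.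
  move=> /(_ isT).
  rewrite (_ : _ * (y - x) + _ = (h x - h y) / 2); first lra.
  by field; apply/eqP; lra.
move=> e e0; have [d d0 hd] := hAC e e0.
have Noo : (@lebesgue_measure R N < +oo)%E by rewrite N0 ltry.
have [U [oU NU Ud]] := lebesgue_regularity_outer mN Noo d0.
have mU : measurable U := open_measurable oU.
have muU : (@lebesgue_measure R U < d%:E)%E.
  have := measureU2 (@lebesgue_measure R) mN (measurableD mU mN).
  rewrite (setDUK NU) => /le_lt_trans; apply.
  by rewrite [X in (X + _)%E]N0 add0e.
pose mu := @lebesgue_measure R.
(* The list holds disjoint intervals around bad points, the newest and rightmost first. Their total
   length is charged to U, and outside them [h] decreases with slope at most [e]. A bad point adds
   an interval; a good one leaves the list unchanged. *)
pose P c := exists l : seq (R * R),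
  [/\ all (fun p => [&& x <= p.1, p.1 < p.2 & p.2 <= c]) l,
      pairwise (fun p q => q.2 <= p.1) l,
      ((\sum_(p <- l) (p.2 - p.1))%:E <= mu (U `&` `]x, c[))%E &
      h x - h c <= e * (c - x) + \sum_(p <- l) `|h p.2 - h p.1|].
suff [l [lxy lpw lU hl]] : P y.
  apply: (le_trans hl); rewrite lerD2l; apply: ltW.
  rewrite (big_nth (0, 0)) big_mkord.
  apply: (hd (size l) (fun i => (nth (0, 0) l i).1) (fun i => (nth (0, 0) l i).2)).
  - move=> i; have /and3P[a b c] := all_nthP (0, 0) lxy i (ltn_ord i).
    by split=> //; [exact: le_trans a|exact: le_trans yT].
  - apply/trivIsetP => i j _ _ ij.
    wlog : i j ij / (i < j)%N => [wl|ltij].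
      have [/wl|/wl|/eqP] := ltngtP i j; first exact; last by rewrite val_eqE (negbTE ij).
      by rewrite setIC; apply; rewrite eq_sym.
    apply/seteqP; split => // r [] /=; rewrite !in_itv/=.
    move/pairwiseP : lpw => /(_ (0, 0) i j); rewrite !inE => /(_ (ltn_ord _) (ltn_ord _) ltij) /=.
    lra.
  - rewrite -lte_fin; apply: le_lt_trans muU.
    move: lU; rewrite (big_nth (0, 0)) big_mkord => /le_trans; apply.
    by apply: le_measure; rewrite ?inE//; exact: measurableI.
apply: (@real_induction R x y P xy).
  exists [::]; split=> //; last by rewrite !subrr mulr0 add0r big_nil.
  by rewrite big_nil measure_ge0.
move=> c /andP[xc cy].
have [Nc|Nc] := pselect (N c).
  have /(nbhs_ballP c U) [r /= r0 rU] : nbhs c U by apply: open_nbhs_nbhs; split=> //; exact: NU.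
  exists r => // u v xu uc cv vy uv cu vc [l [la lpw lU hl]].
  exists ((u, v) :: l); split=> /=.
  - rewrite xu uv lexx /=; apply/allP => p /(allP la)/and3P[-> ->] /= /le_trans; apply.
    exact: ltW.
  - by rewrite lpw andbT; apply/allP => p /(allP la)/and3P[].
  - rewrite big_cons /= EFinD addeC.
    have -> : (v - u)%:E = mu `]u, v[%classic by rewrite /mu lebesgue_measure_itv/= lte_fin uv EFinD.
    apply: (@le_trans _ _ (mu (U `&` `]x, u[) + mu `]u, v[%classic)%E); first exact: leeD.
    rewrite -measureU//; last 2 first.
    + exact: measurableI.
    + by apply/seteqP; split=> // w [[_]] /=; rewrite !in_itv/=; lra.
    apply: le_measure; rewrite ?inE//.
    + by apply: measurableU => //; exact: measurableI.
    + exact: measurableI.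
    + move=> w [[Uw] /=|/=]; rewrite in_itv/= => /andP[w1 w2].
        by split=> //=; rewrite in_itv/=; lra.
      split; last by rewrite /= in_itv/=; lra.
      by apply: rU; rewrite /ball/= ltr_norml; lra.
  - rewrite big_cons /=.
    have := ler_norm (- (h v - h u)); rewrite normrN.
    have : e * (u - x) <= e * (v - x) by rewrite ler_pM2l//; lra.
    lra.
have [D D0 hD] : exists2 D : R, 0 <= D & is_derive c (1 : R) h D.
  apply: contrapT => nh; apply: Nc; apply: badN => /= H; apply: nh; apply: H.
  by rewrite in_itv/=; lra.
have [r r0 hr] : exists2 r : R, 0 < r &
    forall w, `|w - c| < r -> w != c -> - e < (w - c)^-1 * (h w - h c).
  case: hD => dh Dh.
  have /cvgr_gt : t^-1 *: (h (t *: (1 : R) + c) - h c) @[t --> (0 : R)^'] --> D.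
    by rewrite -Dh; exact: dh.
  have eD : - e < D by lra.
  move=> /(_ _ eD) /= [r /= r0 hr]; exists r => // w wc wnc.
  have := hr (w - c); rewrite /= sub0r normrN => /(_ wc).
  rewrite subr_eq0 => /(_ wnc).
  by rewrite /GRing.scale /= mulr1 subrK.
exists r => // u v xu uc cv vy uv cu vc [l [la lpw lU hl]].
exists l; split=> //.
- by apply/allP => p /(allP la)/and3P[-> ->] /= /le_trans; apply; exact: ltW.
- apply: (le_trans lU); apply: le_measure; rewrite ?inE//; [exact: measurableI|exact: measurableI|].
  by apply: setIS => w /=; rewrite !in_itv/=; lra.
have hu : h u - h c <= e * (c - u).
  clear -e0 cu uc hr.
  have [->|unc] := eqVneq u c; first by rewrite !subrr mulr0.
  have uc' : u < c by rewrite lt_neqAle unc.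
  have : `|u - c| < r by rewrite ltr_norml; lra.
  move=> /hr/(_ unc).
  rewrite mulrC -[u - c]opprB invrN mulrN ltrNl opprK ltr_pdivrMr; lra.
have hv : h c - h v <= e * (v - c).
  clear -e0 cv vc hr.
  have [->|vnc] := eqVneq v c; first by rewrite !subrr mulr0.
  have vc' : c < v by rewrite lt_neqAle eq_sym vnc.
  have : `|v - c| < r by rewrite ltr_norml; lra.
  move=> /hr/(_ vnc).
  rewrite mulrC ltr_pdivlMr; lra.
have -> : e * (v - x) = e * (u - x) + e * (c - u) + e * (v - c) by ring.
lra.
Qed.

Lemma norm_fst_le (R : realType) (V W : normedModType R) (x : V * W) :
  `|x.1| <= `|x|.
Proof. by rewrite [leRHS]/Num.norm/= le_max lexx. Qed.

Lemma norm_snd_le (R : realType) (V W : normedModType R) (x : V * W) :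
  `|x.2| <= `|x|.
Proof. by rewrite [leRHS]/Num.norm/= le_max lexx orbT. Qed.

Lemma ae_on_impl (R : realType) (T : R) (P Q : R -> Prop) :
  (forall t, 0 <= t <= T -> P t -> Q t) -> ae_on T P -> ae_on T Q.
Proof.
move=> PQ; apply: negligibleS => t /= nQ Pt; apply: nQ => tT.
by apply: PQ (Pt tT); rewrite in_itv/= in tT.
Qed.

Lemma ae_on_and (R : realType) (T : R) (P Q : R -> Prop) :
  ae_on T P -> ae_on T Q -> ae_on T (fun t => P t /\ Q t).
Proof.
move=> HP HQ; apply: negligibleS (negligibleU HP HQ) => t /= H.
apply: contrapT => /not_orP[/contrapT p /contrapT q]; apply: H => tT.
by split; [exact: p|exact: q].
Qed.

(** The term [y - x] admits Lipschitz functions of time, such as the primitive subtracted from [h]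
    in [curve_length_le]. *)
Lemma AC_lipschitz (R : realType) (V : normedModType R) (T C : R) (g : R -> V)
    (h : R -> R) : absolutely_continuous 0 T g -> 0 <= C ->
  (forall x y, 0 <= x -> x <= y -> y <= T ->
    `|h y - h x| <= C * (`|g y - g x| + (y - x))) ->
  absolutely_continuous 0 T h.
Proof.
move=> gAC C0 hh e e0.
have e'0 : 0 < e / (2 * (C + 1)) by rewrite divr_gt0//; lra.
have [d d0 hd] := gAC _ e'0.
exists (Num.min d (e / (2 * (C + 1)))); first by rewrite lt_min d0.
move=> n s t st dst; rewrite lt_min => /andP[/(hd n s t st dst) sum1 sum2].
apply: (@le_lt_trans _ _ (C * (\sum_(i < n) `|g (t i) - g (s i)| + \sum_(i < n) (t i - s i)))).
  rewrite -big_split mulr_sumr; apply: ler_sum => i _; have [a /ltW b c] := st i.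
  exact: hh.
have h1 : C * (\sum_(i < n) `|g (t i) - g (s i)| + \sum_(i < n) (t i - s i)) <=
  C * (e / (2 * (C + 1)) + e / (2 * (C + 1))) by apply: ler_wpM2l => //; lra.
apply: (le_lt_trans h1).
rewrite (_ : C * _ = e * (C / (C + 1))); last by field; apply/eqP; lra.
rewrite gtr_pMr// ltr_pdivrMr; lra.
Qed.

Lemma measurable_sqrt_fun (R : realType) : measurable_fun [set: R] (@Num.sqrt R).
Proof. by apply: continuous_measurable_fun; exact: sqrt_continuous. Qed.

Lemma measurable_speed (R : realType) (D : set R) (u : R -> R * R) :
  measurable D -> measurable_fun D u ->
  measurable_fun D (fun t => Num.sqrt ((u t).1 ^+ 2 - (u t).2 ^+ 2)).
Proof.
move=> mD mu; apply: (measurableT_comp (measurable_sqrt_fun (R:=R))).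
by apply: measurable_funB; apply: measurable_funX;
  [exact: (measurableT_comp measurable_fst)|exact: (measurableT_comp measurable_snd)].
Qed.

(** The primitive F of the speed has the speed as its derivative almost everywhere, so [h - F] has a
    nonnegative derivative almost everywhere and [AC_nondecreasing] applies to it. *)
Lemma curve_length_le (R : realType) (T : R) (u : R -> R * R) (h : R -> R) :
  0 < T -> ess_bounded T u -> absolutely_continuous 0 T h ->
  ae_on T (fun t => exists2 d : R, Num.sqrt ((u t).1 ^+ 2 - (u t).2 ^+ 2) <= d &
                      is_derive t (1 : R) h d) ->
  (curve_length T u <= (h T - h 0)%:E)%E.
Proof.
move=> T0 [mu [M uM]] hAC hd.
pose f t := Num.sqrt ((u t).1 ^+ 2 - (u t).2 ^+ 2).
(* The truncation is bounded and vanishes outside [0, T], hence integrable on the line; on [0, T] it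
   is the speed almost everywhere, since the speed is at most the norm of [u]. *)
pose phi := (fun t => Num.min (f t) `|M|) \_ `[0, T].
have mf : measurable_fun `[0, T] f by exact: measurable_speed.
have mphi : measurable_fun [set: R] phi.
  by apply: (measurable_restrictT _ _).1 => //; exact: (measurable_minr mf (measurable_cst _)).
have phi0 t : 0 <= phi t.
  by rewrite /phi patchE; case: ifPn => // _; rewrite le_min sqrtr_ge0 /=.
have phiM t : phi t <= `|M|.
  by rewrite /phi patchE; case: ifPn => _; [rewrite ge_min lexx orbT|exact: normr_ge0].
have iphi A : measurable A -> (@lebesgue_measure R A < +oo)%E ->
    (@lebesgue_measure R).-integrable A (EFin \o phi).
  move=> mA Aoo; apply: measurable_bounded_integrable => //.
    exact: measurable_funTS.
  exists `|M|; split => // x Mx t _ /=.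
  by rewrite ger0_norm// (le_trans (phiM t))// ltW.
have iphiT : (@lebesgue_measure R).-integrable [set: R] (EFin \o phi).
  have := iphi `[0, T]%classic (measurable_itv _).
  rewrite lebesgue_measure_itv/= lte_fin T0 -EFinB ltry => /(_ isT).
  rewrite integrable_mkcond//.
  rewrite (_ : (EFin \o phi) \_ _ = EFin \o phi)//; apply/funext => t /=.
  by rewrite [LHS]patchE/=; case: ifPn => // tn; rewrite /phi patchE (negbTE tn).
pose F x := (\int[@lebesgue_measure R]_(t in `]-oo, x]) phi t)%R.
have Fae : ae_on T (fun x => is_derive x (1 : R) F (f x)).
  have : {ae @lebesgue_measure R, forall x, derivable F x 1 /\ derive1 F x = phi x}.
    apply: FTC1Ny; first by move=> y; apply: integrableS iphiT.
    by apply: open_integrable_locally => //; exact: openT.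
  move=> H1; have H2 : ae_on T (fun x => derivable F x 1 /\ derive1 F x = phi x).
    by apply: negligibleS H1 => x /= nP Px; apply: nP.
  move: (ae_on_and H2 uM); apply: ae_on_impl => t tT [[dF F'] ut].
  split=> //; rewrite -derive1E F' /phi patchE mem_set; last by rewrite /= in_itv.
  apply/min_idPl; rewrite -(@ger0_norm _ `|M|)// -sqrtr_sqr; apply: ler_wsqrtr.
  apply: (@le_trans _ _ ((u t).1 ^+ 2)); first by rewrite gerBl sqr_ge0.
  rewrite -real_normK ?num_real// lerXn2r ?nnegrE//.
  have : `|(u t).1| <= `|u t| by exact: norm_fst_le.
  by move=> /le_trans; apply; apply: (le_trans ut); rewrite ler_norm.
have FB x y : x <= y -> F y - F x = (\int[@lebesgue_measure R]_(t in `]x, y]) phi t)%R.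
  move=> xy; rewrite /F Rintegral_itvB//.
  by apply: integrableS iphiT.
have FL x y : x <= y -> 0 <= F y - F x <= `|M| * (y - x).
  move=> xy; rewrite FB//.
  have mxy : (@lebesgue_measure R `]x, y] = (y - x)%:E)%E.
    rewrite lebesgue_measure_itv/= lte_fin; case: ltP => // yx.
    by rewrite (_ : x = y) ?subrr//; apply/eqP; rewrite eq_le xy yx.
  have mxyoo : (@lebesgue_measure R `]x, y] < +oo)%E by rewrite mxy ltry.
  rewrite Rintegral_ge0//=.
  have -> : `|M| * (y - x) = (\int[@lebesgue_measure R]_(t in `]x, y]) `|M|)%R.
    by rewrite Rintegral_cst//= mxy.
  apply: le_Rintegral => //; first by apply: iphi => //; exact: mxyoo.
  apply: measurable_bounded_integrable; [by []|exact: mxyoo|exact: measurable_cst|].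
  by exists `|M|; split => // z Mz t _ /=; rewrite normr_id ltW.
have : h 0 - F 0 <= h T - F T.
  apply: (@AC_nondecreasing R T (fun x => h x - F x)) => //; last exact: ltW.
    apply: (@AC_lipschitz R R T (1 + `|M|) h) => //.
    move=> x y _ xy _; have := FL x y xy => /andP[Fxy0 Fxy].
    rewrite (_ : h y - F y - _ = (h y - h x) - (F y - F x)); last by ring.
    apply: (le_trans (ler_normB _ _)); rewrite (ger0_norm Fxy0).
    have a0 : 0 <= `|h y - h x| by [].
    have b0 : 0 <= `|M| by [].
    have c0 : 0 <= `|M| * `|h y - h x| by exact: mulr_ge0.
    rewrite mulrDl mul1r mulrDr; lra.
  move: (ae_on_and hd Fae); apply: ae_on_impl => t tT [[d fd hdt] Fdt].
  exists (d - f t); first by rewrite subr_ge0.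
  exact: is_deriveB.
have := FB 0 T (ltW T0).
rewrite -[curve_length _ _]/(\int[@lebesgue_measure R]_(t in `[0%R, T]) (f t)%:E)%E.
have -> : (\int[@lebesgue_measure R]_(t in `[0%R, T]) (f t)%:E =
           \int[@lebesgue_measure R]_(t in `[0%R, T]) (phi t)%:E)%E.
  apply: ge0_ae_eq_integral => //.
  - exact/measurable_EFinP.
  - by apply/measurable_EFinP; exact: measurable_funTS.
  - by move=> t _; rewrite lee_fin sqrtr_ge0.
  - by move=> t _; rewrite lee_fin.
  apply: negligibleS uM => t /= H ut; apply: H => tT; congr EFin.
  rewrite /phi patchE mem_set//; apply/esym/min_idPl.
  rewrite -(@ger0_norm _ `|M|)// -sqrtr_sqr; apply: ler_wsqrtr.
  apply: (@le_trans _ _ ((u t).1 ^+ 2)); first by rewrite gerBl sqr_ge0.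
  rewrite -real_normK ?num_real// lerXn2r ?nnegrE//.
  have : `|(u t).1| <= `|u t| by exact: norm_fst_le.
  by move=> /le_trans; apply; apply: (le_trans (ut tT)); rewrite ler_norm.
rewrite Rintegral_itv_obnd_cbnd; last by apply: integrableS iphiT.
move=> HF hF; rewrite -[leLHS]fineK; last first.
  by apply: integrable_fin_num => //; apply: integrableS iphiT.
by rewrite lee_fin -[fine _]/(Rintegral _ _ _) -HF; lra.
Qed.

(** * Left invariance of the time separation *)

Lemma is_deriveP (R : realType) (V W : normedModType R) (f : V -> W) (a v : V)
    (d : W) :
  is_derive a v f d <->
  h^-1 *: (f (h *: v + a) - f a) @[h --> (0 : R)^'] --> d.
Proof.
split=> [[df fd]|fd]; first by rewrite -fd; exact: df.
split; first by apply/cvg_ex; exists d.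
exact: cvg_lim fd.
Qed.

Lemma is_derive_pairP (R : realType) (V W U : normedModType R) (f : V -> W * U)
    (a v : V) (d : W * U) :
  is_derive a v f d <->
  is_derive a v (fun x => (f x).1) d.1 /\ is_derive a v (fun x => (f x).2) d.2.
Proof.
split=> [/is_deriveP fd|[/is_deriveP fd1 /is_deriveP fd2]].
  split; apply/is_deriveP.
    by apply: (cvg_comp (fun h => h^-1 *: (f (h *: v + a) - f a)) (@fst W U) fd); exact: cvg_fst.
  by apply: (cvg_comp (fun h => h^-1 *: (f (h *: v + a) - f a)) (@snd W U) fd); exact: cvg_snd.
by apply/is_deriveP; case: d fd1 fd2 => d1 d2 fd1 fd2; exact: (cvg_pair fd1 fd2).
Qed.

Lemma is_derive_heisP (R : realType) (g : R -> heis R) (t a b c : R) :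
  is_derive t (1 : R) g (a, b, c) <->
  [/\ is_derive t (1 : R) (fun x => (g x).1.1) a,
      is_derive t (1 : R) (fun x => (g x).1.2) b &
      is_derive t (1 : R) (fun x => (g x).2) c].
Proof.
split=> [/is_derive_pairP[/is_derive_pairP[]]//|[ha hb hc]].
by apply/is_derive_pairP; split => //=; apply/is_derive_pairP; split.
Qed.

Lemma heis_velocityE (R : realType) (u : R * R) (q : heis R) :
  u.1 *: heis_X q + u.2 *: heis_Y q =
  (u.1, u.2, 2^-1 * (u.2 * q.1.1 - u.1 * q.1.2)).
Proof.
case: q => -[x y] z; rewrite /heis_X /heis_Y /=.
change ((u.1 * 1 + u.2 * 0, u.1 * 0 + u.2 * 1,
  u.1 * - (y / 2) + u.2 * (x / 2)) = (u.1, u.2, 2^-1 * (u.2 * x - u.1 * y))).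
by congr (_, _, _); ring.
Qed.

Definition heis_inv (R : realType) (q : heis R) : heis R :=
  (- q.1.1, - q.1.2, - q.2).

Lemma heis_mulA (R : realType) (a b c : heis R) :
  heis_mul a (heis_mul b c) = heis_mul (heis_mul a b) c.
Proof.
case: a => -[? ?] ?; case: b => -[? ?] ?; case: c => -[? ?] ?.
by congr (_, _, _); ring.
Qed.

Lemma heis_mulKV (R : realType) (a b : heis R) : heis_mul (heis_inv a) (heis_mul a b) = b.
Proof.
case: a => -[? ?] ?; case: b => -[? ?] ?; rewrite /heis_inv /=.
by congr (_, _, _); field.
Qed.

Lemma heis_mulVK (R : realType) (a b : heis R) : heis_mul a (heis_mul (heis_inv a) b) = b.
Proof.
case: a => -[? ?] ?; case: b => -[? ?] ?; rewrite /heis_inv /=.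
by congr (_, _, _); field.
Qed.

Lemma heis_mul0 (R : realType) (a : heis R) : heis_mul a (0, 0, 0) = a.
Proof. by case: a => -[? ?] ?; congr (_, _, _); field. Qed.

Lemma AC_lipschitz_heis (R : realType) (T C : R) (g g' : R -> heis R) :
  absolutely_continuous 0 T g -> 0 < C ->
  (forall x y, `|g' y - g' x| <= C * `|g y - g x|) ->
  absolutely_continuous 0 T g'.
Proof.
move=> gAC C0 gg' e e0.
have [d d0 hd] := gAC (e / C) (divr_gt0 e0 C0).
exists d => // n s t st dst sd.
apply: (@le_lt_trans _ _ (C * \sum_(i < n) `|g (t i) - g (s i)|)).
  by rewrite mulr_sumr; apply: ler_sum => i _; exact: gg'.
by rewrite mulrC -ltr_pdivlMr//; exact: hd.
Qed.

Lemma norm_heis_le (R : realType) (q : heis R) (M : R) :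
  `|q.1.1| <= M -> `|q.1.2| <= M -> `|q.2| <= M -> `|q| <= M.
Proof.
move=> h1 h2 h3.
rewrite [leLHS]/Num.norm/= ge_max h3 andbT.
by rewrite [leLHS]/Num.norm/= ge_max h1 h2.
Qed.

Lemma norm_heis11 (R : realType) (q : heis R) : `|q.1.1| <= `|q|.
Proof. exact: le_trans (norm_fst_le _) (norm_fst_le _). Qed.

Lemma norm_heis12 (R : realType) (q : heis R) : `|q.1.2| <= `|q|.
Proof. exact: le_trans (norm_snd_le _) (norm_fst_le _). Qed.

(** The translated curve keeps its control [u], as X and Y are left-invariant. Left translation is
    affine, hence Lipschitz, and preserves absolute continuity. *)
Lemma causal_lengths_mul (R : realType) (a q q' : heis R) :
  causal_lengths q q' `<=` causal_lengths (heis_mul a q) (heis_mul a q').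
Proof.
move=> l [T [g [u [T0 [[gAC ub gd] cu] g0 gT ->]]]].
exists T, (fun t => heis_mul a (g t)), u; split => //; [|by rewrite g0|by rewrite gT].
split => //; split => //.
  apply: (@AC_lipschitz_heis R T (1 + `|a|) g) => // x y.
  have p1 := norm_heis11 (g y - g x).
  have p2 := norm_heis12 (g y - g x).
  have p3 := norm_snd_le (g y - g x).
  have a1 := norm_heis11 a.
  have a2 := norm_heis12 a.
  have a0 : 0 <= `|a| by [].
  have d0 : 0 <= `|g y - g x| by [].
  have ad0 : 0 <= `|a| * `|g y - g x| by exact: mulr_ge0.
  move: p1 p2 p3 a1 a2; rewrite mulrDl mul1r.
  set D := `|g y - g x| in d0 ad0 *; move: d0 ad0; rewrite /D.
  case: a a0 => -[a1 a2] a3; case: (g y) => -[x2 y2] z2; case: (g x) => -[x1 y1] z1 /=.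
  set A := `|(a1, a2, a3)|; set E := `| _ |; move=> A0 E0 AE0 p1 p2 p3 ha1 ha2.
  apply: norm_heis_le => /=.
  - by rewrite (_ : _ - _ = x2 - x1); [lra|ring].
  - by rewrite (_ : _ - _ = y2 - y1); [lra|ring].
  - rewrite (_ : _ - _ = (z2 - z1) + 2^-1 * (a1 * (y2 - y1) - (x2 - x1) * a2)); last by ring.
    apply: (le_trans (ler_normD _ _)); apply: lerD => //.
    rewrite normrM ger0_norm//; have := ler_normB (a1 * (y2 - y1)) ((x2 - x1) * a2).
    rewrite !normrM.
    have : `|a1| * `|y2 - y1| <= A * E by exact: ler_pM.
    have : `|x2 - x1| * `|a2| <= A * E by rewrite mulrC; exact: ler_pM.
    lra.
move: gd; apply: ae_on_impl => t tT.
rewrite !heis_velocityE => /is_derive_heisP[dx dy dz].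
apply/is_derive_heisP; move: dx dy dz.
case: a => -[a1 a2] a3.
have E t' : heis_mul (a1, a2, a3) (g t') =
    (a1 + (g t').1.1, a2 + (g t').1.2,
     a3 + (g t').2 + 2^-1 * (a1 * (g t').1.2 - (g t').1.1 * a2)).
  by case: (g t') => -[].
move=> dx dy dz.
split.
- rewrite (_ : (fun _ => _) = cst a1 + (fun x => (g x).1.1)); last first.
    by apply/funext => t'; rewrite E.
  by rewrite -[X in is_derive _ _ _ X]add0r; exact: is_deriveD.
- rewrite (_ : (fun _ => _) = cst a2 + (fun x => (g x).1.2)); last first.
    by apply/funext => t'; rewrite E.
  by rewrite -[X in is_derive _ _ _ X]add0r; exact: is_deriveD.
- rewrite (_ : (fun _ => _) = cst a3 + (fun x => (g x).2) +
     2^-1 *: (a1 *: (fun x => (g x).1.2) - a2 *: (fun x => (g x).1.1))); last first.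
    apply/funext => t'; rewrite E /=.
    change (a3 + (g t').2 + 2^-1 * (a1 * (g t').1.2 - (g t').1.1 * a2) =
      a3 + (g t').2 + 2^-1 * (a1 * (g t').1.2 - a2 * (g t').1.1)).
    ring.
  have h := is_deriveD (is_deriveD (is_derive_cst a3 t (1 : R)) dz)
    (is_deriveZ 2^-1 (is_deriveB (is_deriveZ a1 dy) (is_deriveZ a2 dx))).
  apply: (is_derive_eq h); rewrite E.
  change (0 + 2^-1 * ((u t).2 * (g t).1.1 - (u t).1 * (g t).1.2) +
      2^-1 * (a1 * (u t).2 - a2 * (u t).1) =
    2^-1 * ((u t).2 * (a1 + (g t).1.1) - (u t).1 * (a2 + (g t).1.2))).
  ring.
Qed.

Lemma time_separation_mul (R : realType) (a q q' : heis R) :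
  time_separation (heis_mul a q) (heis_mul a q') = time_separation q q'.
Proof.
rewrite /time_separation.
suff -> : causal_lengths (heis_mul a q) (heis_mul a q') = causal_lengths q q' by [].
apply/seteqP; split; last exact: causal_lengths_mul.
by have := @causal_lengths_mul R (heis_inv a) (heis_mul a q) (heis_mul a q'); rewrite !heis_mulKV.
Qed.

Lemma time_separation_right (R : realType) (q q0 : heis R) :
  time_separation q (heis_mul q q0) = time_separation (0, 0, 0) q0.
Proof. by rewrite -{1}(heis_mul0 q) time_separation_mul. Qed.

Lemma time_separation_le (R : realType) (q q' : heis R) (B : R) : 0 <= B ->
  (forall l, causal_lengths q q' l -> (l <= B%:E)%E) ->
  (time_separation q q' <= B%:E)%E.
Proof.
move=> B0 lB; rewrite /time_separation; case: ifPn => _; last by rewrite lee_fin.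
exact: ge_ereal_sup.
Qed.

Lemma time_separation_ge (R : realType) (q q' : heis R) (l : \bar R) :
  causal_lengths q q' l -> (l <= time_separation q q')%E.
Proof.
move=> cl; rewrite /time_separation; case: ifPn => [_|/asboolPn[]]; last by exists l.
exact: ereal_sup_ubound.
Qed.

Lemma time_separation_ge0 (R : realType) (q q' : heis R) :
  (0 <= time_separation q q')%E.
Proof.
rewrite /time_separation; case: ifPn => // /asboolP[l cl].
apply: le_trans (ereal_sup_ubound cl).
case: cl => T [g [u [T0 _ _ _ ->]]].
by apply: integral_ge0 => t _; rewrite lee_fin sqrtr_ge0.
Qed.

Lemma time_separation_gt0 (R : realType) (q q' : heis R) :
  (0 < time_separation q q')%E -> exists2 l, causal_lengths q q' l & (0 < l)%E.
Proof.
rewrite /time_separation; case: ifPn => [_|_]; last by rewrite ltxx.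
by move=> /ereal_sup_gt[l cl l0]; exists l.
Qed.

(** AM-GM: the two terms of the mean have product u1^2 - u2^2. Equality holds when f^2 (u1 - u2) =
    u1 + u2. *)
Lemma sqrt_null_le (R : realType) (u1 u2 f : R) : `|u2| <= u1 -> 0 < f ->
  Num.sqrt (u1 ^+ 2 - u2 ^+ 2) <= 2^-1 * ((u1 + u2) / f + (u1 - u2) * f).
Proof.
rewrite ler_norml => /andP[h1 h2] f0.
have a0 : 0 <= (u1 + u2) / f by rewrite divr_ge0//; lra.
have b0 : 0 <= (u1 - u2) * f by rewrite mulr_ge0//; lra.
have c0 : 0 <= 2^-1 * ((u1 + u2) / f + (u1 - u2) * f) by rewrite mulr_ge0//; lra.
rewrite -(ger0_norm c0) -sqrtr_sqr; apply: ler_wsqrtr.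
rewrite -subr_ge0 (_ : _ - _ = (2^-1 * ((u1 + u2) / f - (u1 - u2) * f)) ^+ 2) ?sqr_ge0//.
by field; lra.
Qed.

Lemma ln_lipschitz (R : realType) (c a b : R) : 0 < c -> c <= a -> c <= b ->
  `|ln b - ln a| <= `|b - a| / c.
Proof.
move=> c0.
have key a' b' : c <= a' -> c <= b' -> ln b' - ln a' <= `|b' - a'| / c.
  move=> ca cb; have a0 : 0 < a' by lra.
  have b0 : 0 < b' by lra.
  rewrite -ln_div ?posrE//.
  have ba0 := divr_gt0 b0 a0.
  have : ln (b' / a') <= b' / a' - 1.
    have -> : b' / a' = 1 + (b' / a' - 1) by ring.
    rewrite -[X in _ <= X - 1]/(1 + (b' / a' - 1)) [leRHS](_ : _ = b' / a' - 1); last by ring.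
    by apply: le_ln1Dx; lra.
  move=> /le_trans; apply.
  rewrite (_ : b' / a' - 1 = (b' - a') / a'); last by field; lra.
  apply: (@le_trans _ _ (`|b' - a'| / a')).
    by rewrite ler_pM2r ?invr_gt0// ler_norm.
  by apply: ler_wpM2l => //; rewrite lef_pV2 ?posrE.
move=> ca cb; rewrite ler_norml key// andbT lerNl opprB distrC; exact: key.
Qed.

(** * Upper bounds by calibration *)

(* [S] and [N] are null coordinates, with velocities u1 + u2 and u1 - u2 along the
   curve, and 4 Z' = N S' - S N'.  By AM-GM, the speed is at most
   (S' / f + f N') / 2 for every f > 0, which is an exact derivative for constant f
   and for f = k + w S. *)
Section Calibration.
Variables (R : realType) (T : R) (g : R -> heis R) (u : R -> R * R) (x y z : R).
Hypotheses (T0 : 0 < T) (gc : future_causal_curve T g u) (g0 : g 0 = (0, 0, 0))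
  (gT : g T = (x, y, z)).
Let S t := (g t).1.1 + (g t).1.2.
Let N t := (g t).1.1 - (g t).1.2.
Let Z t := (g t).2.

Lemma null_increment (a b : R) : [/\ `|S b - S a| <= 2 * `|g b - g a|,
  `|N b - N a| <= 2 * `|g b - g a| & `|Z b - Z a| <= `|g b - g a|].
Proof.
have p1 := norm_heis11 (g b - g a).
have p2 := norm_heis12 (g b - g a).
have p3 := norm_snd_le (g b - g a).
have e1 : (g b - g a).1.1 = (g b).1.1 - (g a).1.1 by [].
have e2 : (g b - g a).1.2 = (g b).1.2 - (g a).1.2 by [].
rewrite e1 in p1; rewrite e2 in p2; split=> //.
- rewrite /S (_ : _ - _ = ((g b).1.1 - (g a).1.1) + ((g b).1.2 - (g a).1.2)); last by ring.
  by apply: (le_trans (ler_normD _ _)); lra.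
- rewrite /N (_ : _ - _ = ((g b).1.1 - (g a).1.1) - ((g b).1.2 - (g a).1.2)); last by ring.
  by apply: (le_trans (ler_normB _ _)); lra.
Qed.

Lemma null_derivatives : ae_on T (fun t => [/\
    `|(u t).2| <= (u t).1, is_derive t (1 : R) S ((u t).1 + (u t).2),
    is_derive t (1 : R) N ((u t).1 - (u t).2) &
    is_derive t (1 : R) Z (4^-1 * (N t * ((u t).1 + (u t).2) - S t * ((u t).1 - (u t).2)))]).
Proof.
case: gc => [[_ _ gd] cu]; move: (ae_on_and gd cu); apply: ae_on_impl => t tT [].
rewrite heis_velocityE => /is_derive_heisP[dx dy dz] [u12 _]; split => //.
- exact: (is_deriveD dx dy).
- exact: (is_deriveB dx dy).
- by apply: (is_derive_eq dz); rewrite /N /S; field.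
Qed.

Lemma null_AC : absolutely_continuous 0 T S /\ absolutely_continuous 0 T N.
Proof.
case: gc => [[gAC _ _] _].
by split; apply: (@AC_lipschitz R _ T 2 g) => // a b _ ab _;
  have [s1 s2 _] := null_increment a b;
  have d0 : 0 <= `|g b - g a| by []; lra.
Qed.

(** Causality makes u1 + u2 and u1 - u2 nonnegative, so S and N increase from 0 to their final
    values. *)
Lemma null_bounds (t : R) : 0 <= t <= T -> 0 <= S t <= x + y /\ 0 <= N t <= x - y.
Proof.
move=> /andP[t0 tT]; have [SAC NAC] := null_AC.
have S0 : S 0 = 0 by rewrite /S g0 /= addr0.
have N0 : N 0 = 0 by rewrite /N g0 /= subr0.
have ST : S T = x + y by rewrite /S gT.
have NT : N T = x - y by rewrite /N gT.
have Sm := AC_nondecreasing SAC _.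
have Nm := AC_nondecreasing NAC _.
have Smono : forall a b : R, 0 <= a -> a <= b -> b <= T -> S a <= S b.
  apply: Sm; move: null_derivatives; apply: ae_on_impl => r _ [h dS _ _].
  by exists ((u r).1 + (u r).2) => //; move: h; rewrite ler_norml; lra.
have Nmono : forall a b : R, 0 <= a -> a <= b -> b <= T -> N a <= N b.
  apply: Nm; move: null_derivatives; apply: ae_on_impl => r _ [h _ dN _].
  by exists ((u r).1 - (u r).2) => //; move: h; rewrite ler_norml; lra.
have h1 : 0 <= S t by rewrite -S0; exact: Smono.
have h2 : 0 <= N t by rewrite -N0; exact: Nmono.
by rewrite h1 h2 -ST -NT Smono// Nmono.
Qed.

Lemma length_le_linear (f : R) : 0 < f ->
  (curve_length T u <= (2^-1 * ((x + y) / f + (x - y) * f))%:E)%E.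
Proof.
move=> f0; case: (gc) => [[gAC ub _] _].
pose h t := 2^-1 * (f^-1 * S t + f * N t).
have := @curve_length_le R T u h T0 ub.
rewrite /h /S /N g0 gT /= !(addr0, subr0, mulr0) (mulrC f^-1) (mulrC f); apply.
  apply: (@AC_lipschitz R _ T (f^-1 + f) g) => //.
    by rewrite addr_ge0// ltW// invr_gt0.
  move=> a b _ ab _; have [s1 s2 _] := null_increment a b.
  rewrite /h (_ : _ - _ = 2^-1 * (f^-1 * (S b - S a)) + 2^-1 * (f * (N b - N a))); last by rewrite /S /N; ring.
  apply: (le_trans (ler_normD _ _)); rewrite !normrM (@ger0_norm _ 2^-1)// (gtr0_norm f0) normfV (gtr0_norm f0).
  have d0 : 0 <= `|g b - g a| by [].
  have : f^-1 * `|S b - S a| <= f^-1 * (2 * `|g b - g a|) by rewrite ler_pM2l// invr_gt0.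
  have : f * `|N b - N a| <= f * (2 * `|g b - g a|) by rewrite ler_pM2l.
  have : 0 <= (f^-1 + f) * (b - a).
    by rewrite mulr_ge0// ?subr_ge0// addr_ge0// ltW// invr_gt0.
  rewrite mulrDr; lra.
move: null_derivatives; apply: ae_on_impl => t _ [ut dS dN _].
exists (2^-1 * (f^-1 * ((u t).1 + (u t).2) + f * ((u t).1 - (u t).2))).
  by rewrite mulrC (mulrC f^-1) (mulrC f) mulrC; exact: sqrt_null_le.
exact: (is_deriveZ 2^-1 (is_deriveD (is_deriveZ f^-1 dS) (is_deriveZ f dN))).
Qed.

(** For f = k + w S, the term S' / f integrates to a logarithm, and S N' integrates to (S N - 4 Z) /
    2. This is how the height of the endpoint enters the bound. *)
Lemma length_le_calibration (k w : R) : w != 0 -> 0 < k -> 0 < k + w * (x + y) ->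
  (curve_length T u <= (2^-1 * (w^-1 * (ln (k + w * (x + y)) - ln k) + k * (x - y)
     + w / 2 * ((x + y) * (x - y) - 4 * z)))%:E)%E.
Proof.
move=> w0 k0 kw0; case: (gc) => [[gAC ub _] _].
pose h t := 2^-1 * (w^-1 * ln (k + w * S t) + k * N t + w / 2 * (S t * N t - 4 * Z t)).
(* An affine function of S on [0, x + y] is smallest at an endpoint, so [c] bounds f from below
   along the curve and makes the logarithm Lipschitz there. *)
pose c := Num.min k (k + w * (x + y)).
have c0 : 0 < c by rewrite lt_min k0.
have cS t : 0 <= t <= T -> c <= k + w * S t.
  move=> /null_bounds[/andP[S0 Sx] _]; rewrite ge_min.
  have [w1|w1] := leP 0 w.
    by apply/orP; left; have := mulr_ge0 w1 S0; lra.
  apply/orP; right; rewrite lerD2l; exact: ler_wnM2l (ltW w1) _ _ Sx.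
have hE : h T - h 0 = 2^-1 * (w^-1 * (ln (k + w * (x + y)) - ln k) + k * (x - y)
     + w / 2 * ((x + y) * (x - y) - 4 * z)).
  rewrite /h /S /N /Z g0 gT /= !(addr0, subr0, mulr0); ring.
rewrite -hE; apply: curve_length_le => //.
  have xy0 : 0 <= x + y by have [|/andP[? ?] _] := @null_bounds 0; [rewrite lexx ltW|lra].
  have yx0 : 0 <= x - y by have [|_ /andP[? ?]] := @null_bounds 0; [rewrite lexx ltW|lra].
  pose C := c^-1 + k + `|w| * ((x + y) / 2 + (x - y) / 2 + 1).
  have C0 : 0 <= C.
    by rewrite /C !addr_ge0// ?mulr_ge0// ?invr_ge0 ltW//; lra.
  apply: (@AC_lipschitz R _ T C g) => //.
  move=> a b a0 ab bT; have [s1 s2 s3] := null_increment a b.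
  have [/andP[Sa0 Sax] /andP[Na0 Nax]] : 0 <= S a <= x + y /\ 0 <= N a <= x - y.
    by apply: null_bounds; rewrite a0 (le_trans ab).
  have [/andP[Sb0 Sbx] /andP[Nb0 Nbx]] : 0 <= S b <= x + y /\ 0 <= N b <= x - y.
    by apply: null_bounds; rewrite bT (le_trans a0).
  set D := `|g b - g a| in s1 s2 s3 *.
  have D0 : 0 <= D by exact: normr_ge0.
  have i1 : `|w^-1 * (ln (k + w * S b) - ln (k + w * S a))| <= c^-1 * (2 * D).
    rewrite normrM.
    have hl := @ln_lipschitz R c (k + w * S a) (k + w * S b) c0.
    apply: (@le_trans _ _ (`|w^-1| * (`|w| * (2 * D) / c))).
      apply: ler_wpM2l => //; apply: (le_trans (hl _ _)).
      - by apply: cS; rewrite a0 (le_trans ab).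
      - by apply: cS; rewrite bT (le_trans a0).
      rewrite ler_pM2r ?invr_gt0// (_ : _ - _ = w * (S b - S a)); last by ring.
      by rewrite normrM; exact: ler_wpM2l.
    have wn : `|w| != 0 by rewrite normr_eq0.
    have cn : c != 0 by rewrite gt_eqF.
    rewrite normfV le_eqVlt; apply/orP; left; apply/eqP; field.
    by rewrite wn cn.
  have i2 : `|k * (N b - N a)| <= k * (2 * D).
    by rewrite normrM (gtr0_norm k0) ler_pM2l.
  have i3 : `|S b * N b - S a * N a| <= (x + y) * (2 * D) + (x - y) * (2 * D).
    rewrite (_ : _ - _ = S b * (N b - N a) + N a * (S b - S a)); last by ring.
    apply: (le_trans (ler_normD _ _)); rewrite !normrM (ger0_norm Sb0) (ger0_norm Na0).
    by apply: lerD; apply: ler_pM.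
  have i4 : `|w / 2 * ((S b * N b - S a * N a) - 4 * (Z b - Z a))| <=
     `|w| / 2 * ((x + y) * (2 * D) + (x - y) * (2 * D) + 4 * D).
    rewrite normrM normrM (@ger0_norm _ 2^-1)//; apply: ler_wpM2l.
      by rewrite mulr_ge0.
    apply: (le_trans (ler_normB _ _)); rewrite [X in _ + X]normrM (@ger0_norm _ 4)//.
    lra.
  rewrite /h (_ : _ - _ = 2^-1 * (w^-1 * (ln (k + w * S b) - ln (k + w * S a)) +
    k * (N b - N a) + w / 2 * ((S b * N b - S a * N a) - 4 * (Z b - Z a)))); last by ring.
  rewrite normrM (@ger0_norm _ 2^-1)//.
  apply: (@le_trans _ _ (2^-1 * (c^-1 * (2 * D) + k * (2 * D) +
     `|w| / 2 * ((x + y) * (2 * D) + (x - y) * (2 * D) + 4 * D)))).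
    rewrite ler_pM2l//; apply: (le_trans (ler_normD _ _)); apply: lerD => //.
    by apply: (le_trans (ler_normD _ _)); apply: lerD.
  apply: (@le_trans _ _ (C * D)); last by apply: ler_wpM2l => //; lra.
  have cn : c != 0 by rewrite gt_eqF.
  by rewrite /C le_eqVlt; apply/orP; left; apply/eqP; field.
move: (null_derivatives); apply: ae_on_impl => t tT [ut dS dN dZ].
have kt : 0 < k + w * S t by apply: lt_le_trans (cS t tT).
have dln : is_derive t (1 : R) (fun t => ln (k + w * S t))
    ((k + w * S t)^-1 * (w * ((u t).1 + (u t).2))).
  have d1 : is_derive t (1 : R) (fun t => k + w * S t) (w * ((u t).1 + (u t).2)).
    by rewrite -[X in is_derive _ _ _ X]add0r; exact: (is_deriveD (is_derive_cst k t 1) (is_deriveZ w dS)).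
  by have := @is_derive1_comp R (@ln R) _ t _ _ (is_derive1_ln kt) d1; rewrite mulrC.
exists (2^-1 * (((u t).1 + (u t).2) / (k + w * S t) + ((u t).1 - (u t).2) * (k + w * S t))).
  exact: sqrt_null_le.
have := is_deriveZ 2^-1 (is_deriveD (is_deriveD (is_deriveZ w^-1 dln) (is_deriveZ k dN))
  (is_deriveZ (w / 2) (is_deriveB (is_deriveM dS dN) (is_deriveZ 4 dZ)))).
move=> h1; apply: (is_derive_eq h1); rewrite /GRing.scale/=; field.
by rewrite w0 gt_eqF.
Qed.

End Calibration.

(** * The chronological future of the identity *)

Lemma causal_lengths_minkowski (R : realType) (x y z : R) (l : \bar R) :
  causal_lengths (0, 0, 0) (x, y, z) l -> (0 < l)%E ->
  [/\ 0 < x + y, 0 < x - y & (l <= (Num.sqrt ((x + y) * (x - y)))%:E)%E].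
Proof.
case=> T [g [u [T0 gc g0 gT ->]]] l0.
have lin := length_le_linear T0 gc g0 gT.
have T00 : (0 : R) <= 0 <= T by rewrite lexx ltW.
have [/andP[sa sb] /andP[ta tb]] := null_bounds gc g0 gT T00.
have s0 : 0 <= x + y by lra.
have t0 : 0 <= x - y by lra.
have : curve_length T u \is a fin_num.
  by rewrite ge0_fin_numE ?ltW//; apply: le_lt_trans (lin 1 ltr01) (ltry _).
case: (curve_length T u) l0 lin => [r| |]//; rewrite lte_fin => r0 lin _.
have sgt : 0 < x + y.
  rewrite lt_neqAle s0 andbT; apply/negP => /eqP s00.
  (* With x + y = 0, so small an f brings the linear bound below the length r; if x - y = 0 instead,
     a large f does. *)
  have f0 : 0 < r / (x - y + 1) by rewrite divr_gt0//; lra.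
  have := lin _ f0; rewrite lee_fin -s00 mul0r add0r.
  have : (x - y) * (r / (x - y + 1)) <= r.
    by rewrite mulrCA ger_pMr// ler_pdivrMr; lra.
  lra.
have tgt : 0 < x - y.
  rewrite lt_neqAle t0 andbT; apply/negP => /eqP t00.
  have f0 : 0 < (x + y) / r by rewrite divr_gt0.
  have := lin _ f0; rewrite lee_fin -t00 mul0r addr0.
  by rewrite (_ : (x + y) / _ = r); [lra|field; lra].
split=> //; rewrite lee_fin.
pose s := Num.sqrt (x + y); pose t := Num.sqrt (x - y).
have s'0 : 0 < s by rewrite sqrtr_gt0.
have t'0 : 0 < t by rewrite sqrtr_gt0.
have sE : x + y = s ^+ 2 by rewrite sqr_sqrtr.
have tE : x - y = t ^+ 2 by rewrite sqr_sqrtr.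
(* f = s / t minimises the linear bound, with value s t. *)
have := lin _ (divr_gt0 s'0 t'0); rewrite lee_fin sE tE.
rewrite -exprMn sqrtr_sqr gtr0_norm ?mulr_gt0//.
by rewrite (_ : 2^-1 * _ = s * t)//; field; lra.
Qed.

(** With k = 1 / n and w = n^3 the part of the calibration bound that does not see the height is O(1
    / n): the logarithm of 1 + n^4 s is negligible against w. If 4 z >= s t, the remaining part is
    nonpositive, and no positive length is possible. *)
Lemma small_calibration (R : realType) (s t r : R) : 0 < s -> 0 < t -> 0 < r ->
  exists k w : R, [/\ 0 < k, 0 < w &
    2^-1 * (w^-1 * (ln (k + w * s) - ln k) + k * t) < r].
Proof.
move=> s0 t0 r0; pose n := 1 + (4 + 2 * s + t) / r.
have q0 : 0 < (4 + 2 * s + t) / r by rewrite divr_gt0//; lra.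
have n1 : 1 < n by rewrite /n; lra.
have n0 : 0 < n by lra.
exists n^-1, (n ^+ 3); split; [by rewrite invr_gt0|by rewrite exprn_gt0|].
have a0 : 0 < n^-1 + n ^+ 3 * s by rewrite addr_gt0 ?invr_gt0// mulr_gt0// exprn_gt0.
have n40 : 0 < n ^+ 4 by rewrite exprn_gt0.
have b0 : 0 < 1 + n ^+ 4 * s by rewrite addr_gt0// mulr_gt0.
rewrite -ln_div ?posrE ?invr_gt0//.
have -> : (n^-1 + n ^+ 3 * s) / n^-1 = 1 + n ^+ 4 * s by field; lra.
(* Comparing 1 + n^4 s with a square halves the exponent, so that ln (1 + x) <= x already gives
   growth n^2, below w = n^3. *)
have lnle : ln (1 + n ^+ 4 * s) <= 2 * (1 + n ^+ 2 * (1 + s)).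
  have c0 : 0 < 1 + n ^+ 2 * (1 + s).
    by rewrite addr_gt0// mulr_gt0 ?exprn_gt0//; lra.
  apply: (@le_trans _ _ (ln ((1 + n ^+ 2 * (1 + s)) ^+ 2))).
    rewrite ler_ln ?posrE ?exprn_gt0// -subr_ge0.
    rewrite (_ : _ - _ = 2 * (n ^+ 2 * (1 + s)) + n ^+ 4 * (1 + s + s ^+ 2)); last by ring.
    apply: addr_ge0; apply: mulr_ge0 => //.
    - by apply: mulr_ge0; [exact: sqr_ge0|lra].
    - exact: ltW.
    - by have := sqr_ge0 s; lra.
  rewrite [leLHS](_ : _ = 2 * ln (1 + n ^+ 2 * (1 + s))); last by rewrite lnXn// mulr_natl.
  rewrite ler_pM2l//.
  have h : ln (1 + n ^+ 2 * (1 + s)) <= n ^+ 2 * (1 + s).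
    by apply: le_ln1Dx; lra.
  lra.
have n30 : 0 < n ^+ 3 by rewrite exprn_gt0.
have : (n ^+ 3)^-1 * ln (1 + n ^+ 4 * s) <= (4 + 2 * s) / n.
  rewrite mulrC ler_pdivrMr//; apply: (le_trans lnle).
  rewrite (_ : (4 + 2 * s) / n * n ^+ 3 = 2 * (n ^+ 2 + n ^+ 2 * (1 + s))); last by field; lra.
  by rewrite ler_pM2l// lerD2r -[leLHS](expr1n _ 2%N) lerXn2r ?nnegrE// ltW.
rewrite [n^-1 * t]mulrC => h.
apply: (@le_lt_trans _ _ (2^-1 * ((4 + 2 * s) / n + t / n))).
  by rewrite ler_pM2l// lerD2r.
rewrite -mulrDl mulrA ltr_pdivrMr//.
have : r * n = r + (4 + 2 * s + t) by rewrite /n; field; lra.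
lra.
Qed.

Lemma causal_lengths_area (R : realType) (x y z : R) (l : \bar R) :
  causal_lengths (0, 0, 0) (x, y, z) l -> (0 < l)%E ->
  4 * `|z| < (x + y) * (x - y).
Proof.
move=> cl l0; have [s0 t0 lub] := causal_lengths_minkowski cl l0.
case: cl => T [g [u [T0 gc g0 gT lE]]].
have cal := length_le_calibration T0 gc g0 gT.
move: cal; rewrite -lE {lE}.
have : l \is a fin_num by rewrite ge0_fin_numE ?ltW//; apply: le_lt_trans lub (ltry _).
case: l l0 lub => [r| |]//; rewrite lte_fin => r0 lub _ cal.
have [k [w [k0 w0 kw]]] := small_calibration s0 t0 r0.
have kw0 : 0 < k + w * (x + y) by rewrite addr_gt0// mulr_gt0.
rewrite ltNge; apply/negP => zge.
have [zp|zn] := leP 0 z.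
  have := cal k w (lt0r_neq0 w0) k0 kw0; rewrite lee_fin.
  rewrite (ger0_norm zp) in zge.
  have : w / 2 * ((x + y) * (x - y) - 4 * z) <= 0.
    by rewrite mulr_ge0_le0//; lra.
  lra.
have wn : - w != 0 by rewrite oppr_eq0 lt0r_neq0.
(* Negative heights use the mirrored calibration, which descends from k + w (x + y) to k with slope
   - w. *)
have e1 : (k + w * (x + y)) + - w * (x + y) = k by ring.
have := cal (k + w * (x + y)) (- w) wn kw0; rewrite e1 lee_fin => /(_ k0).
rewrite invrN (ltr0_norm zn) in zge *.
have : w / 2 * (2 * ((x + y) * (x - y))) <= w / 2 * ((x + y) * (x - y) - 4 * z).
  by rewrite ler_pM2l ?divr_gt0//; lra.
rewrite (_ : w / 2 * (2 * ((x + y) * (x - y))) = w * (x + y) * (x - y)); last by field.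
rewrite !mulNr [(k + _) * _]mulrDl -mulrN opprB.
lra.
Qed.

Lemma time_separation_gt0_minkowski (R : realType) (x y z : R) :
  (0 < time_separation (0%R, 0%R, 0%R) (x, y, z))%E ->
  [/\ 0 < x + y, 0 < x - y & 4 * `|z| < (x + y) * (x - y)].
Proof.
move=> /time_separation_gt0[l cl l0].
have [s0 t0 _] := causal_lengths_minkowski cl l0.
by split=> //; exact: causal_lengths_area cl l0.
Qed.

Lemma time_separation_le_minkowski (R : realType) (x y z : R) :
  (time_separation (0%R, 0%R, 0%R) (x, y, z) <= (Num.sqrt ((x + y) * (x - y)))%:E)%E.
Proof.
apply: time_separation_le; first exact: sqrtr_ge0.
move=> l cl; have [l0|l0] := leP l 0%E.
  by apply: (le_trans l0); rewrite lee_fin sqrtr_ge0.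
by have [] := causal_lengths_minkowski cl l0.
Qed.

Lemma time_separation_le_calibration (R : realType) (x y z k w : R) :
  (0 < time_separation (0%R, 0%R, 0%R) (x, y, z))%E ->
  w != 0 -> 0 < k -> 0 < k + w * (x + y) ->
  (time_separation (0%R, 0%R, 0%R) (x, y, z) <=
    (2^-1 * (w^-1 * (ln (k + w * (x + y)) - ln k) + k * (x - y)
     + w / 2 * ((x + y) * (x - y) - 4 * z)))%:E)%E.
Proof.
move=> /time_separation_gt0[l0 cl0 l00] w0 k0 kw.
have ub l : causal_lengths (0, 0, 0) (x, y, z) l -> (l <=
    (2^-1 * (w^-1 * (ln (k + w * (x + y)) - ln k) + k * (x - y)
     + w / 2 * ((x + y) * (x - y) - 4 * z)))%:E)%E.
  by case=> T [g [u [T0 gc g0 gT ->]]]; exact: (length_le_calibration T0 gc g0 gT).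
apply: time_separation_le => //.
by have := lt_le_trans l00 (ub _ cl0); rewrite lte_fin => /ltW.
Qed.

(** * Hyperbolic inequalities *)

Lemma expR_cosh_gt (R : realType) (w : R) : w != 0 -> 2 < expR w + expR (- w).
Proof.
move=> w0; have e0 := expR_gt0 w.
rewrite -subr_gt0 (_ : _ - _ = (expR w - 1) ^+ 2 / expR w).
  by rewrite divr_gt0// exprn_even_gt0//= subr_eq0 -expR0 (inj_eq (@expR_inj R)).
by rewrite expRN; field; lra.
Qed.

Lemma MVT_gt0 (R : realType) (f df : R -> R) (w : R) : 0 < w ->
  (forall x, is_derive x (1 : R) f (df x)) -> (forall x, 0 < x -> 0 < df x) ->
  f 0 < f w.
Proof.
move=> w0 fd df0.
have [|c /[!in_itv]/= /andP[c0 cw]] := @MVT R f df 0 w w0 (fun x _ => fd x).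
  apply: continuous_subspaceT => x; apply: differentiable_continuous.
  by apply/derivable1_diffP; case: (fd x).
by rewrite subr0 -subr_gt0 => ->; rewrite mulr_gt0// df0.
Qed.

Lemma is_derive_expRM (R : realType) (w t : R) :
  is_derive t (1 : R) (fun x => expR (w * x)) (w * expR (w * t)).
Proof.
have d1 : is_derive t (1 : R) (fun x : R => w * x) w.
  by have := is_deriveZ w (is_derive_id t (1 : R)); rewrite /GRing.scale/= mulr1.
by have := @is_derive1_comp R (@expR R) _ t _ _ (is_derive_expR (w * t)) d1; rewrite mulrC.
Qed.

Lemma is_derive_expRN (R : realType) (t : R) :
  is_derive t (1 : R) (fun x => expR (- x)) (- expR (- t)).
Proof.
have := is_derive_expRM (-1) t; rewrite mulN1r.
by under eq_fun do rewrite mulN1r; rewrite mulN1r.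
Qed.

Lemma expR_sinh_gt (R : realType) (w : R) : 0 < w -> 0 < expR w - expR (- w) - 2 * w.
Proof.
move=> w0.
have := @MVT_gt0 R (fun x => expR x - expR (- x) - 2 * x)
  (fun x => expR x + expR (- x) - 2) w w0.
rewrite oppr0 mulr0 subrr subr0; apply=> [x|x x0].
  have := is_deriveB (is_deriveB (is_derive_expR x) (is_derive_expRN x))
    (is_deriveZ (2 : R) (is_derive_id x (1 : R))).
  by rewrite opprK /GRing.scale/= mulr1.
by rewrite subr_gt0 expR_cosh_gt// gt_eqF.
Qed.

(** Strictness makes the determinant [De] of [time_separation_ge_hyp] nonzero. *)
Lemma expR_cosh_gt_sqr (R : realType) (w : R) : w != 0 ->
  w ^+ 2 < expR w + expR (- w) - 2.
Proof.
wlog w0 : w / 0 < w => [hw w0|_].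
  have [/hw|] := ltP 0 w; first exact.
  rewrite le_eqVlt (negbTE w0) /= => wn.
  by have := hw (- w); rewrite oppr_gt0 oppr_eq0 sqrrN opprK (addrC (expR (- w))); apply.
have := @MVT_gt0 R (fun x => expR x + expR (- x) - x ^+ 2)
  (fun x => expR x - expR (- x) - 2 * x) w w0.
rewrite oppr0 expr0n /= expR0 subr0 => h.
suff : 1 + 1 < expR w + expR (- w) - w ^+ 2 by lra.
apply: h => x; last exact: expR_sinh_gt.
have := is_deriveB (is_deriveD (is_derive_expR x) (is_derive_expRN x))
  (is_deriveM (is_derive_id x (1 : R)) (is_derive_id x (1 : R))).
move=> h; apply: (is_derive_eq h).
change (expR x - expR (- x) - (x * 1 + x * 1) = expR x - expR (- x) - 2 * x).
ring.
Qed.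

Lemma expR_tanh_lt (R : realType) (w : R) : 0 < w ->
  expR w - expR (- w) < w * (expR w + expR (- w)).
Proof.
move=> w0.
have := @MVT_gt0 R (fun x => x * (expR x + expR (- x)) - (expR x - expR (- x)))
  (fun x => x * (expR x - expR (- x))) w w0.
rewrite oppr0 subrr mul0r subrr subr_gt0; apply=> [x|x x0].
  have := is_deriveB (is_deriveM (is_derive_id x (1 : R)) (is_deriveD (is_derive_expR x) (is_derive_expRN x)))
    (is_deriveB (is_derive_expR x) (is_derive_expRN x)).
  move=> h; apply: (is_derive_eq h).
  change (x * (expR x - expR (- x)) + (expR x + expR (- x)) * 1 -
    (expR x - - expR (- x)) = x * (expR x - expR (- x))).
  ring.
by rewrite mulr_gt0// subr_gt0 ltr_expR; lra.
Qed.

(** The odd function (sinh w - w) / (cosh w - 1) takes every value in ]-1, 1[. For a hyperbolic arc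
    it is the ratio 4 z / (s t), so every admissible height is attained. *)
Lemma hyperbolic_area_surjective (R : realType) (th : R) : th != 0 -> `|th| < 1 ->
  exists2 w : R, w != 0 &
    expR w - expR (- w) - 2 * w = th * (expR w + expR (- w) - 2).
Proof.
wlog th0 : th / 0 < th => [hw th0 th1|_].
  have [/hw|] := ltP 0 th; first exact.
  rewrite le_eqVlt (negbTE th0) /= => thn.
  have [] := hw (- th); rewrite ?oppr_gt0 ?oppr_eq0 ?normrN// => w w0 wE.
  exists (- w); rewrite ?oppr_eq0// opprK (addrC (expR (- w))).
  have : th * (expR w + expR (- w) - 2) = - (- th * (expR w + expR (- w) - 2)) by ring.
  lra.
rewrite gtr0_norm// => th1.
pose f (w : R) := expR w - expR (- w) - 2 * w - th * (expR w + expR (- w) - 2).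
(* Right end for the intermediate value theorem: exp b >= (b / 2)^2 gives (1 - th) exp b >= 4 b,
   which outweighs 2 b and the bounded terms. *)
pose b := 16 / (1 - th).
have b16 : 16 < b by rewrite /b ltr_pdivlMr; lra.
(* At w = th the terms - 2 w and 2 th cancel, and tanh th < th remains. *)
have fth : f th <= 0 by rewrite /f; have := expR_tanh_lt th0; lra.
have fb : 0 <= f b.
  have eb : (1 + b / 2) ^+ 2 <= expR b.
    rewrite (_ : expR b = expR (b / 2) ^+ 2); last first.
      by rewrite -expRM_natl; congr expR; field.
    by rewrite lerXn2r ?nnegrE ?expR_ge0 ?expR_ge1Dx//; lra.
  have enb : expR (- b) <= 1 by rewrite -[leRHS]expR0 ler_expR; lra.
  have eb2 : (1 - th) * (b / 2) ^+ 2 <= (1 - th) * expR b.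
    rewrite ler_pM2l ?subr_gt0//; apply: le_trans eb.
    by rewrite lerXn2r ?nnegrE//; lra.
  have : (1 - th) * (b / 2) ^+ 2 = 4 * b by rewrite /b; field; lra.
  have : th * expR (- b) <= 1 * 1 by apply: ler_pM => //; rewrite ?expR_ge0 ?ltW.
  rewrite /f; lra.
have cf : continuous f.
  move=> x; apply: differentiable_continuous; apply/derivable1_diffP.
  have := is_deriveB (is_deriveB (is_deriveB (is_derive_expR x) (is_derive_expRN x))
    (is_deriveZ (2 : R) (is_derive_id x (1 : R))))
    (is_deriveZ th (is_deriveB (is_deriveD (is_derive_expR x) (is_derive_expRN x)) (is_derive_cst (2 : R) x 1))).
  by case.
have thb : th <= b by lra.
have [|w /[!in_itv]/= /andP[w1 w2] fw] := @IVT R f th b 0 thb (continuous_subspaceT cf).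
  by rewrite ge_min le_max fth fb orbT.
by exists w; [rewrite gt_eqF//; lra|move: fw; rewrite /f; lra].
Qed.

(** * Lengths of continuously differentiable curves *)

Lemma is_derive_continuous (R : realType) (f df : R -> R) :
  (forall t, is_derive t (1 : R) f (df t)) -> continuous f.
Proof.
move=> fd x; apply: differentiable_continuous.
by apply/derivable1_diffP; case: (fd x).
Qed.

Lemma continuous_mul (R : realType) (f g : R -> R) :
  continuous f -> continuous g -> continuous (fun t => f t * g t).
Proof. by move=> cf cg t; apply: cvgM; [exact: cf|exact: cg]. Qed.

Lemma continuous_add (R : realType) (f g : R -> R) :
  continuous f -> continuous g -> continuous (fun t => f t + g t).
Proof. by move=> cf cg t; apply: cvgD; [exact: cf|exact: cg]. Qed.

Lemma continuous_sub (R : realType) (f g : R -> R) :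
  continuous f -> continuous g -> continuous (fun t => f t - g t).
Proof. by move=> cf cg t; apply: cvgB; [exact: cf|exact: cg]. Qed.

Lemma continuous_const (R : realType) (k : R) : continuous (fun _ : R => k).
Proof. by move=> t; exact: cvg_cst. Qed.

Lemma continuous_bounded01 (R : realType) (f : R -> R) : continuous f ->
  exists2 C : R, 0 <= C & forall x : R, 0 <= x <= 1 -> `|f x| <= C.
Proof.
move=> cf.
have [|c _ hc] := @EVT_max R (fun x => `|f x|) 0 1 ler01.
  apply: continuous_subspaceT => x.
  by apply: (continuous_comp (cf x)); exact: norm_continuous.
by exists `|f c| => // x x01; apply: hc; rewrite in_itv.
Qed.

Lemma C1_lipschitz (R : realType) (f df : R -> R) :
  (forall t, is_derive t (1 : R) f (df t)) -> continuous df ->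
  exists2 C : R, 0 <= C &
    forall x y : R, 0 <= x -> x <= y -> y <= 1 -> `|f y - f x| <= C * (y - x).
Proof.
move=> fd cdf; have [C C0 hC] := continuous_bounded01 cdf.
exists C => // x y x0 xy y1.
have [|c /[!in_itv]/= /andP[xc cy] ->] := @MVT_segment R f df x y xy (fun t _ => fd t).
  by apply: continuous_subspaceT; exact: is_derive_continuous fd.
rewrite normrM (@ger0_norm _ (y - x)) ?subr_ge0//.
by apply: ler_wpM2r; [rewrite subr_ge0|apply: hC; lra].
Qed.

(** With u1 = (al + be) / 2 and u2 = (al - be) / 2, the squared speed u1^2 - u2^2 is al be, and the
    equation for Z says that the curve is horizontal. *)
Lemma null_curve_length (R : realType) (S N Z al be : R -> R) :
  (forall t, is_derive t (1 : R) S (al t)) ->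
  (forall t, is_derive t (1 : R) N (be t)) ->
  (forall t, is_derive t (1 : R) Z (4^-1 * (N t * al t - S t * be t))) ->
  continuous al -> continuous be ->
  (forall t, 0 <= t <= 1 -> 0 < al t /\ 0 < be t) ->
  S 0 = 0 -> N 0 = 0 -> Z 0 = 0 ->
  causal_lengths (0, 0, 0) ((S 1 + N 1) / 2, (S 1 - N 1) / 2, Z 1)
    (\int[@lebesgue_measure R]_(t in `[0%R, 1%R]) (Num.sqrt (al t * be t))%:E)%E.
Proof.
move=> dS dN dZ cal cbe pos S0 N0 Z0.
pose g t : heis R := ((S t + N t) / 2, (S t - N t) / 2, Z t).
pose u t : R * R := ((al t + be t) / 2, (al t - be t) / 2).
have cS := is_derive_continuous dS.
have cN := is_derive_continuous dN.
have cdZ : continuous (fun t => 4^-1 * (N t * al t - S t * be t)).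
  apply: continuous_mul; first exact: continuous_const.
  by apply: continuous_sub; exact: continuous_mul.
have cu1 : continuous (fun t => (al t + be t) / 2).
  by apply: continuous_mul; [exact: continuous_add|exact: continuous_const].
have cu2 : continuous (fun t => (al t - be t) / 2).
  by apply: continuous_mul; [exact: continuous_sub|exact: continuous_const].
exists 1, g, u; split => //.
- have [C1 C10 h1] := C1_lipschitz dS cal.
  have [C2 C20 h2] := C1_lipschitz dN cbe.
  have [C3 C30 h3] := C1_lipschitz dZ cdZ.
  have [D1 D10 k1] := continuous_bounded01 cu1.
  have [D2 D20 k2] := continuous_bounded01 cu2.
  split.
    split.
    + move=> e e0; pose C := C1 + C2 + C3 + 1; have C0 : 0 < C by rewrite /C; lra.
      exists (e / C); first by rewrite divr_gt0.
      move=> n s t st _; rewrite ltr_pdivlMr// mulrC; apply: le_lt_trans.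
      rewrite mulr_sumr; apply: ler_sum => i _; have [a /ltW b c] := st i.
      have := h1 _ _ a b c; have := h2 _ _ a b c; have := h3 _ _ a b c.
      have d0 : 0 <= t i - s i by rewrite subr_ge0.
      have := mulr_ge0 C10 d0; have := mulr_ge0 C20 d0; have := mulr_ge0 C30 d0.
      move=> p3 p2 p1 q3 q2 q1.
      have e3 : `|S (t i) - S (s i) + (N (t i) - N (s i))| <= C1 * (t i - s i) + C2 * (t i - s i).
        by apply: (le_trans (ler_normD _ _)); lra.
      have e4 : `|S (t i) - S (s i) - (N (t i) - N (s i))| <= C1 * (t i - s i) + C2 * (t i - s i).
        by apply: (le_trans (ler_normB _ _)); lra.
      rewrite /C !mulrDl mul1r.
      apply: norm_heis_le => /=.
      * rewrite (_ : _ - _ = (S (t i) - S (s i) + (N (t i) - N (s i))) / 2); last by field.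
        by rewrite normrM (@ger0_norm _ 2^-1)//; lra.
      * rewrite (_ : _ - _ = (S (t i) - S (s i) - (N (t i) - N (s i))) / 2); last by field.
        by rewrite normrM (@ger0_norm _ 2^-1)//; lra.
      * lra.
    + split.
        apply: measurable_funTS; apply/measurable_fun_pairP; split.
          exact: continuous_measurable_fun.
        exact: continuous_measurable_fun.
      exists (D1 + D2); apply: aeW => t; rewrite /= in_itv/= => tT.
      rewrite [leLHS]/Num.norm/= ge_max.
      by have := k1 _ tT; have := k2 _ tT; lra.
    + apply: aeW => t tT; rewrite heis_velocityE; apply/is_derive_heisP; split.
      * rewrite (_ : (fun _ => _) = 2^-1 *: (S + N)); last first.
          apply/funext => r.
          by change ((S r + N r) / 2 = 2^-1 * (S r + N r)); rewrite mulrC.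
        apply: (is_derive_eq (is_deriveZ 2^-1 (is_deriveD (dS t) (dN t)))).
        by change (2^-1 * (al t + be t) = (al t + be t) / 2); rewrite mulrC.
      * rewrite (_ : (fun _ => _) = 2^-1 *: (S - N)); last first.
          apply/funext => r.
          by change ((S r - N r) / 2 = 2^-1 * (S r - N r)); rewrite mulrC.
        apply: (is_derive_eq (is_deriveZ 2^-1 (is_deriveB (dS t) (dN t)))).
        by change (2^-1 * (al t - be t) = (al t - be t) / 2); rewrite mulrC.
      * by apply: (is_derive_eq (dZ t)) => /=; field.
  apply: aeW => t; rewrite /= in_itv/= => /pos[a0 b0].
  by rewrite ler_norml; lra.
- by rewrite /g S0 N0 Z0 addr0 subr0 mul0r.
- apply: eq_integral => t _; congr (EFin (Num.sqrt _)); rewrite /u /=; by field.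
Qed.

Lemma le_integral01 (R : realType) (H h f : R -> R) :
  (forall t, is_derive t (1 : R) H (h t)) -> continuous h -> continuous f ->
  (forall t, 0 <= t <= 1 -> h t <= f t) ->
  ((H 1 - H 0)%:E <= \int[@lebesgue_measure R]_(t in `[0%R, 1%R]) (f t)%:E)%E.
Proof.
move=> dH ch cf hf.
have cH := is_derive_continuous dH.
have E := @continuous_FTC2 R h H 0 1 ltr01 (continuous_subspaceT ch).
rewrite EFinB -E; last 2 first.
- split; first by move=> x _; case: (dH x).
    exact: cvg_at_right_filter (cH 0).
  exact: cvg_at_left_filter (cH 1).
- by move=> x _; rewrite derive1E; case: (dH x).
apply: le_integral => //.
- apply: continuous_compact_integrable; first exact: segment_compact.
  exact: continuous_subspaceT.
- apply: continuous_compact_integrable; first exact: segment_compact.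
  exact: continuous_subspaceT.
- by move=> t; rewrite inE /= in_itv/= => tT; rewrite lee_fin; exact: hf.
Qed.

(** For q = sqrt P the defect is exactly (q - m)^2 (q^2 + 2 q m) / (2 m^3), so the bound holds for
    all P >= 0 and not only near m^2. *)
Lemma sqrt_ge_tangent (R : realType) (m P : R) : 0 < m -> 0 <= P ->
  m + (P - m ^+ 2) / (2 * m) - (P - m ^+ 2) ^+ 2 / (2 * m ^+ 3) <= Num.sqrt P.
Proof.
move=> m0 P0; set q := Num.sqrt P.
have q0 : 0 <= q by rewrite sqrtr_ge0.
have -> : P = q ^+ 2 by rewrite sqr_sqrtr.
rewrite -subr_ge0 (_ : _ - _ = (q - m) ^+ 2 * (q ^+ 2 + 2 * q * m) / (2 * m ^+ 3)).
  rewrite divr_ge0//; last by rewrite mulr_ge0// exprn_ge0// ltW.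
  by rewrite mulr_ge0 ?sqr_ge0// addr_ge0 ?sqr_ge0// mulr_ge0 ?mulr_ge0// ltW.
by field; lra.
Qed.

(** * Lower bounds by explicit curves *)

(* With [c = 0] these are the arcs of hyperbolas maximising the length for a
   prescribed area; [b] and [c] parametrise the remaining two endpoint
   coordinates. *)
Section HyperbolicCurve.
Variables (R : realType) (w a b c : R).
Hypothesis w0 : w != 0.

(** Final values of S, N and Z on the curve from the identity with S' = a exp(w t) and N' = b exp(-
    w t) + c on [0, 1]. *)
Definition hyp_s : R := a * (expR w - 1) / w.
Definition hyp_t : R := b * (1 - expR (- w)) / w + c.
Definition hyp_z : R := a / 4 * (b * (expR w - expR (- w) - 2 * w) / w ^+ 2 +
  c * (expR w / w - 2 * (expR w - 1) / w ^+ 2 + w^-1)).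

(** Both sides are the integral of S' N'. The left one is direct; the right one uses S' = a + w S
    and 2 S N' = (S N - 4 Z)'. *)
Lemma hyp_identity : a * b + a * c * (expR w - 1) / w =
  a * hyp_t + w / 2 * (hyp_s * hyp_t - 4 * hyp_z).
Proof.
rewrite /hyp_s /hyp_t /hyp_z expRN.
field.
by rewrite w0 gt_eqF ?expR_gt0.
Qed.

(** The length integrand is sqrt(S' N'). Its tangent at m^2 only involves the integral of S' N',
    which [hyp_identity] expresses through the endpoint; [dl] bounds the deviation of S' N' from
    m^2. *)
Lemma hyperbolic_curve (m dl : R) : 0 < m -> 0 < a ->
  (forall t, 0 <= t <= 1 -> 0 < b * expR (- w * t) + c) ->
  (forall t, 0 <= t <= 1 -> `|a * b + a * c * expR (w * t) - m ^+ 2| <= dl) ->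
  exists2 l, causal_lengths (0, 0, 0)
     ((hyp_s + hyp_t) / 2, (hyp_s - hyp_t) / 2, hyp_z) l &
   ((m / 2 + (a * hyp_t + w / 2 * (hyp_s * hyp_t - 4 * hyp_z)) / (2 * m)
     - dl ^+ 2 / (2 * m ^+ 3))%:E <= l)%E.
Proof.
move=> m0 a0 bc dlP.
pose al t := a * expR (w * t).
pose be t := b * expR (- w * t) + c.
pose S t := a / w * (expR (w * t) - 1).
pose N t := b / w * (1 - expR (- w * t)) + c * t.
pose Z t := 4^-1 * (a * b / w * ((expR (w * t) - 1) / w - 2 * t + (1 - expR (- w * t)) / w)
  + a * c * (t * expR (w * t) / w - (expR (w * t) - 1) / w ^+ 2)
  - a * c / w * ((expR (w * t) - 1) / w - t)).
have dE t : is_derive t (1 : R) (fun t => expR (w * t)) (w * expR (w * t)) := is_derive_expRM w t.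
have dE' t : is_derive t (1 : R) (fun t => expR (- w * t)) (- w * expR (- w * t)) := is_derive_expRM (- w) t.
have d1 t : is_derive t (1 : R) (fun t : R => t) 1 := is_derive_id t (1 : R).
have dcst (k t : R) : is_derive t (1 : R) (cst k) 0 := is_derive_cst k t (1 : R).
have dS t : is_derive t (1 : R) S (al t).
  apply: (is_derive_eq (is_deriveZ (a / w) (is_deriveB (dE t) (dcst 1 t)))).
  by rewrite /GRing.scale/= /al; field.
have dN t : is_derive t (1 : R) N (be t).
  apply: (is_derive_eq (is_deriveD (is_deriveZ (b / w) (is_deriveB (dcst 1 t) (dE' t)))
    (is_deriveZ c (d1 t)))).
  by rewrite /GRing.scale/= /be; field.
have EE t : expR (- w * t) = (expR (w * t))^-1 by rewrite mulNr expRN.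
have dZ t : is_derive t (1 : R) Z (4^-1 * (N t * al t - S t * be t)).
  pose A := is_deriveB (dE t) (dcst 1 t).
  pose A' := is_deriveB (dcst 1 t) (dE' t).
  pose H := is_deriveZ 4^-1 (is_deriveB (is_deriveD
    (is_deriveZ (a * b / w) (is_deriveD (is_deriveB (is_deriveZ w^-1 A) (is_deriveZ (2 : R) (d1 t))) (is_deriveZ w^-1 A')))
    (is_deriveZ (a * c) (is_deriveB (is_deriveZ w^-1 (is_deriveM (d1 t) (dE t))) (is_deriveZ (w ^+ 2)^-1 A))))
    (is_deriveZ (a * c / w) (is_deriveB (is_deriveZ w^-1 A) (d1 t)))).
  have ZE : Z = 4^-1 *: (a * b / w *: (w^-1 *: ((fun t => expR (w * t)) - cst 1) - (2 : R) *: (fun t : R => t)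
      + w^-1 *: (cst 1 - (fun t => expR (- w * t))))
    + (a * c) *: (w^-1 *: ((fun t : R => t) * (fun t => expR (w * t))) - (w ^+ 2)^-1 *: ((fun t => expR (w * t)) - cst 1))
    - (a * c / w) *: (w^-1 *: ((fun t => expR (w * t)) - cst 1) - (fun t : R => t))).
    apply/funext => r.
    change (Z r = 4^-1 * (a * b / w * (w^-1 * (expR (w * r) - 1) - 2 * r
      + w^-1 * (1 - expR (- w * r)))
      + (a * c) * (w^-1 * (r * expR (w * r)) - (w ^+ 2)^-1 * (expR (w * r) - 1))
      - (a * c / w) * (w^-1 * (expR (w * r) - 1) - r))).
    by rewrite /Z; field.
  rewrite ZE; apply: (is_derive_eq H).
  change (4^-1 * (a * b / w * (w^-1 * (w * expR (w * t) - 0) - 2 * 1 + w^-1 * (0 - - w * expR (- w * t)))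
    + a * c * (w^-1 * (t * (w * expR (w * t)) + expR (w * t) * 1) - (w ^+ 2)^-1 * (w * expR (w * t) - 0))
    - a * c / w * (w^-1 * (w * expR (w * t) - 0) - 1)) = 4^-1 * (N t * al t - S t * be t)).
  rewrite /N /al /S /be EE; field.
  by rewrite w0 gt_eqF ?expR_gt0.
have cE : continuous (fun t => expR (w * t)) := is_derive_continuous dE.
have cE' : continuous (fun t => expR (- w * t)) := is_derive_continuous dE'.
have cal : continuous al.
  by apply: continuous_mul; [exact: continuous_const|exact: cE].
have cbe : continuous be.
  apply: continuous_add; last exact: continuous_const.
  by apply: continuous_mul; [exact: continuous_const|exact: cE'].
have pos t : 0 <= t <= 1 -> 0 < al t /\ 0 < be t.
  by move=> tT; split; [rewrite mulr_gt0 ?expR_gt0|exact: bc].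
have S0 : S 0 = 0 by rewrite /S mulr0 expR0 subrr mulr0.
have N0 : N 0 = 0 by rewrite /N !mulr0 expR0 subrr mulr0 addr0.
have Z0 : Z 0 = 0 by rewrite /Z !mulr0 expR0; field.
have S1 : S 1 = hyp_s by rewrite /S mulr1 /hyp_s; field.
have N1 : N 1 = hyp_t by rewrite /N !mulr1 /hyp_t; field.
have Z1 : Z 1 = hyp_z by rewrite /Z !mulr1 /hyp_z; field.
have := null_curve_length dS dN dZ cal cbe pos S0 N0 Z0; rewrite S1 N1 Z1 => cl.
exists (\int[@lebesgue_measure R]_(t in `[0%R, 1%R]) (Num.sqrt (al t * be t))%:E)%E => //.
rewrite -hyp_identity.
(* K + L exp(w t) is the tangent bound for sqrt(S' N') with the deviation replaced by [dl]; H is its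
   primitive. *)
pose K := m / 2 + a * b / (2 * m) - dl ^+ 2 / (2 * m ^+ 3).
pose L := a * c / (2 * m).
pose H t := K * t + L / w * expR (w * t).
have dH t : is_derive t (1 : R) H (K + L * expR (w * t)).
  apply: (is_derive_eq (is_deriveD (is_deriveZ K (d1 t)) (is_deriveZ (L / w) (dE t)))).
  by rewrite /GRing.scale/=; field.
have := @le_integral01 R H (fun t => K + L * expR (w * t)) (fun t => Num.sqrt (al t * be t)) dH.
have -> : H 1 - H 0 = m / 2 + (a * b + a * c * (expR w - 1) / w) / (2 * m) - dl ^+ 2 / (2 * m ^+ 3).
  rewrite /H /K /L !mulr1 !mulr0 expR0; field.
  by rewrite w0 gt_eqF.
apply.
- apply: continuous_add; first exact: continuous_const.
  by apply: continuous_mul; [exact: continuous_const|exact: cE].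
- move=> t; apply: (@continuous_comp _ _ _ (fun t => al t * be t) (@Num.sqrt R)).
    exact: (continuous_mul cal cbe).
  exact: sqrt_continuous.
move=> t tT; have [a1 b1] := pos t tT.
have PE : al t * be t = a * b + a * c * expR (w * t).
  rewrite /al /be EE; field.
  by rewrite gt_eqF ?expR_gt0.
have P0 : 0 <= al t * be t by rewrite mulr_ge0// ltW.
apply: le_trans (sqrt_ge_tangent m0 P0); rewrite PE.
set D := a * b + a * c * expR (w * t) - m ^+ 2.
have Ddl : D ^+ 2 / (2 * m ^+ 3) <= dl ^+ 2 / (2 * m ^+ 3).
  rewrite ler_pM2r ?invr_gt0 ?mulr_gt0 ?exprn_gt0//.
  by rewrite -(real_normK (num_real D)) lerXn2r ?nnegrE ?(le_trans _ (dlP t tT))//; exact: dlP.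
apply: (@le_trans _ _ (m + D / (2 * m) - dl ^+ 2 / (2 * m ^+ 3))); last by lra.
rewrite le_eqVlt; apply/orP; left; apply/eqP; rewrite /D /K /L; field.
by rewrite gt_eqF.
Qed.

End HyperbolicCurve.

Lemma expR_slope_gt0 (R : realType) (w : R) : w != 0 -> 0 < (expR w - 1) / w.
Proof.
move=> w0; have [wp|] := ltP 0 w.
  by rewrite divr_gt0// subr_gt0 -expR0 ltr_expR.
rewrite le_eqVlt (negbTE w0) /= => wn.
by rewrite -mulrNN -invrN mulr_gt0 ?invr_gt0 ?oppr_gt0// subr_lt0 -[ltRHS]expR0 ltr_expR.
Qed.

(** For c = 0 the ratio 4 z / (s t) depends on w only, so [hyperbolic_area_surjective] provides w;
    then a and b are scaled to give s0 and t0. *)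
Lemma maximizer_parameters (R : realType) (s0 t0 z0 : R) :
  0 < s0 -> 0 < t0 -> z0 != 0 -> 4 * `|z0| < s0 * t0 ->
  exists w a b : R, [/\ w != 0, 0 < a, 0 < b &
    [/\ hyp_s w a = s0, hyp_t w b 0 = t0 & hyp_z w a b 0 = z0]].
Proof.
move=> s00 t00 z00 zst.
have st0 : 0 < s0 * t0 by exact: mulr_gt0.
have [||w w0 wE] := @hyperbolic_area_surjective R (4 * z0 / (s0 * t0)).
- by apply: mulf_neq0; [apply: mulf_neq0 => //; rewrite pnatr_eq0|rewrite invr_eq0 (gt_eqF st0)].
- by rewrite normrM normfV (gtr0_norm st0) ltr_pdivrMr// mul1r normrM (@ger0_norm _ 4).
have e1 := expR_slope_gt0 w0.
have e2 : 0 < (1 - expR (- w)) / w.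
  have wn0 : - w != 0 by rewrite oppr_eq0.
  by have := expR_slope_gt0 wn0; rewrite invrN mulrN -mulNr opprB.
have ew := expR_gt0 w.
have n1 : expR w - 1 != 0 by apply: contraTN e1 => /eqP ->; rewrite mul0r ltxx.
have n2 : 1 - expR (- w) != 0 by apply: contraTN e2 => /eqP ->; rewrite mul0r ltxx.
exists w, (s0 / ((expR w - 1) / w)), (t0 / ((1 - expR (- w)) / w)).
split => //; try exact: divr_gt0.
split.
- by rewrite /hyp_s; field; rewrite w0 n1.
- by rewrite /hyp_t; field; rewrite w0 n2.
rewrite /hyp_z mul0r addr0 wE.
have n3 : expR w + expR (- w) - 2 != 0.
  by rewrite gt_eqF// subr_gt0 expR_cosh_gt.
have E : expR w + expR (- w) - 2 = (expR w - 1) * (1 - expR (- w)).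
  by rewrite expRN; field; rewrite gt_eqF.
rewrite E; field.
by rewrite w0 n1 n2 !gt_eqF.
Qed.

(** The calibration with parameters a / m and w / m is f = S' / m = sqrt(S' / N') along the arc,
    where AM-GM is an equality; the bound it gives is therefore the length m of the arc. *)
Lemma time_separation_le_hyp (R : realType) (w a b x y z : R) :
  w != 0 -> 0 < a -> 0 < b ->
  hyp_s w a = x + y -> hyp_t w b 0 = x - y -> hyp_z w a b 0 = z ->
  (0 < time_separation (0%R, 0%R, 0%R) (x, y, z))%E ->
  (time_separation (0%R, 0%R, 0%R) (x, y, z) <= (Num.sqrt (a * b))%:E)%E.
Proof.
move=> w0 a0 b0 sE tE zE tau0.
set m := Num.sqrt (a * b).
have m0 : 0 < m by rewrite sqrtr_gt0 mulr_gt0.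
have m2 : m ^+ 2 = a * b by rewrite sqr_sqrtr// mulr_ge0// ltW.
have k0 : 0 < a / m by rewrite divr_gt0.
have wm0 : w / m != 0 by rewrite mulf_neq0// invr_eq0 gt_eqF.
have kw : a / m + w / m * (x + y) = a / m * expR w.
  by rewrite -sE /hyp_s; field; rewrite w0 gt_eqF.
have kw0 : 0 < a / m + w / m * (x + y) by rewrite kw mulr_gt0 ?expR_gt0.
apply: le_trans (time_separation_le_calibration tau0 wm0 k0 kw0) _.
rewrite kw lnM ?posrE ?expR_gt0// expRK lee_fin.
have := hyp_identity a b 0 w0.
rewrite mulr0 !mul0r addr0 sE tE zE -m2 => mE.
rewrite (_ : 2^-1 * _ = 2^-1 * (m + m^-1 * (a * (x - y) + w / 2 * ((x + y) * (x - y) - 4 * z)))).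
  by rewrite -mE le_eqVlt; apply/orP; left; apply/eqP; field; rewrite gt_eqF.
by field; rewrite w0 gt_eqF.
Qed.

Lemma expR_le_norm (R : realType) (w t : R) : 0 <= t <= 1 -> expR (w * t) <= expR `|w|.
Proof.
move=> /andP[t0 t1]; rewrite ler_expR; apply: (le_trans (ler_norm _)).
by rewrite normrM (ger0_norm t0) ler_piMr.
Qed.

(** Endpoints near that of the arc are reached by curves with nearby parameters a, b and small c.
    Since S' N' = m^2 on the arc itself, its deviation is O(rho), and it enters the length bound
    squared. *)
Lemma time_separation_ge_hyp (R : realType) (w a0 b0 : R) :
  w != 0 -> 0 < a0 -> 0 < b0 ->
  let s0 := hyp_s w a0 in let t0 := hyp_t w b0 0 in let z0 := hyp_z w a0 b0 0 in
  let m := Num.sqrt (a0 * b0) in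
  exists K r : R, [/\ 0 <= K, 0 < r & forall s t z : R,
    let rho := `|s - s0| + `|t - t0| + `|z - z0| in rho < r ->
    ((m / 2 + (a0 / s0 * s * t + w / 2 * (s * t - 4 * z)) / (2 * m) - K * rho ^+ 2)%:E
      <= time_separation (0%R, 0%R, 0%R) (((s + t) / 2)%R, ((s - t) / 2)%R, z))%E].
Proof.
move=> w0 a00 b00 s0 t0 z0 m.
have m0 : 0 < m by rewrite sqrtr_gt0 mulr_gt0.
have m2 : m ^+ 2 = a0 * b0 by rewrite sqr_sqrtr// mulr_ge0// ltW.
have ew := expR_gt0 w.
pose E1 := (expR w - 1) / w; have E10 : 0 < E1 := expR_slope_gt0 w0.
pose T1 := (1 - expR (- w)) / w.
have T10 : 0 < T1.
  have wn0 : - w != 0 by rewrite oppr_eq0.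
  by have := expR_slope_gt0 wn0; rewrite invrN mulrN -mulNr opprB.
pose P := (expR w - expR (- w) - 2 * w) / w ^+ 2.
pose Q := expR w / w - 2 * (expR w - 1) / w ^+ 2 + w^-1.
(* Once a = s / E1 is known, b and c solve the linear system b T1 + c = t, b P + c Q = v with v = 4
   z / a, of determinant De. *)
pose De := T1 * Q - P.
have De0 : De != 0.
  rewrite (_ : De = 2 / w ^+ 3 * (w ^+ 2 - (expR w + expR (- w) - 2))).
    rewrite mulf_neq0 ?mulf_neq0 ?invr_eq0 ?expf_neq0//.
    by rewrite lt_eqF// subr_lt0 expR_cosh_gt_sqr.
  by rewrite /De /T1 /Q /P expRN; field; rewrite w0 gt_eqF.
have hsE a' : hyp_s w a' = a' * E1 by rewrite /hyp_s /E1 mulrA.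
have htE b' c' : hyp_t w b' c' = b' * T1 + c' by rewrite /hyp_t /T1 mulrA.
have hzE a' b' c' : hyp_z w a' b' c' = a' / 4 * (b' * P + c' * Q).
  by rewrite /hyp_z /P /Q mulrA.
have s0E : s0 = a0 * E1 by rewrite /s0 hsE.
have t0E : t0 = b0 * T1 by rewrite /t0 htE addr0.
have z0E : z0 = a0 / 4 * (b0 * P) by rewrite /z0 hzE mul0r addr0.
have DeE : T1 * Q - P = De by [].
pose M := expR `|w|.
have M0 : 0 < M := expR_gt0 _.
have M1 r : 0 <= r <= 1 -> expR (w * r) <= M by exact: expR_le_norm.
have M2 r : 0 <= r <= 1 -> expR (- w * r) <= M by rewrite /M -normrN; exact: expR_le_norm.
have M3 r : 0 <= r <= 1 -> M^-1 <= expR (- w * r).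
  by move=> r01; rewrite mulNr expRN lef_pV2 ?posrE ?expR_gt0// expR_le_norm.
clearbody s0 t0 z0 m E1 T1 P Q De M.
have s00 : 0 < s0 by rewrite s0E mulr_gt0.
pose v0 := b0 * P.
(* Lipschitz constants at the base point, with respect to rho, of v, b, c and the deviation of S' N'
   from m^2. *)
pose Kv := 8 * E1 * (s0 + `|z0|) / s0 ^+ 2.
pose Kb := (`|Q| + Kv) / `|De|.
pose Kc := (T1 * Kv + `|P|) / `|De|.
pose Kd := 3 * a0 / 2 * (Kb + Kc * M) + b0 / E1.
have Kv0 : 0 <= Kv.
  apply: divr_ge0; last exact: sqr_ge0.
  apply: mulr_ge0; first by apply: mulr_ge0 => //; exact: ltW.
  by apply: addr_ge0 => //; exact: ltW.
have Kb0 : 0 <= Kb by rewrite divr_ge0 ?addr_ge0.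
have Kc0 : 0 <= Kc.
  apply: divr_ge0 => //; apply: addr_ge0 => //; apply: mulr_ge0 => //; exact: ltW.
have Kd0 : 0 <= Kd.
  have KcM : 0 <= Kc * M by apply: mulr_ge0 => //; exact: ltW.
  apply: addr_ge0; last by apply: divr_ge0; exact: ltW.
  apply: mulr_ge0; last exact: addr_ge0.
  by apply: divr_ge0 => //; apply: mulr_ge0 => //; exact: ltW.
have KvE : Kv = 8 * E1 * (s0 + `|z0|) / s0 ^+ 2 by [].
have KbE : Kb = (`|Q| + Kv) / `|De| by [].
have KcE : Kc = (T1 * Kv + `|P|) / `|De| by [].
have KdE : Kd = 3 * a0 / 2 * (Kb + Kc * M) + b0 / E1 by [].
clearbody Kv Kb Kc Kd.
(* The first bound on rho keeps s between s0 / 2 and 3 s0 / 2, the second keeps N' positive on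
   [0, 1]. *)
exists (Kd ^+ 2 / (2 * m ^+ 3)), (Num.min (s0 / 2) (b0 / M / (Kb * M + Kc + 1))).
have den0 : 0 < Kb * M + Kc + 1.
  by have := mulr_ge0 Kb0 (ltW M0); lra.
split.
- by rewrite divr_ge0 ?sqr_ge0// mulr_ge0// exprn_ge0// ltW.
- by rewrite lt_min divr_gt0//= !divr_gt0.
move=> s t z rho; rewrite lt_min => /andP[rs rb].
have rho0 : 0 <= rho by rewrite !addr_ge0.
have ds : `|s - s0| <= rho.
  by clear; have := normr_ge0 (t - t0); have := normr_ge0 (z - z0); rewrite /rho; lra.
have dt : `|t - t0| <= rho.
  by clear; have := normr_ge0 (s - s0); have := normr_ge0 (z - z0); rewrite /rho; lra.
have dz : `|z - z0| <= rho.
  by clear; have := normr_ge0 (s - s0); have := normr_ge0 (t - t0); rewrite /rho; lra.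
have [sl su] : s0 / 2 < s /\ s < 3 * s0 / 2.
  by clear -ds rs; move: ds; rewrite ler_norml => /andP[]; lra.
have sp : 0 < s by clear -sl s00; lra.
pose a := s / E1; pose v := 4 * z / a.
pose b := (t * Q - v) / De; pose c := (T1 * v - P * t) / De.
have a_gt0 : 0 < a by rewrite divr_gt0.
have hs : hyp_s w a = s.
  by rewrite hsE /a; field; rewrite gt_eqF.
have ht : hyp_t w b c = t.
  rewrite htE (_ : b * T1 + c = t * ((T1 * Q - P) / De)); last first.
    by rewrite /b /c; field.
  by rewrite DeE divff// mulr1.
have hz : hyp_z w a b c = z.
  rewrite hzE (_ : b * P + c * Q = v * ((T1 * Q - P) / De)); last first.
    by rewrite /b /c; field.
  by rewrite DeE divff// mulr1 /v; field; rewrite gt_eqF.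
have dv : `|v - v0| <= Kv * rho.
  have v0E : v0 = 4 * z0 / a0 by rewrite z0E /v0; field; rewrite gt_eqF.
  have -> : v - v0 = 4 * E1 * ((z - z0) * s0 - z0 * (s - s0)) / (s * s0).
    by rewrite v0E /v /a s0E; field; rewrite !gt_eqF.
  rewrite normrM normfV (gtr0_norm (mulr_gt0 sp s00)) ler_pdivrMr ?mulr_gt0//.
  rewrite normrM gtr0_norm ?mulr_gt0//.
  have h1 : `|(z - z0) * s0 - z0 * (s - s0)| <= rho * (s0 + `|z0|).
    apply: (le_trans (ler_normB _ _)); rewrite !normrM (gtr0_norm s00).
    rewrite mulrDr [X in _ <= _ + X]mulrC; apply: lerD.
      by rewrite ler_pM2r.
    exact: ler_wpM2l.
  apply: (@le_trans _ _ (4 * E1 * (rho * (s0 + `|z0|)))).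
    by rewrite ler_pM2l// mulr_gt0.
  have -> : Kv * rho * (s * s0) = 4 * E1 * (rho * (s0 + `|z0|)) * (2 * s / s0).
    by rewrite KvE; field; rewrite gt_eqF.
  rewrite ler_peMr//; last by rewrite ler_pdivlMr//; clear -sl; lra.
  by rewrite !mulr_ge0 ?addr_ge0// ltW.
have db : `|b - b0| <= Kb * rho.
  have -> : b - b0 = ((t - t0) * Q - (v - v0)) / De.
    rewrite (_ : b - b0 = (t * Q - v - b0 * (T1 * Q - P)) / De).
      by rewrite /v0 t0E; field.
    by rewrite DeE /b; field.
  rewrite normrM normfV KbE mulrAC ler_pM2r ?invr_gt0 ?normr_gt0//.
  apply: (le_trans (ler_normB _ _)); rewrite normrM mulrDl mulrC; apply: lerD => //.
  exact: ler_wpM2l.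
have dc : `|c| <= Kc * rho.
  have -> : c = (T1 * (v - v0) - P * (t - t0)) / De.
    by rewrite /c /v0 t0E; field.
  rewrite normrM normfV KcE mulrAC ler_pM2r ?invr_gt0 ?normr_gt0//.
  apply: (le_trans (ler_normB _ _)); rewrite !normrM mulrDl (gtr0_norm T10); apply: lerD.
    by rewrite -mulrA ler_pM2l.
  exact: ler_wpM2l.
have a_le : a <= 3 * a0 / 2.
  rewrite /a ler_pdivrMr// (_ : _ * E1 = 3 * s0 / 2); first by clear -su; lra.
  by rewrite s0E; field.
have da : `|a - a0| <= rho / E1.
  rewrite (_ : a - a0 = (s - s0) / E1); last by rewrite /a s0E; field; rewrite gt_eqF.
  by rewrite normrM normfV (gtr0_norm E10) ler_pM2r ?invr_gt0.
have bc r : 0 <= r <= 1 -> 0 < b * expR (- w * r) + c.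
  move=> r01.
  have u1 := M2 r r01.
  have u2 := M3 r r01.
  have u3 : `|(b - b0) * expR (- w * r)| <= Kb * rho * M.
    by rewrite normrM; apply: ler_pM => //; rewrite ger0_norm ?expR_ge0.
  have u4 : b0 / M <= b0 * expR (- w * r) by rewrite ler_pM2l.
  have u5 : rho * (Kb * M + Kc + 1) < b0 / M by rewrite -ltr_pdivlMr.
  move: u3 dc; rewrite !ler_norml => /andP[u3 _] /andP[u6 _].
  have -> : b * expR (- w * r) + c = b0 * expR (- w * r) + (b - b0) * expR (- w * r) + c by ring.
  have : rho * (Kb * M + Kc + 1) = Kb * rho * M + Kc * rho + rho by ring.
  clear -u3 u4 u5 u6 rho0; lra.
have dlP r : 0 <= r <= 1 -> `|a * b + a * c * expR (w * r) - m ^+ 2| <= Kd * rho.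
  move=> r01; rewrite m2.
  have u1 := M1 r r01.
  rewrite (_ : _ - _ = a * (b - b0) + a * c * expR (w * r) + b0 * (a - a0)); last by ring.
  have u2 : `|a * (b - b0)| <= 3 * a0 / 2 * (Kb * rho).
    by rewrite normrM (gtr0_norm a_gt0); apply: ler_pM => //; exact: ltW.
  have u3 : `|a * c * expR (w * r)| <= 3 * a0 / 2 * (Kc * rho) * M.
    rewrite normrM (gtr0_norm (expR_gt0 _)); apply: ler_pM => //.
    by rewrite normrM (gtr0_norm a_gt0); apply: ler_pM => //; exact: ltW.
  have u4 : `|b0 * (a - a0)| <= b0 * (rho / E1).
    by rewrite normrM (gtr0_norm b00) ler_pM2l.
  have -> : Kd * rho = 3 * a0 / 2 * (Kb * rho) + 3 * a0 / 2 * (Kc * rho) * M + b0 * (rho / E1).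
    by rewrite KdE; ring.
  apply: (le_trans (ler_normD _ _)); apply: lerD => //.
  by apply: (le_trans (ler_normD _ _)); apply: lerD.
have [l cl] := hyperbolic_curve w0 m0 a_gt0 bc dlP.
rewrite hs ht hz in cl *.
move=> /le_trans; have := time_separation_ge cl => tl /(_ _ tl).
apply: le_trans; rewrite lee_fin le_eqVlt; apply/orP; left; apply/eqP.
have -> : a0 / s0 = E1^-1 by rewrite s0E; field; rewrite !gt_eqF.
by rewrite /a; field; rewrite !gt_eqF.
Qed.

Lemma sqr_sum3_le (R : realType) (a b c k1 k2 k3 : R) :
  (k1 * a + k2 * b + k3 * c) ^+ 2 <=
  (k1 ^+ 2 + k2 ^+ 2 + k3 ^+ 2) * (a ^+ 2 + b ^+ 2 + c ^+ 2).
Proof.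
rewrite -subr_ge0 (_ : _ - _ = (k1 * b - k2 * a) ^+ 2 + (k1 * c - k3 * a) ^+ 2 +
  (k2 * c - k3 * b) ^+ 2); last by ring.
by rewrite !addr_ge0 ?sqr_ge0.
Qed.

Lemma time_separation_quadratic (R : realType) (x0 y0 z0 : R) :
  (0 < time_separation (0%R, 0%R, 0%R) (x0, y0, z0))%E -> z0 != 0 ->
  exists m A B k C r : R, [/\ 0 < m, k != 0, 0 <= C, 0 < r &
   (time_separation (0%R, 0%R, 0%R) (x0, y0, z0) <= m%:E)%E /\
   forall dx dy dz : R, `|dx| < r -> `|dy| < r -> `|dz| < r ->
    ((m + A * dx + B * dy + k * dz - C * (dx ^+ 2 + dy ^+ 2 + dz ^+ 2))%:E <=
     time_separation (0%R, 0%R, 0%R) ((x0 + dx)%R, (y0 + dy)%R, (z0 + dz)%R))%E].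
Proof.
move=> tau0 z00; have [s0 t0 z0st] := time_separation_gt0_minkowski tau0.
have [w [a [b [w0 a0 b0 [sE tE zE]]]]] := maximizer_parameters s0 t0 z00 z0st.
have ub := time_separation_le_hyp w0 a0 b0 sE tE zE tau0.
have /= [K [r [K0 r0 lb]]] := time_separation_ge_hyp w0 a0 b0.
set m := Num.sqrt (a * b) in ub lb.
have m0 : 0 < m by rewrite sqrtr_gt0 mulr_gt0.
have m2 : m ^+ 2 = a * b by rewrite sqr_sqrtr// mulr_ge0// ltW.
rewrite sE tE zE in lb.
(* The coefficient of s t = x^2 - y^2 in the lower bound, up to the factor 1 / (2 m). *)
pose k0 := a / (x0 + y0) + w / 2.
have mE : m ^+ 2 = k0 * ((x0 + y0) * (x0 - y0)) - 2 * w * z0.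
  have := hyp_identity a b 0 w0; rewrite mulr0 !mul0r addr0 sE tE zE m2 => ->.
  by rewrite /k0; field; rewrite gt_eqF.
(* The slopes are those of (k0 (x^2 - y^2) - 2 w z) / (2 m). C collects the second-order part of x^2
   - y^2 and K rho^2; from rho <= 2 |dx| + 2 |dy| + |dz| come 9 = 4 + 4 + 1 by Cauchy-Schwarz and 5
   = 2 + 2 + 1 in the radius. *)
exists m, (k0 * (2 * x0) / (2 * m)), (k0 * (- 2 * y0) / (2 * m)), (- (w / m)),
  (`|k0| / (2 * m) + 9 * K), (r / 5).
split=> //.
- by rewrite oppr_eq0 mulf_neq0// invr_eq0 gt_eqF.
- by rewrite addr_ge0 ?divr_ge0 ?mulr_ge0// ltW.
- by rewrite divr_gt0.
split=> // dx dy dz hx hy hz.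
have := lb (x0 + dx + (y0 + dy)) (x0 + dx - (y0 + dy)) (z0 + dz).
rewrite (_ : (x0 + dx + (y0 + dy) + _) / 2 = x0 + dx); last by field.
rewrite (_ : (x0 + dx + (y0 + dy) - _) / 2 = y0 + dy); last by field.
rewrite (_ : x0 + dx + (y0 + dy) - (x0 + y0) = dx + dy); last by ring.
rewrite (_ : x0 + dx - (y0 + dy) - (x0 - y0) = dx - dy); last by ring.
rewrite (_ : z0 + dz - z0 = dz); last by ring.
set rho := `|dx + dy| + `|dx - dy| + `|dz|.
have rho_le : rho <= 2 * `|dx| + 2 * `|dy| + 1 * `|dz|.
  by rewrite /rho; have := ler_normD dx dy; have := ler_normB dx dy; lra.
have rho0 : 0 <= rho by rewrite !addr_ge0.
have -> : rho < r by lra.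
move=> /(_ isT); apply: le_trans; rewrite lee_fin.
have rho2 : rho ^+ 2 <= 9 * (dx ^+ 2 + dy ^+ 2 + dz ^+ 2).
  apply: (@le_trans _ _ ((2 * `|dx| + 2 * `|dy| + 1 * `|dz|) ^+ 2)).
    by rewrite lerXn2r ?nnegrE// (le_trans rho0).
  apply: (le_trans (sqr_sum3_le _ _ _ _ _ _)).
  rewrite !real_normK ?num_real//.
  by rewrite (_ : 2 ^+ 2 + 2 ^+ 2 + 1 ^+ 2 = 9 :> R)//; ring.
have Kr : K * rho ^+ 2 <= 9 * K * (dx ^+ 2 + dy ^+ 2 + dz ^+ 2).
  by rewrite (mulrC 9) -mulrA; exact: ler_wpM2l.
have q1 : - (`|k0| / (2 * m) * (dx ^+ 2 + dy ^+ 2 + dz ^+ 2)) <= k0 / (2 * m) * (dx ^+ 2 - dy ^+ 2).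
  have i0 : 0 < (2 * m)^-1 by rewrite invr_gt0 mulr_gt0.
  rewrite [X in - X]mulrAC [X in _ <= X]mulrAC -mulNr ler_pM2r//.
  rewrite lerNl -mulrN; apply: (le_trans (ler_norm _)); rewrite normrM; apply: ler_wpM2l => //.
  rewrite normrN; apply: (le_trans (ler_normB _ _)); rewrite !ger0_norm ?sqr_ge0//.
  by rewrite lerDl sqr_ge0.
have -> : m / 2 + (a / (x0 + y0) * (x0 + dx + (y0 + dy)) * (x0 + dx - (y0 + dy)) +
   w / 2 * ((x0 + dx + (y0 + dy)) * (x0 + dx - (y0 + dy)) - 4 * (z0 + dz))) / (2 * m) - K * rho ^+ 2 =
   m / 2 + (k0 * ((x0 + y0) * (x0 - y0)) - 2 * w * z0) / (2 * m) + k0 * (2 * x0) / (2 * m) * dx +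
   k0 * (- 2 * y0) / (2 * m) * dy + - (w / m) * dz + k0 / (2 * m) * (dx ^+ 2 - dy ^+ 2) - K * rho ^+ 2.
  by rewrite /k0; field; rewrite !gt_eqF.
rewrite -mE (_ : m / 2 + m ^+ 2 / (2 * m) = m); last by field; rewrite gt_eqF.
rewrite [(_ + 9 * K) * _]mulrDl; lra.
Qed.

(** * The cost function *)

(** With e = xi / m, the power of 1 + e is exp(p ln (1 + e)), and ln (1 + e) >= e - 2 e^2 as long as
    |e| <= 1 / 2. *)
Lemma powR_ge_tangent (R : realType) (p m xi : R) : 0 < m -> 0 < p -> `|xi| <= m / 2 ->
  m `^ p * (1 + p * (xi / m) - 2 * p * (xi / m) ^+ 2) <= (m + xi) `^ p.
Proof.
move=> m0 p0; set e := xi / m => xim.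
have xiE : xi = m * e by rewrite /e; field; rewrite gt_eqF.
have [e1 e2] : - (1 / 2) <= e /\ e <= 1 / 2.
  by move: xim; rewrite ler_norml => /andP[h1 h2]; split;
    rewrite /e ?ler_pdivrMr// ?ler_pdivlMr//; lra.
clearbody e; have -> : m + xi = m * (1 + e) by rewrite xiE; ring.
have e10 : 0 < 1 + e by lra.
rewrite (powRM _ (ltW m0) (ltW e10)) ler_pM2l ?powR_gt0//.
rewrite /powR gt_eqF//.
have lne : e - 2 * e ^+ 2 <= ln (1 + e).
  have h : - ln (1 + e) <= (1 + e)^-1 - 1.
    rewrite -lnV ?posrE//.
    have i0 : 0 < (1 + e)^-1 by rewrite invr_gt0.
    have {1}-> : (1 + e)^-1 = 1 + ((1 + e)^-1 - 1) by ring.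
    by apply: le_ln1Dx; lra.
  have : (1 + e)^-1 - 1 <= - (e - 2 * e ^+ 2); last by lra.
  rewrite -subr_ge0 (_ : _ - _ = e ^+ 2 * (1 + 2 * e) / (1 + e)).
    apply: divr_ge0; last exact: ltW.
    by apply: mulr_ge0; [exact: sqr_ge0|lra].
  by field; rewrite gt_eqF.
apply: le_trans (expR_ge1Dx _).
have : p * (e - 2 * e ^+ 2) <= p * ln (1 + e) by rewrite ler_pM2l.
lra.
Qed.

(** Weighted AM-GM for x and 1: the logarithm lies below its tangent at the weighted mean c, where
    the linear terms cancel. *)
Lemma powR_le_tangent (R : realType) (p x : R) : 0 < p -> p < 1 -> 0 < x ->
  x `^ p <= 1 + p * (x - 1).
Proof.
move=> p0 p1 x0; set c := 1 + p * (x - 1).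
have c0 : 0 < c by have := mulr_gt0 p0 x0; rewrite /c; lra.
have h1 : ln (x / c) <= x / c - 1.
  have i0 : 0 < x / c by rewrite divr_gt0.
  have {1}-> : x / c = 1 + (x / c - 1) by ring.
  by apply: le_ln1Dx; lra.
have h2 : ln (c^-1) <= c^-1 - 1.
  have i0 : 0 < c^-1 by rewrite invr_gt0.
  have {1}-> : c^-1 = 1 + (c^-1 - 1) by ring.
  by apply: le_ln1Dx; lra.
rewrite ln_div ?posrE// in h1; rewrite lnV ?posrE// in h2.
rewrite /powR gt_eqF// -[leRHS]lnK ?posrE// ler_expR.
have e1 : p * (ln x - ln c) <= p * (x / c - 1) by rewrite ler_pM2l.
have e2 : (1 - p) * (- ln c) <= (1 - p) * (c^-1 - 1) by rewrite ler_pM2l// subr_gt0.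
have : p * (x / c - 1) + (1 - p) * (c^-1 - 1) = 0.
  by rewrite /c; field; rewrite gt_eqF.
lra.
Qed.

Lemma cost_ge0 (R : realType) (p : R) (q q' : heis R) : 0 < p -> (0 <= cost p q q')%E.
Proof. by move=> p0; rewrite /cost mule_ge0 ?poweR_ge0// lee_fin invr_ge0 ltW. Qed.

Lemma cost_ge (R : realType) (p L : R) (q q' : heis R) : 0 < p -> 0 <= L ->
  (L%:E <= time_separation q q')%E -> ((L `^ p / p)%:E <= cost p q q')%E.
Proof.
move=> p0 L0 Lt; rewrite /cost EFinM -poweR_EFin.
rewrite lee_pmul2r ?lte_fin ?invr_gt0//; apply: (gt0_ler_poweR (ltW p0)) => //.
  by rewrite in_itv/= lee_fin L0 leey.
by rewrite in_itv/= time_separation_ge0 leey.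
Qed.

Lemma cost_le (R : realType) (p L : R) (q q' : heis R) : 0 < p -> 0 <= L ->
  (time_separation q q' <= L%:E)%E -> (cost p q q' <= (L `^ p / p)%:E)%E.
Proof.
move=> p0 L0 Lt; rewrite /cost EFinM -poweR_EFin.
rewrite lee_pmul2r ?lte_fin ?invr_gt0//; apply: (gt0_ler_poweR (ltW p0)) => //.
  by rewrite in_itv/= time_separation_ge0 leey.
by rewrite in_itv/= lee_fin L0 leey.
Qed.

Lemma cost_gt0 (R : realType) (p : R) (q q' : heis R) : 0 < p ->
  (0 < cost p q q')%E -> (0 < time_separation q q')%E.
Proof.
move=> p0 c0; rewrite lt_neqAle time_separation_ge0 andbT; apply: contraTN c0 => /eqP E.
by rewrite -leNgt /cost -E poweR_EFin powR0 ?gt_eqF// mul0e.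
Qed.

Lemma cost_right (R : realType) (p : R) (q h q0 : heis R) :
  cost p q (heis_mul (heis_mul q h) q0) = cost p (0, 0, 0) (heis_mul h q0).
Proof. by rewrite /cost -heis_mulA time_separation_right. Qed.

Lemma time_separation_diff (R : realType) (q q' : heis R) :
  time_separation q q' = time_separation (0, 0, 0) (heis_mul (heis_inv q) q').
Proof. by rewrite -{1}(heis_mulVK q q') time_separation_right. Qed.

Lemma cost_quadratic (R : realType) (p x0 y0 z0 : R) : 0 < p ->
  (0 < time_separation (0%R, 0%R, 0%R) (x0, y0, z0))%E -> z0 != 0 ->
  exists F A B k C r : R, [/\ 0 < F, k != 0, 0 <= C, 0 < r &
   (cost p (0%R, 0%R, 0%R) (x0, y0, z0) <= F%:E)%E /\
   forall a b c : R, `|a| < r -> `|b| < r -> `|c| < r ->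
    ((F + A * a + B * b + k * c - C * (a ^+ 2 + b ^+ 2 + c ^+ 2))%:E <=
     cost p (0%R, 0%R, 0%R) (heis_mul (a, b, c) (x0, y0, z0)))%E].
Proof.
move=> p0 tau0 z00.
have [m [A [B [k [C [r [m0 k0 C0 r0 [ub lb]]]]]]]] := time_separation_quadratic tau0 z00.
(* In the product the height changes by c + (a y0 - x0 b) / 2. The linear part in a and b is
   absorbed by A1 and B1 and leaves k alone; the square is absorbed by C1. *)
pose A1 := A + k * y0 / 2; pose B1 := B - k * x0 / 2.
pose C1 := C * (1 + ((y0 / 2) ^+ 2 + (- x0 / 2) ^+ 2 + 1 ^+ 2)).
have C10 : 0 <= C1.
  by apply: mulr_ge0 => //; have := sqr_ge0 (y0 / 2); have := sqr_ge0 (- x0 / 2); lra.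
(* Constant of xi^2 <= D n, where n = a^2 + b^2 + c^2: Cauchy-Schwarz for the linear part, and n^2
   <= 3 n for the quadratic one. *)
pose D := 2 * (A1 ^+ 2 + B1 ^+ 2 + k ^+ 2) + 6 * C1 ^+ 2.
have D0 : 0 <= D by rewrite addr_ge0 ?mulr_ge0 ?addr_ge0 ?sqr_ge0.
pose g := m `^ p / m.
have mp0 : 0 < m `^ p by rewrite powR_gt0.
have g0 : 0 < g by rewrite divr_gt0.
(* The three bounds serve n <= 3, then |xi| <= m / 2 as [powR_ge_tangent] requires, then |dz| <
   r. *)
pose r1 := Num.min 1 (Num.min (m ^+ 2 / (12 * (D + 1))) (r / (1 + `|y0| + `|x0|))).
have den : 0 < 1 + `|y0| + `|x0| by have := normr_ge0 x0; have := normr_ge0 y0; lra.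
have D1 : 0 < 12 * (D + 1) by lra.
exists (m `^ p / p), (g * A1), (g * B1), (g * k), (g * C1 + 2 * (g / m) * D), r1.
split.
- exact: divr_gt0.
- by apply: mulf_neq0 => //; rewrite gt_eqF.
- apply: addr_ge0; apply: mulr_ge0 => //; first exact: ltW.
  by apply: mulr_ge0 => //; apply: divr_ge0; exact: ltW.
- rewrite !lt_min ltr01 /= !divr_gt0 ?exprn_gt0//.
split; first by apply: cost_le => //; exact: ltW.
move=> a b c; rewrite /r1 !lt_min => /and3P[a1 a2 a3] /and3P[b1 b2 b3] /and3P[c1 c2 c3].
pose dz := c + 2^-1 * (a * y0 - x0 * b).
have E : heis_mul (a, b, c) (x0, y0, z0) = (x0 + a, y0 + b, z0 + dz).
  by rewrite /heis_mul /dz; congr (_, _, _); ring.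
have small (v : R) : `|v| < r / (1 + `|y0| + `|x0|) -> `|v| < r /\ `|v| * (1 + `|y0| + `|x0|) < r.
  rewrite ltr_pdivlMr// => h; split=> //; apply: le_lt_trans h.
  by rewrite ler_peMr//; have := normr_ge0 x0; have := normr_ge0 y0; lra.
have [a4 _] := small _ a3; have [b4 _] := small _ b3.
have dzr : `|dz| < r.
  set rr := r / (1 + `|y0| + `|x0|) in a3 b3 c3.
  have rr0 : 0 < rr by rewrite divr_gt0.
  have -> : r = rr + rr * `|y0| + rr * `|x0| by rewrite /rr; field; rewrite gt_eqF.
  apply: le_lt_trans (ler_normD _ _) _.
  have h := ler_normB (a * y0) (x0 * b).
  rewrite !normrM in h.
  have h1 : `|a| * `|y0| <= rr * `|y0| by rewrite ler_wpM2r// ltW.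
  have h2 : `|x0| * `|b| <= rr * `|x0| by rewrite mulrC ler_wpM2r// ltW.
  rewrite normrM (@ger0_norm _ 2^-1)//.
  have := mulr_ge0 (ltW rr0) (normr_ge0 x0); have := mulr_ge0 (ltW rr0) (normr_ge0 y0).
  lra.
have := lb a b dz a4 b4 dzr; rewrite -E => lbq.
clear a3 b3 c3 a4 b4 dzr small.
set n := a ^+ 2 + b ^+ 2 + c ^+ 2.
have n0 : 0 <= n by rewrite /n !addr_ge0 ?sqr_ge0.
have dz2 : dz ^+ 2 <= ((y0 / 2) ^+ 2 + (- x0 / 2) ^+ 2 + 1 ^+ 2) * n.
  have := sqr_sum3_le a b c (y0 / 2) (- x0 / 2) 1.
  by rewrite (_ : y0 / 2 * a + _ * b + _ = dz)//; rewrite /dz; ring.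
pose xi := A1 * a + B1 * b + k * c - C1 * n.
have lin2 := sqr_sum3_le a b c A1 B1 k; rewrite -/n in lin2.
have sq1 (v w : R) : `|v| < w -> v ^+ 2 <= w ^+ 2.
  move=> vw; rewrite -(real_normK (num_real v)) lerXn2r ?nnegrE//; last exact: ltW.
  by apply: ltW; exact: le_lt_trans vw.
have n3 : n <= 3.
  by have := sq1 _ _ a1; have := sq1 _ _ b1; have := sq1 _ _ c1; rewrite /n !expr1n; lra.
have n_small : n <= 3 * (m ^+ 2 / (12 * (D + 1))).
  have key (v : R) : `|v| < 1 -> `|v| < m ^+ 2 / (12 * (D + 1)) -> v ^+ 2 <= m ^+ 2 / (12 * (D + 1)).
    move=> v1 v2; rewrite -(real_normK (num_real v)) expr2.
    apply: (@le_trans _ _ (1 * `|v|)); first by rewrite ler_wpM2r// ltW.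
    by rewrite mul1r ltW.
  by have := key _ a1 a2; have := key _ b1 b2; have := key _ c1 c2; rewrite /n; lra.
clear a1 a2 b1 b2 c1 c2 sq1.
have xi2 : xi ^+ 2 <= D * n.
  have h1 : xi ^+ 2 <= 2 * (A1 * a + B1 * b + k * c) ^+ 2 + 2 * (C1 * n) ^+ 2.
    rewrite -subr_ge0 (_ : _ - _ = (A1 * a + B1 * b + k * c + C1 * n) ^+ 2) ?sqr_ge0//.
    by rewrite /xi; ring.
  have h2 : (C1 * n) ^+ 2 <= C1 ^+ 2 * (3 * n).
    by rewrite exprMn ler_wpM2l ?sqr_ge0// expr2 ler_wpM2r.
  have : D * n = 2 * ((A1 ^+ 2 + B1 ^+ 2 + k ^+ 2) * n) + 2 * (C1 ^+ 2 * (3 * n)).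
    by rewrite /D; ring.
  lra.
have xim : `|xi| <= m / 2.
  have m20 : 0 <= m / 2 by rewrite divr_ge0// ltW.
  rewrite -(@ler_pXn2r _ 2%N) ?nnegrE// real_normK ?num_real//; apply: (le_trans xi2).
  apply: (@le_trans _ _ ((D + 1) * (3 * (m ^+ 2 / (12 * (D + 1)))))).
    by apply: ler_pM => //; lra.
  by rewrite le_eqVlt; apply/orP; left; apply/eqP; field; rewrite gt_eqF//; lra.
have Lp : 0 <= m + xi by move: xim; rewrite ler_norml => /andP[]; lra.
have Lt : ((m + xi)%:E <= time_separation (0%R, 0%R, 0%R) (heis_mul (a, b, c) (x0, y0, z0)))%E.
  apply: le_trans lbq; rewrite lee_fin.
  have h1 : C * (a ^+ 2 + b ^+ 2 + dz ^+ 2) <= C1 * n.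
    rewrite /C1 -mulrA; apply: ler_wpM2l => //; rewrite mulrDl mul1r; apply: lerD => //.
    by rewrite /n lerDl sqr_ge0.
  have : A1 * a + B1 * b + k * c = A * a + B * b + k * dz by rewrite /A1 /B1 /dz; field.
  rewrite /xi; lra.
apply: le_trans (cost_ge p0 Lp Lt); rewrite lee_fin.
have h : m `^ p * (1 + p * (xi / m) - 2 * p * (xi / m) ^+ 2) / p <= (m + xi) `^ p / p.
  by rewrite ler_pM2r ?invr_gt0//; exact: powR_ge_tangent.
apply: le_trans h.
have -> : m `^ p * (1 + p * (xi / m) - 2 * p * (xi / m) ^+ 2) / p =
   m `^ p / p + g * xi - 2 * (g / m) * xi ^+ 2.
  by rewrite /g; field; rewrite !gt_eqF.
have : 2 * (g / m) * xi ^+ 2 <= 2 * (g / m) * (D * n).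
  by apply: ler_wpM2l => //; apply: mulr_ge0 => //; apply: divr_ge0; exact: ltW.
have : (g * C1 + 2 * (g / m) * D) * n = g * (C1 * n) + 2 * (g / m) * (D * n) by ring.
have : g * xi = g * A1 * a + g * B1 * b + g * k * c - g * (C1 * n) by rewrite /xi; ring.
lra.
Qed.

(** Let u and v be the ratios of the null increments to x0 + y0 and x0 - y0. Then tau <= m sqrt(u v)
    <= m (u + v) / 2, and [powR_le_tangent] linearises the power; both steps are sharp at u = v =
    1. *)
Lemma cost_le_linear (R : realType) (p x0 y0 : R) (q q' : heis R) :
  0 < p -> p < 1 -> 0 < x0 + y0 -> 0 < x0 - y0 ->
  (0 < time_separation q q')%E ->
  (cost p q q' <= (Num.sqrt ((x0 + y0) * (x0 - y0)) `^ p / p +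
     Num.sqrt ((x0 + y0) * (x0 - y0)) `^ p / 2 *
     ((q'.1.1 - q.1.1 + (q'.1.2 - q.1.2)) / (x0 + y0) +
      (q'.1.1 - q.1.1 - (q'.1.2 - q.1.2)) / (x0 - y0) - 2))%:E)%E.
Proof.
move=> p0 p1 s00 t00 tau0; set m := Num.sqrt ((x0 + y0) * (x0 - y0)).
have m0 : 0 < m by rewrite sqrtr_gt0 mulr_gt0.
have mp0 : 0 < m `^ p by rewrite powR_gt0.
set x := q'.1.1 - q.1.1; set y := q'.1.2 - q.1.2.
have [z E] : exists z, heis_mul (heis_inv q) q' = (x, y, z).
  rewrite /x /y; case: (q) => -[a b] c; case: (q') => -[a' b'] c'.
  eexists; rewrite /heis_inv /=; congr (_, _, _); ring.
have tE := time_separation_diff q q'; rewrite E in tE.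
rewrite tE in tau0; have [s0 t0 _] := time_separation_gt0_minkowski tau0.
have ub := time_separation_le_minkowski x y z.
set u := (x + y) / (x0 + y0); set v := (x - y) / (x0 - y0).
have u0 : 0 < u by rewrite divr_gt0.
have v0 : 0 < v by rewrite divr_gt0.
have stE : (x + y) * (x - y) = (x0 + y0) * (x0 - y0) * (u * v).
  by rewrite /u /v; field; rewrite !gt_eqF.
have hm : (time_separation q q' <= (m * ((u + v) / 2))%:E)%E.
  rewrite tE; apply: (le_trans ub); rewrite lee_fin stE sqrtrM; last by rewrite mulr_ge0// ltW.
  rewrite ler_pM2l// -(@ger0_norm _ ((u + v) / 2)); last by rewrite divr_ge0// addr_ge0// ltW.
  rewrite -sqrtr_sqr; apply: ler_wsqrtr.
  by rewrite -subr_ge0 (_ : _ - _ = ((u - v) / 2) ^+ 2) ?sqr_ge0//; field.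
have uv0 : 0 < (u + v) / 2 by rewrite divr_gt0// addr_gt0.
have muv : 0 <= m * ((u + v) / 2) by rewrite mulr_ge0// ltW.
apply: (le_trans (cost_le p0 muv hm)); rewrite lee_fin (powRM _ (ltW m0) (ltW uv0)).
have h := powR_le_tangent p0 p1 uv0.
have : m `^ p * ((u + v) / 2) `^ p / p <= m `^ p * (1 + p * ((u + v) / 2 - 1)) / p.
  by rewrite ler_pM2r ?invr_gt0// ler_pM2l.
move=> /le_trans; apply; rewrite le_eqVlt; apply/orP; left; apply/eqP.
by field; rewrite gt_eqF.
Qed.

Lemma time_separation_straight (R : realType) (x y : R) : 0 < x + y -> 0 < x - y ->
  ((Num.sqrt ((x + y) * (x - y)))%:E <= time_separation (0%R, 0%R, 0%R) (x, y, 0%R))%E.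
Proof.
move=> s0 t0.
pose s := x + y; pose t := x - y.
have dl (k r : R) : is_derive r (1 : R) (fun r : R => k * r) k.
  by have := is_deriveZ k (is_derive_id r (1 : R)); rewrite /GRing.scale/= mulr1.
have dZ r : is_derive r (1 : R) (cst 0) (4^-1 * (t * r * s - s * r * t)).
  by apply: (is_derive_eq (is_derive_cst 0 r (1 : R))); ring.
have := null_curve_length (dl s) (dl t) dZ (@continuous_const R s) (@continuous_const R t)
  (fun _ _ => conj s0 t0) (mulr0 _) (mulr0 _) erefl.
rewrite !mulr1 (_ : (s + t) / 2 = x); last by rewrite /s /t; field.
rewrite (_ : (s - t) / 2 = y); last by rewrite /s /t; field.
move=> /time_separation_ge; apply: le_trans.
have := @le_integral01 R (fun r => Num.sqrt (s * t) * r) (fun=> Num.sqrt (s * t)) (fun=> Num.sqrt (s * t))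
  (dl _) (@continuous_const R _) (@continuous_const R _) (fun _ _ => lexx _).
by rewrite mulr1 mulr0 subr0.
Qed.

(** * Borel sets, supports and Lebesgue measure *)

Lemma ball_heisE (R : realType) (q q' : heis R) (e : R) :
  ball q e q' <-> [/\ `|q.1.1 - q'.1.1| < e, `|q.1.2 - q'.1.2| < e & `|q.2 - q'.2| < e].
Proof. by split=> [[[]]|[]]. Qed.

Lemma measurable_heisP d (T : measurableType d) (R : realType) (f : T -> heis R) :
  measurable_fun [set: T] (fun t => (f t).1.1) ->
  measurable_fun [set: T] (fun t => (f t).1.2) ->
  measurable_fun [set: T] (fun t => (f t).2) -> measurable_fun [set: T] f.
Proof.
move=> h1 h2 h3; apply/measurable_fun_pairP; split => //.
by apply/measurable_fun_pairP.
Qed.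

Lemma measurable_heis11 (R : realType) :
  measurable_fun [set: heis R] (fun q : heis R => q.1.1).
Proof. exact: (measurableT_comp measurable_fst measurable_fst). Qed.

Lemma measurable_heis12 (R : realType) :
  measurable_fun [set: heis R] (fun q : heis R => q.1.2).
Proof. exact: (measurableT_comp measurable_snd measurable_fst). Qed.

Lemma measurable_heis2 (R : realType) :
  measurable_fun [set: heis R] (fun q : heis R => q.2).
Proof. exact: measurable_snd. Qed.

Lemma measurable_preimageT d d' (T : measurableType d) (U : measurableType d')
    (f : T -> U) (A : set U) :
  measurable_fun [set: T] f -> measurable A -> measurable (f @^-1` A).
Proof. by move=> mf mA; rewrite -[X in measurable X]setTI; exact: mf. Qed.

Lemma heis_mulE (R : realType) (q g : heis R) : heis_mul q g =
  (q.1.1 + g.1.1, q.1.2 + g.1.2, q.2 + g.2 + 2^-1 * (q.1.1 * g.1.2 - g.1.1 * q.1.2)).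
Proof. by case: q => -[? ?] ?; case: g => -[? ?] ?. Qed.

Lemma measurable_heis_mul (R : realType) (g : heis R) :
  measurable_fun [set: heis R] (fun q => heis_mul q g).
Proof.
apply: measurable_heisP.
- apply: (@eq_measurable_fun _ _ _ _ _ (fun q : heis R => q.1.1 + g.1.1)).
    by move=> q _; rewrite heis_mulE.
  by apply: measurable_funD; [exact: measurable_heis11|exact: measurable_cst].
- apply: (@eq_measurable_fun _ _ _ _ _ (fun q : heis R => q.1.2 + g.1.2)).
    by move=> q _; rewrite heis_mulE.
  by apply: measurable_funD; [exact: measurable_heis12|exact: measurable_cst].
- apply: (@eq_measurable_fun _ _ _ _ _ (fun q : heis R =>
    q.2 + g.2 + 2^-1 * (q.1.1 * g.1.2 - g.1.1 * q.1.2))).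
    by move=> q _; rewrite heis_mulE.
  apply: measurable_funD.
    by apply: measurable_funD; [exact: measurable_heis2|exact: measurable_cst].
  apply: measurable_funM; first exact: measurable_cst.
  apply: measurable_funB; apply: measurable_funM;
    [exact: measurable_heis11|exact: measurable_cst|exact: measurable_cst|exact: measurable_heis12].
Qed.

Lemma rat_approx (R : realType) (x d : R) : 0 < d -> exists r : rat, `|x - ratr r| < d.
Proof.
move=> d0; have lt : x - d < x + d by lra.
have [r] := rat_in_itvoo lt; rewrite in_itv/= => /andP[r1 r2]; exists r.
by rewrite ltr_norml; apply/andP; split; lra.
Qed.

Lemma dist_triangle_lt (R : realType) (a b c d e : R) :
  `|a - b| < d -> `|b - c| < d -> d < e / 2 -> `|a - c| < e.
Proof.
move=> h1 h2 h3; rewrite (_ : a - c = (a - b) + (b - c)); last by ring.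
by apply: le_lt_trans (ler_normD _ _) _; lra.
Qed.

Section RationalBalls.
Variable R : realType.

(** Balls of the product norm are boxes, hence measurable for the product sigma-algebra. These form
    a countable base, which makes all open sets measurable. *)
Definition rat_ball (i : rat * rat * rat * nat) : set (heis R) :=
  ball (ratr i.1.1.1 : R, ratr i.1.1.2 : R, ratr i.1.2 : R) (i.2.+1%:R^-1 : R).

Lemma measurable_heis_ball (q : heis R) (e : R) : measurable (ball q e).
Proof.
rewrite (_ : ball q e = (fun q' : heis R => q'.1.1) @^-1` (ball q.1.1 e) `&`
   (fun q' : heis R => q'.1.2) @^-1` (ball q.1.2 e) `&`
   (fun q' : heis R => q'.2) @^-1` (ball q.2 e)); last first.
  by apply/seteqP; split=> q' => [[[]]|[[]]].
apply: measurableI; first apply: measurableI.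
- by apply: measurable_preimageT; [exact: measurable_heis11|exact: measurable_ball].
- by apply: measurable_preimageT; [exact: measurable_heis12|exact: measurable_ball].
- by apply: measurable_preimageT; [exact: measurable_heis2|exact: measurable_ball].
Qed.

Lemma open_rat_ball (q : heis R) (U : set (heis R)) : open U -> U q ->
  exists2 i, rat_ball i q & rat_ball i `<=` U.
Proof.
move=> oU Uq.
have /(nbhs_ballP q U) [e /= e0 eU] : nbhs q U by exact: open_nbhs_nbhs.
pose k := (Num.truncn (2 / e)).
have k1 : (k.+1%:R^-1 : R) < e / 2.
  rewrite invf_plt ?posrE ?divr_gt0// invf_div.
  exact: truncnS_gt.
have k0 : 0 < (k.+1%:R^-1 : R) by rewrite invr_gt0.
have [a ha] := rat_approx q.1.1 k0; have [b hb] := rat_approx q.1.2 k0.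
have [c hc] := rat_approx q.2 k0.
exists (a, b, c, k); first by apply/ball_heisE; split; rewrite distrC.
move=> q' /ball_heisE /= [h1 h2 h3]; apply: eU; apply/ball_heisE.
by split; [exact: dist_triangle_lt ha h1 k1|exact: dist_triangle_lt hb h2 k1|
  exact: dist_triangle_lt hc h3 k1].
Qed.

Lemma open_heis_measurable (U : set (heis R)) : open U -> measurable U.
Proof.
move=> oU; rewrite (_ : U = \bigcup_i (if `[< rat_ball i `<=` U >] then rat_ball i else set0)).
  apply: countable_bigcupT_measurable; first exact: countableP.
  by move=> i; case: ifPn => // _; exact: measurable_heis_ball.
apply/seteqP; split=> q.
  move=> Uq; have [i iq iU] := open_rat_ball oU Uq.
  by exists i => //; rewrite asboolT.
by case=> i _; case: ifPn => // /asboolP iU /iU.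
Qed.

Lemma open_heis_ball (q : heis R) (e : R) : open (ball q e).
Proof. exact: ball_open. Qed.

End RationalBalls.

Section Support.
Variables (R : realType) (mu : probability (heis R) R).

Lemma support_complement_open : open (~` measure_support mu).
Proof.
rewrite openE => q /= /existsNP[U] /not_implyP[oU] /not_implyP[Uq nU].
have nUq : nbhs q U by exact: open_nbhs_nbhs.
rewrite /interior; apply: filterS nUq => q' Uq' sq'; apply: nU; exact: sq'.
Qed.

Lemma measurable_support : measurable (measure_support mu).
Proof.
rewrite -[X in measurable X]setCK; apply: measurableC.
exact: open_heis_measurable support_complement_open.
Qed.

(** A point outside the support has a null neighbourhood, which contains a null rational ball around
    it; there are countably many of these. *)
Lemma support_complement0 : mu (~` measure_support mu) = 0%E.
Proof.
pose I := (rat * rat * rat * nat)%type.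
pose B (n : nat) : set (heis R) := if (unpickle n : option I) is Some i
  then if mu ((rat_ball i : set (heis R))) == 0%E then (rat_ball i : set (heis R)) else set0 else set0.
have mB n : measurable (B n).
  by rewrite /B; case: unpickle => // i; case: ifPn => // _; exact: measurable_heis_ball.
have B0 n : mu (B n) = 0%E.
  by rewrite /B; case: unpickle => [i|]; rewrite ?measure0//; case: ifPn => [/eqP|]; rewrite ?measure0.
have -> : ~` measure_support mu = \bigcup_n B n.
  apply/seteqP; split=> q.
    move=> /existsNP[U] /not_implyP[oU] /not_implyP[Uq nU].
    have [i iq iU] := open_rat_ball oU Uq.
    exists (pickle i); first exact: Logic.I.
    have -> : B (pickle i) = if mu (rat_ball i : set (heis R)) == 0%E then rat_ball i else set0.
      by rewrite /B pickleK.
    have mU0 : mu U = 0%E.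
      by apply/eqP; rewrite eq_le measure_ge0 andbT leNgt; apply/negP.
    suff -> : mu (rat_ball i : set (heis R)) == 0%E by [].
    rewrite eq_le measure_ge0 andbT -mU0; apply: le_measure => //; rewrite inE.
      exact: measurable_heis_ball.
    exact: open_heis_measurable.
  case=> n _; rewrite /B; case: unpickle => // i; case: ifPn => // /eqP mi qi sq.
  have oi : open (rat_ball i : set (heis R)) by exact: open_heis_ball.
  by have := sq _ oi qi; rewrite mi ltxx.
apply: measure_negligible; first exact: bigcupT_measurable.
apply: negligible_bigcup => n; exists (B n).
by split; [exact: mB|exact: B0|exact: subset_refl].
Qed.

Lemma support_measure1 : mu (measure_support mu) = 1%E.
Proof.
rewrite -[X in mu X]setCK probability_setC; last by apply: measurableC; exact: measurable_support.
by rewrite support_complement0 sube0.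
Qed.

End Support.

(** * Invariance of Lebesgue measure under right translations *)

Lemma lebesgue_measure_translate (R : realType) (a : R) (A : set R) : measurable A ->
  @lebesgue_measure R [set x | A (x + a)] = @lebesgue_measure R A.
Proof.
move=> mA.
have mf : measurable_fun [set: measurableTypeR R] (fun x : R => x + a : measurableTypeR R).
  by apply: measurable_funD => //; exact: measurable_cst.
rewrite -[LHS]/(pushforward (@lebesgue_measure R) (fun x : R => x + a : measurableTypeR R) A).
apply/esym/lebesgue_measure_unique => //= _ [[b c]] _ <-.
rewrite /pushforward (_ : _ @^-1` _ = `]b - a, c - a]%classic); last first.
  by apply/seteqP; split=> x /=; rewrite !in_itv/=; lra.
rewrite !lebesgue_measure_itv/= !lte_fin ltrD2r; case: ifPn => // _.
by rewrite -!EFinB; congr EFin; ring.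
Qed.

Lemma measurable_shift (R : realType) (a b : R) :
  measurable_fun [set: R * R] (fun v : R * R => (v.1 + a, v.2 + b)).
Proof.
apply: measurable_fun_pair; apply: measurable_funD; try exact: measurable_cst.
  exact: measurable_fst.
exact: measurable_snd.
Qed.

Lemma lebesgue2_translate (R : realType) (a b : R) (A : set (R * R)) : measurable A ->
  (@lebesgue_measure R \x @lebesgue_measure R)%E [set v | A (v.1 + a, v.2 + b)] =
  (@lebesgue_measure R \x @lebesgue_measure R)%E A.
Proof.
move=> mA.
pose f (v : measurableTypeR R * measurableTypeR R) : measurableTypeR R * measurableTypeR R :=
  (v.1 + a, v.2 + b).
have mf : measurable_fun setT f by exact: measurable_shift.
rewrite -[LHS]/(pushforward (@lebesgue_measure R \x @lebesgue_measure R)%E f A).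
apply/esym/product_measure_unique => //= B C mB mC.
rewrite -(lebesgue_measure_translate a mB) -(lebesgue_measure_translate b mC).
rewrite -product_measure1E//; last 2 first.
- have mfa : measurable_fun setT (fun x : measurableTypeR R => x + a : measurableTypeR R).
    by apply: measurable_funD => //; exact: measurable_cst.
  exact: (measurable_preimageT mfa mB).
- have mfb : measurable_fun setT (fun x : measurableTypeR R => x + b : measurableTypeR R).
    by apply: measurable_funD => //; exact: measurable_cst.
  exact: (measurable_preimageT mfb mC).
Qed.

(** A right translation is a shear: over a fixed (x, y) it shifts the height by a constant, and it
    shifts (x, y) itself. Fubini reduces the claim to shifts in dimensions one and two. *)
Lemma heis_lebesgue_translate (R : realType) (g : heis R) (A : set (heis R)) :
  measurable A -> heis_lebesgue [set q | A (heis_mul q g)] = heis_lebesgue A.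
Proof.
move=> mA; case: g => -[a b] c.
pose f (v : measurableTypeR R * measurableTypeR R) : measurableTypeR R * measurableTypeR R :=
  (v.1 + a, v.2 + b).
have mf : measurable_fun setT f by exact: measurable_shift.
pose phi (v : R * R) := @lebesgue_measure R (xsection A v).
have mphi : measurable_fun [set: R * R] phi.
  by apply: measurable_fun_xsection; exact: mA.
have LE B : heis_lebesgue B = (\int[(@lebesgue_measure R \x @lebesgue_measure R)%E]_v
    (@lebesgue_measure R (xsection B v)))%E by [].
rewrite !LE.
transitivity (\int[(@lebesgue_measure R \x @lebesgue_measure R)%E]_v (phi \o f) v)%E.
  apply: eq_integral => v _.
  have -> : xsection [set q | A (heis_mul q (a, b, c))] v =
     [set z | xsection A (f v) (z + (c + 2^-1 * (v.1 * b - a * v.2)))].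
    apply/seteqP; split=> z; rewrite /xsection /= !inE /= /f; case: v => x y /=.
      by rewrite addrA.
    by rewrite addrA.
  by rewrite lebesgue_measure_translate//; exact: measurable_xsection.
rewrite -[RHS]/(\int[(@lebesgue_measure R \x @lebesgue_measure R)%E]_v phi v)%E.
have phi0 : {in [set: R * R], forall v, (0 <= phi v)%E}.
  by move=> v _; exact: measure_ge0.
have := ge0_integral_pushforward mf (@lebesgue_measure R \x @lebesgue_measure R)%E measurableT mphi phi0.
rewrite preimage_setT => <-.
apply: eq_measure_integral => B mB _.
exact: lebesgue2_translate.
Qed.

Definition heis_box (R : realType) (M : R) : set (heis R) :=
  (`[- M, M] `*` `[- M, M]) `*` `[- M, M].

Lemma heis_lebesgue_box (R : realType) (M : R) : 0 <= M ->
  (heis_lebesgue (heis_box M) < +oo)%E.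
Proof.
move=> M0.
have h : (@lebesgue_measure R `[(- M)%R, M]%classic < +oo)%E.
  by rewrite lebesgue_measure_itv/=; case: ifP => // _; rewrite -EFinB ltry.
have h2 : ((@lebesgue_measure R \x @lebesgue_measure R)%E (`[(- M)%R, M] `*` `[(- M)%R, M]) < +oo)%E.
  rewrite product_measure1E//; apply: lte_mul_pinfty; [exact: measure_ge0| |exact: h].
  by rewrite ge0_fin_numE; [exact: h|exact: measure_ge0].
rewrite /heis_lebesgue /heis_box product_measure1E//; last exact: measurableX.
apply: lte_mul_pinfty; [exact: measure_ge0| |exact: h].
by rewrite ge0_fin_numE; [exact: h2|exact: measure_ge0].
Qed.

Lemma measurable_heis_box (R : realType) (M : R) : measurable (heis_box M).
Proof. by apply: measurableX => //; exact: measurableX. Qed.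

(* The identity transports Lebesgue measure from the sigma-algebra generated by
   half-open intervals to the default one on [R], whose display differs. *)
Lemma heis_lebesgue_measure (R : realType) :
  exists L : {measure set (heis R) -> \bar R}, forall A, heis_lebesgue A = L A.
Proof.
pose m := (@lebesgue_measure R \x @lebesgue_measure R \x @lebesgue_measure R)%E.
pose f (q : measurableTypeR R * measurableTypeR R * measurableTypeR R) : heis R := q.
have mf : measurable_fun setT f.
  by move=> _ B mB; rewrite setTI; exact: mB.
pose L : {measure set (heis R) -> \bar R} :=
  measure_function_pushforward__canonical__measure_function_Measure m mf.
by exists L.
Qed.

(* Steinhaus: for small [g], the translate of [K] by the inverse of [g] lies in a
   thin neighbourhood of [K], so it meets [K] in almost full measure. *)
Lemma common_translates (R : realType) (K : set (heis R)) (n : nat) :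
  compact K -> (0 < heis_lebesgue K)%E ->
  exists2 d : R, 0 < d & forall g : 'I_n -> heis R,
    (forall i, `|g i| < d) -> exists q, forall i, K (heis_mul q (g i)).
Proof.
move=> cK K0.
have clK : closed K by apply: compact_closed cK; exact: norm_hausdorff.
have mK : measurable K.
  by rewrite -[K]setCK; apply: measurableC; apply: open_heis_measurable; exact: closed_openC.
have [M [Mr KM]] := compact_bounded cK.
pose M' := `|M| + 1.
have {}KM q : K q -> `|q| <= M'.
  by move=> Kq; apply: (KM M') => //; rewrite /M'; have := ler_norm M; lra.
have [L LE] := heis_lebesgue_measure R.
pose N k := [set q | exists2 q', K q' & ball q' (k.+1%:R^-1 : R) q].
have oN k : open (N k).
  rewrite (_ : N k = \bigcup_(q' in K) ball q' (k.+1%:R^-1 : R)) //.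
  by apply: bigcup_open => q' _; exact: open_heis_ball.
have mN k : measurable (N k) by exact: open_heis_measurable.
have KN k : K `<=` N k.
  by move=> q Kq; exists q => //; apply: ballxx; rewrite invr_gt0.
have NK : \bigcap_k N k = K.
  apply/seteqP; split; last by move=> q Kq k _; exact: KN.
  move=> q Nq; apply: clK => B /nbhs_ballP[e /= e0 eB].
  pose k := Num.truncn (e^-1).
  have ke : (k.+1%:R^-1 : R) < e.
    by rewrite invf_plt ?posrE// truncnS_gt.
  have [q' Kq' qq'] := Nq k Logic.I; exists q'; split=> //; apply: eB.
  by apply: (le_ball (ltW ke)); exact: ball_sym.
have N0 : (L (N 0%N) < +oo)%E.
  have M'0 : 0 <= M' + 1 by rewrite /M'; have := normr_ge0 M; lra.
  apply: le_lt_trans (heis_lebesgue_box M'0); rewrite LE.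
  apply: le_measure; rewrite ?inE//.
    exact: measurable_heis_box.
  move=> q [q' Kq' /ball_heisE]; rewrite invr1 => -[h1 h2 h3].
  have := KM _ Kq' => Mq'.
  have b1 := le_trans (norm_heis11 q') Mq'.
  have b2 := le_trans (norm_heis12 q') Mq'.
  have b3 := le_trans (norm_snd_le q') Mq'.
  move: h1 h2 h3 b1 b2 b3; rewrite !ltr_norml !ler_norml => /andP[? ?] /andP[? ?] /andP[? ?] /andP[? ?] /andP[? ?] /andP[? ?].
  by split; [split|] => /=; rewrite in_itv/=; apply/andP; split; lra.
have cvgN : L (N k) @[k --> \oo] --> L K.
  rewrite -NK; apply: nonincreasing_cvg_mu => //; first by rewrite NK.
  move=> k1 k2 k12; apply/subsetPset => q [q' Kq' qq']; exists q' => //.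
  by apply: le_ball qq'; rewrite lef_pV2 ?posrE// ler_nat.
have LK : L K \is a fin_num.
  by rewrite ge0_fin_numE//; apply: le_lt_trans N0; apply: le_measure; rewrite ?inE.
(* Each of the n translates misses at most [eta] of the neighbourhood, in total less than the
   measure of K, so a point common to all remains. *)
pose eta := fine (L K) / n.+1%:R.
have K0' : 0 < fine (L K) by rewrite fine_gt0// -LE K0 LE -ge0_fin_numE.
have eta0 : 0 < eta by rewrite divr_gt0.
have [k Nk] : exists k, (L (N k) < L K + eta%:E)%E.
  apply: contrapT => /forallNP h.
  have : (L K + eta%:E <= lim (L (N k) @[k --> \oo]))%E.
    apply: lime_ge; first by apply/cvg_ex; exists (L K).
    by apply: nearW => k; rewrite leNgt; apply/negP; exact: h.
  rewrite (cvg_lim _ cvgN)//.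
  by rewrite -{2}[L K]adde0 leeD2lE// lee_fin leNgt eta0.
have k0 : 0 < (k.+1%:R^-1 : R) by rewrite invr_gt0.
have M'0 : 0 < M' by rewrite /M'; have := normr_ge0 M; lra.
(* Multiplying by g moves a point by at most |g| (1 + M') when the image lies in K; M' accounts for
   the twist in the height. *)
exists (k.+1%:R^-1 / (1 + M')); first by rewrite divr_gt0//; lra.
move=> g gd.
pose A i := [set q | K (heis_mul q (g i))].
have mA i : measurable (A i) by exact: (measurable_preimageT (measurable_heis_mul (g i)) mK).
have LA i : L (A i) = L K by rewrite -!LE; exact: heis_lebesgue_translate.
have AN i : A i `<=` N k.
  move=> q Aq; exists (heis_mul q (g i)) => //; apply/ball_heisE.
  have MK := KM _ Aq.
  have a1 := le_trans (norm_heis11 _) MK.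
  have a2 := le_trans (norm_heis12 _) MK.
  move: (gd i); rewrite ltr_pdivlMr; last by lra.
  have g1 := norm_heis11 (g i); have g2 := norm_heis12 (g i); have g3 := norm_snd_le (g i).
  have gi0 : 0 <= `|g i| by exact: normr_ge0.
  move=> hd.
  have gM : 0 <= `|g i| * M' by apply: mulr_ge0 => //; exact: ltW.
  rewrite mulrDr mulr1 in hd.
  rewrite heis_mulE /= in a1 a2 *; split.
  - by apply: le_lt_trans hd; rewrite (_ : _ - _ = (g i).1.1); [lra|ring].
  - by apply: le_lt_trans hd; rewrite (_ : _ - _ = (g i).1.2); [lra|ring].
  - apply: le_lt_trans hd; rewrite (_ : _ - _ = (g i).2 + 2^-1 * ((q.1.1 + (g i).1.1) * (g i).1.2 - (g i).1.1 * (q.1.2 + (g i).1.2))); last by ring.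
    apply: (le_trans (ler_normD _ _)).
    rewrite normrM (@ger0_norm _ 2^-1)//.
    have := ler_normB ((q.1.1 + (g i).1.1) * (g i).1.2) ((g i).1.1 * (q.1.2 + (g i).1.2)).
    rewrite !normrM.
    have : `|q.1.1 + (g i).1.1| * `|(g i).1.2| <= `|g i| * M' by rewrite mulrC; apply: ler_pM.
    have : `|(g i).1.1| * `|q.1.2 + (g i).1.2| <= `|g i| * M' by apply: ler_pM.
    lra.
(* Padded with empty sets beyond n, as subadditivity is stated for sequences. *)
pose C (i : nat) := if insub i is Some j then N k `\` A j else set0.
have mC i : measurable (C i).
  by rewrite /C; case: insub => // j; exact: measurableD.
have LNk : (L (N k) < +oo)%E by apply: (lt_trans Nk); rewrite -(fineK LK) -EFinD ltry.
have LC i : (L (C i) <= eta%:E)%E.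
  rewrite /C; case: insub => [j|]; last by rewrite measure0 lee_fin ltW.
  have -> : L (N k `\` A j) = (L (N k) - L (A j))%E by rewrite measureD// (setIidr (AN j)).
  rewrite LA leeBlDr// addeC.
  exact: ltW.
apply: contrapT => /forallNP noq.
have cover : N k `<=` \big[setU/set0]_(i < n) C i.
  move=> q Nq; have /existsNP[i Ai] := noq q.
  rewrite -bigcup_mkord; exists i; first exact: ltn_ord.
  by rewrite /C insubT// => lt; rewrite (_ : Sub _ _ = i)//; exact: val_inj.
have := content_subadditive L (fun i _ => mC i) (mN k) cover.
apply/negP; rewrite -ltNge.
apply: (@le_lt_trans _ _ (\sum_(i < n) eta%:E)%E).
  by apply: lee_sum => i _; exact: LC.
rewrite sumEFin sumr_const card_ord.
apply: (@lt_le_trans _ _ (L K)); last first.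
  apply: le_measure; rewrite ?inE//; exact: KN.
have h : eta *+ n < fine (L K).
  have etaE : eta * n.+1%:R = fine (L K) by rewrite /eta divfK.
  by rewrite -mulr_natr -etaE ltr_pM2l// ltr_nat.
by rewrite -(fineK LK) lte_fin.
Qed.

(** * Measure-preserving rearrangements *)

Lemma measure_bigcup_le d (T : measurableType d) (R : realType)
    (mu : {measure set T -> \bar R}) (F : (set T)^nat) (c : \bar R) :
  (forall n, measurable (F n)) -> (forall n m, (n <= m)%N -> F n `<=` F m) ->
  (forall n, (mu (F n) <= c)%E) -> (mu (\bigcup_n F n) <= c)%E.
Proof.
move=> mF ndF Fc.
have h : mu (F k) @[k --> \oo] --> mu (\bigcup_n F n).
  apply: nondecreasing_cvg_mu => //; first exact: bigcupT_measurable.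
  by move=> n m nm; apply/subsetPset; exact: ndF.
rewrite -(cvg_lim _ h)//; apply: lime_le; first by apply/cvg_ex; eexists; exact: h.
exact: nearW.
Qed.

Lemma measure_bigcap_ge d (T : measurableType d) (R : realType)
    (mu : {measure set T -> \bar R}) (F : (set T)^nat) (c : \bar R) :
  (forall n, measurable (F n)) -> (forall n m, (n <= m)%N -> F m `<=` F n) ->
  (mu (F 0%N) < +oo)%E ->
  (forall n, (c <= mu (F n))%E) -> (c <= mu (\bigcap_n F n))%E.
Proof.
move=> mF niF F0 Fc.
have h : mu (F k) @[k --> \oo] --> mu (\bigcap_n F n).
  apply: nonincreasing_cvg_mu => //; first exact: bigcapT_measurable.
  by move=> n m nm; apply/subsetPset; exact: niF.
rewrite -(cvg_lim _ h)//; apply: lime_ge; first by apply/cvg_ex; eexists; exact: h.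
exact: nearW.
Qed.

Lemma measurable_set_le d (T : measurableType d) (R : realType) (f : T -> R) (r : R) :
  measurable_fun [set: T] f -> measurable [set x | f x <= r].
Proof.
move=> mf; have := measurable_fun_le measurableT mf (measurable_cst r).
by rewrite setTI.
Qed.

Lemma measurable_fun_of_le d (T : measurableType d) (R : realType) (f : T -> R) :
  (forall r, measurable [set x | f x <= r]) -> measurable_fun [set: T] f.
Proof.
move=> h mT; apply: (measurability _ (RGenOInfty.measurableE R)) => //.
move=> _ [_ [r ->] <-]; rewrite setTI.
rewrite (_ : _ @^-1` _ = ~` [set x | f x <= r]); first exact: measurableC.
by apply/seteqP; split=> x /=; rewrite in_itv/= andbT ltNge => /negP.
Qed.

Lemma inv_nat_lt (R : realType) (e : R) : 0 < e -> exists n : nat, n.+1%:R^-1 < e.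
Proof.
move=> e0; exists (Num.truncn (e^-1)).
by rewrite invf_plt ?posrE// truncnS_gt.
Qed.

Lemma le_of_le_inv (R : realType) (x y : R) :
  (forall n : nat, x <= y + n.+1%:R^-1) -> x <= y.
Proof.
move=> h; rewrite leNgt; apply/negP => yx.
have xy0 : 0 < x - y by rewrite subr_gt0.
have [n hn] := inv_nat_lt xy0.
by have := h n; rewrite -lerBlDl leNgt hn.
Qed.

Section DistributionFunction.
Context d (T : measurableType d) (R : realType).
Variables (mu : probability T R) (A : set T) (f : T -> R).
Hypotheses (mA : measurable A) (mf : measurable_fun [set: T] f).

Definition distr (t : R) : R := fine (mu (A `&` [set x | f x <= t])).

Lemma measurable_sublevel t : measurable (A `&` [set x | f x <= t]).
Proof. by apply: measurableI => //; exact: measurable_set_le. Qed.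

Lemma distrE t : mu (A `&` [set x | f x <= t]) = (distr t)%:E.
Proof. by rewrite /distr fineK//; apply: fin_num_measure; exact: measurable_sublevel. Qed.

Lemma distr_ge0 t : 0 <= distr t.
Proof. by rewrite -lee_fin -distrE measure_ge0. Qed.

Lemma distr_mono s t : s <= t -> distr s <= distr t.
Proof.
move=> st; rewrite -lee_fin -!distrE; apply: le_measure; rewrite ?inE//;
  try exact: measurable_sublevel.
by apply: setIS => x /= /le_trans; apply.
Qed.

(** Right continuity of the distribution function. *)
Lemma distr_le (c t : R) : (forall n : nat, c <= distr (t + n.+1%:R^-1)) -> c <= distr t.
Proof.
move=> h; rewrite -lee_fin -distrE.
rewrite (_ : A `&` _ = \bigcap_n (A `&` [set x | f x <= t + n.+1%:R^-1])).
  apply: measure_bigcap_ge.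
  - by move=> n; exact: measurable_sublevel.
  - move=> n m nm; apply: setIS => x /= /le_trans; apply; rewrite lerD2l.
    by rewrite lef_pV2 ?posrE// ler_nat.
  - by rewrite -ge0_fin_numE// fin_num_measure//; exact: measurable_sublevel.
  - move=> n; suff : (c%:E <= (distr (t + n.+1%:R^-1))%:E)%E by rewrite -distrE.
    by rewrite lee_fin.
apply/seteqP; split=> x.
  by case=> Ax /= fx n _; split=> //=; apply: (le_trans fx); rewrite lerDl invr_ge0.
move=> h1; have Ax : A x by case: (h1 0%N Logic.I).
by split=> //=; apply: le_of_le_inv => n; case: (h1 n Logic.I).
Qed.

Lemma measurable_distr_comp : measurable_fun [set: T] (fun x => distr (f x)).
Proof.
have md : measurable_fun [set: R] distr.
  apply: measurable_fun_of_le => r.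
  have [h|] := pselect (forall t, distr t <= r).
    by rewrite (_ : [set _ | _] = setT)//; apply/seteqP; split=> // x _; exact: h.
  move=> /existsNP[t1 /negP]; rewrite -ltNge => t1r.
  have [[t0 t0r]|h] := pselect (exists t, distr t <= r); last first.
    by rewrite (_ : [set _ | _] = set0)//; apply/seteqP; split=> // x /= xr; apply: h; exists x.
  apply: is_interval_measurable => x y /= xr yr z /andP[_ zy].
  by apply: le_trans yr; exact: distr_mono.
exact: (measurableT_comp md mf).
Qed.

(* Atomlessness makes the distribution function of [f] uniformly distributed. *)
Lemma distr_level (th : R) : (forall t, mu [set x | f x = t] = 0%E) -> 0 <= th ->
  (th%:E <= mu A)%E -> mu (A `&` [set x | distr (f x) <= th]) = th%:E.
Proof.
move=> atom th0 thA.
have mL : measurable (A `&` [set x | distr (f x) <= th]).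
  by apply: measurableI => //; apply: measurable_set_le; exact: measurable_distr_comp.
(* If [distr] always exceeds [th], then [th] is 0, by the limit at minus infinity. *)
have [[t0 t0th]|h] := pselect (exists t, distr t <= th); last first.
  have lt t : th < distr t by rewrite ltNge; apply/negP => ?; apply: h; exists t.
  rewrite (_ : [set _ | _] = set0); last first.
    by apply/seteqP; split=> // x /=; rewrite leNgt lt.
  rewrite setI0 measure0; congr EFin; apply/eqP; rewrite eq_le th0 /=.
  have : (th%:E <= mu (\bigcap_n (A `&` [set x | (f x <= - n%:R)%R])))%E.
    apply: measure_bigcap_ge.
    - by move=> n; exact: measurable_sublevel.
    - by move=> n m nm; apply: setIS => x /= /le_trans; apply; rewrite lerN2 ler_nat.
    - by rewrite -ge0_fin_numE// fin_num_measure//; exact: measurable_sublevel.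
    - move=> n; suff : (th%:E <= (distr (- n%:R))%:E)%E by rewrite -distrE.
      by rewrite lee_fin ltW.
  rewrite (_ : \bigcap_n _ = set0) ?measure0 ?lee_fin//.
  apply/seteqP; split=> // x h1; have := (h1 (Num.truncn (- f x)).+1 Logic.I).2 => /=.
  by rewrite lerNr leNgt truncnS_gt.
(* If the level set is unbounded, [distr] never exceeds [th], and the limit at plus infinity shows
   that [th] is the mass of A. *)
have [hub|hub] := pselect (has_ubound [set t | distr t <= th]); last first.
  have all t : distr t <= th.
    rewrite leNgt; apply/negP => tth; apply: hub; exists t => s /= sth.
    by rewrite leNgt; apply/negP => /ltW/distr_mono; lra.
  rewrite (_ : [set _ | _] = setT); last by apply/seteqP; split=> // x _; exact: all.
  rewrite setIT; apply/eqP; rewrite eq_le thA andbT.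
  have : (mu (\bigcup_n (A `&` [set x | (f x <= n%:R)%R])) <= th%:E)%E.
    apply: measure_bigcup_le.
    - by move=> n; exact: measurable_sublevel.
    - by move=> n m nm; apply: setIS => x /= /le_trans; apply; rewrite ler_nat.
    - move=> n; suff : ((distr n%:R)%:E <= th%:E)%E by rewrite -distrE.
      by rewrite lee_fin.
  rewrite (_ : \bigcup_n _ = A)//; apply/seteqP; split=> [x [n _ []]//|x Ax].
  by exists (Num.truncn (f x)).+1 => //; split=> //=; apply: ltW; exact: truncnS_gt.
pose t := sup [set t | distr t <= th].
have hs : has_sup [set t | distr t <= th] by split=> //; exists t0.
have below s : s < t -> distr s <= th.
  move=> st; have ts0 : 0 < t - s by rewrite subr_gt0.
  have [r rth sr] := sup_adherent ts0 hs.
  have sr' : s < r by move: sr; rewrite -/t; lra.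
  exact: le_trans (distr_mono (ltW sr')) rth.
have above s : t < s -> th < distr s.
  move=> ts; rewrite ltNge; apply/negP => sth.
  by have := ub_le_sup hub sth; rewrite -/t; lra.
have ge : th <= distr t.
  by apply: distr_le => n; apply: ltW; apply: above; rewrite ltrDl invr_gt0.
(* The left limit at [t] is at most [th], and [f = t] has no mass. *)
have le : distr t <= th.
  have mlt : measurable (A `&` [set x | f x < t]).
    apply: measurableI => //; rewrite (_ : [set _ | _] = f @^-1` `]-oo, t[%classic).
      by apply: measurable_preimageT.
    by apply/seteqP; split=> x /=; rewrite in_itv.
  have meq : measurable [set x | f x = t].
    rewrite (_ : [set _ | _] = f @^-1` [set t])//; exact: measurable_preimageT.
  have lt : (mu (A `&` [set x | (f x < t)%R]) <= th%:E)%E.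
    have : (mu (\bigcup_n (A `&` [set x | (f x <= t - n.+1%:R^-1)%R])) <= th%:E)%E.
      apply: measure_bigcup_le.
      - by move=> n; exact: measurable_sublevel.
      - move=> n m nm; apply: setIS => x /= /le_trans; apply; rewrite lerD2l lerN2.
        by rewrite lef_pV2 ?posrE// ler_nat.
      - move=> n; suff : ((distr (t - n.+1%:R^-1))%:E <= th%:E)%E by rewrite -distrE.
        by rewrite lee_fin; apply: below; rewrite ltrBlDr ltrDl invr_gt0.
    rewrite (_ : \bigcup_n _ = A `&` [set x | f x < t])//.
    apply/seteqP; split=> x.
      by case=> n _ [Ax /= fx]; split=> //=; apply: (le_lt_trans fx); rewrite ltrBlDr ltrDl invr_gt0.
    case=> Ax /= fx; have xt : 0 < t - f x by rewrite subr_gt0.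
    have [n hn] := inv_nat_lt xt; exists n => //; split=> //=.
    by rewrite lerBrDl -lerBrDr ltW.
  rewrite -lee_fin -distrE; apply: le_trans lt.
  apply: (@le_trans _ _ (mu ((A `&` [set x | (f x < t)%R]) `|` [set x | f x = t]))).
    apply: le_measure; rewrite ?inE; [exact: measurable_sublevel|exact: measurableU|].
    move=> x [Ax /=]; rewrite le_eqVlt => /orP[/eqP|] ?; [by right|by left].
  apply: (le_trans (measureU2 _ _ _)) => //.
  by rewrite [X in (_ + X)%E]atom adde0.
have Gt : distr t = th by apply/eqP; rewrite eq_le le ge.
rewrite -Gt -distrE; congr (mu (A `&` _)); apply/seteqP; split=> x /=.
  by rewrite Gt => xth; rewrite leNgt; apply/negP => /above; rewrite ltNge xth.
exact: distr_mono.
Qed.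

End DistributionFunction.

Lemma shrink d (T : measurableType d) (R : realType) (mu : probability T R)
    (f : T -> R) (A : set T) (th : R) : measurable_fun [set: T] f ->
  (forall t, mu [set x | f x = t] = 0%E) -> measurable A -> 0 <= th ->
  (th%:E <= mu A)%E -> exists B, [/\ measurable B, B `<=` A & mu B = th%:E].
Proof.
move=> mf atom mA th0 thA; exists (A `&` [set x | distr mu A f (f x) <= th]); split.
- by apply: measurableI => //; apply: measurable_set_le; exact: measurable_distr_comp.
- by move=> x [].
- exact: distr_level.
Qed.

(* Transport to the line: the composition of the (uniform) distribution function
   of [f] on [A] with the quantile function of [j] on [B]. *)
Section Quantile.
Context d (T : measurableType d) (R : realType).
Variables (mu : probability T R) (A B : set T) (f j : T -> R).
Hypotheses (mA : measurable A) (mB : measurable B) (AB : mu A = mu B).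
Hypotheses (mf : measurable_fun [set: T] f) (mj : measurable_fun [set: T] j).
Hypothesis atom : forall t, mu [set x | f x = t] = 0%E.
Hypothesis j01 : forall x, 0 <= j x <= 1.

(** The point 1 is adjoined so that the infimum exists and lies in [0, 1] for every [th]. *)
Definition quantile_set (th : R) : set R :=
  [set r | 0 <= r <= 1 /\ (th <= distr mu B j r \/ r = 1)].

Definition quantile (th : R) : R := inf (quantile_set th).

Lemma quantile_has_inf th : has_inf (quantile_set th).
Proof.
split; first by exists 1; split; [rewrite ler01 lexx|right].
by exists 0 => r [/andP[]].
Qed.

(** Galois connection between quantiles and distribution function; right continuity closes the
    infimum. The value r = 1 is excluded because 1 was adjoined by hand. *)
Lemma quantile_le th r : 0 <= r -> r < 1 -> (quantile th <= r) = (th <= distr mu B j r).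
Proof.
move=> r0 r1; apply/idP/idP => [h|h]; last first.
  apply: inf_lbound; first by case: (quantile_has_inf th).
  by split; [rewrite r0 ltW|left].
apply: distr_le => // n.
have e0 : 0 < Num.min (n.+1%:R^-1) (1 - r) by rewrite lt_min invr_gt0 ltr0Sn subr_gt0.
have [s [/andP[s0 s1] sth] hs] := inf_adherent e0 (quantile_has_inf th).
have hs' : s < r + Num.min (n.+1%:R^-1) (1 - r).
  by apply: (lt_le_trans hs); rewrite lerD2r.
have m1 : Num.min (n.+1%:R^-1) (1 - r) <= n.+1%:R^-1 by rewrite ge_min lexx.
have m2 : Num.min (n.+1%:R^-1) (1 - r) <= 1 - r by rewrite ge_min lexx orbT.
case: sth => [sth|s1'].
  apply: (le_trans sth); apply: distr_mono => //.
  by apply: ltW; apply: (lt_le_trans hs'); rewrite lerD2l.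
exfalso; move: hs'; rewrite s1' ltNge => /negP; apply.
by rewrite addrC -lerBrDr.
Qed.

Lemma quantile_ge0 th : 0 <= quantile th.
Proof.
have [[r rS] _] := quantile_has_inf th.
by apply: lb_le_inf; [exists r|move=> s [/andP[]]].
Qed.

Lemma quantile_le1 th : quantile th <= 1.
Proof.
apply: inf_lbound; first by case: (quantile_has_inf th).
by split; [rewrite ler01 lexx|right].
Qed.

Definition line_transport (x : T) : R := quantile (distr mu A f (f x)).

Lemma line_transport_le r : [set x | line_transport x <= r] =
  if r < 0 then set0 else if r < 1 then [set x | distr mu A f (f x) <= distr mu B j r]
  else [set: T].
Proof.
apply/seteqP; split=> x /=; rewrite /line_transport.
  have q0 := quantile_ge0 (distr mu A f (f x)).
  case: ifPn => [r0|]; first by move=> /(le_trans q0); rewrite leNgt r0.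
  by rewrite -leNgt => r0; case: ifPn => // r1 /=; rewrite quantile_le.
case: ifPn => //; rewrite -leNgt => r0; case: ifPn => [r1|]; first by rewrite quantile_le.
by rewrite -leNgt => r1 _; apply: le_trans r1; exact: quantile_le1.
Qed.

Lemma measurable_line_transport : measurable_fun [set: T] line_transport.
Proof.
apply: measurable_fun_of_le => r; rewrite line_transport_le.
case: ifPn => // _; case: ifPn => // _.
by apply: measurable_set_le; exact: measurable_distr_comp.
Qed.

Lemma line_transport_distr r :
  mu (A `&` [set x | line_transport x <= r]) = mu (B `&` [set x | j x <= r]).
Proof.
rewrite line_transport_le; case: ifPn => [r0|_].
  rewrite setI0 (_ : B `&` _ = set0) ?measure0//; apply/seteqP; split=> // x [_ /=].
  by rewrite leNgt (lt_le_trans r0)//; case/andP: (j01 x).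
case: ifPn => [r1|]; last first.
  rewrite -leNgt => r1; rewrite setIT AB; congr (mu _).
  by apply/seteqP; split=> [x Bx|x []//]; split=> //=; apply: le_trans r1; case/andP: (j01 x).
rewrite distr_level ?distrE//; first exact: distr_ge0.
rewrite -distrE// AB; apply: le_measure; rewrite ?inE//.
exact: measurable_sublevel.
Qed.

(** Both sides are finite measures in [C]. They agree on the rays ]r, +oo[, by complement from
    [line_transport_distr], and these rays generate the Borel sets. *)
Lemma line_transport_pushforward (C : set R) : measurable C ->
  mu (A `&` line_transport @^-1` C) = mu (B `&` j @^-1` C).
Proof.
move=> mC.
pose m1 : {measure set R -> \bar R} :=
  measure_function_pushforward__canonical__measure_function_Measure (mrestr mu mA) measurable_line_transport.
pose m2 : {measure set R -> \bar R} :=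
  measure_function_pushforward__canonical__measure_function_Measure (mrestr mu mB) mj.
have m1E D : m1 D = mu (A `&` line_transport @^-1` D) by rewrite setIC.
have m2E D : m2 D = mu (B `&` j @^-1` D) by rewrite setIC.
rewrite -m1E -m2E.
have cpl (S : set T) (g : T -> R) r : measurable_fun [set: T] g -> measurable S ->
    mu (S `&` g @^-1` `]r, +oo[) = (mu S - mu (S `&` [set x | (g x <= r)%R]))%E.
  move=> mg mS; rewrite -measureD//; last 2 first.
  - exact: measurable_set_le.
  - by rewrite -ge0_fin_numE// fin_num_measure.
  congr (mu _); apply/seteqP; split=> x [Sx] /=; rewrite in_itv/= andbT ltNge => /negP h.
    by split.
  by split.
apply: (@measure_unique _ R R (@RGenOInfty.G R) (fun n => `]- n%:R, +oo[%classic)) => //.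
- exact: (RGenOInfty.measurableE R).
- move=> _ _ [x ->] [y ->]; exists (Num.max x y); apply/seteqP; split=> z /=.
    by case=> /=; rewrite !in_itv/= !andbT gt_max => -> ->.
  by rewrite !in_itv/= !andbT gt_max => /andP[].
- by move=> n; exists (- n%:R).
- apply/seteqP; split=> // x _; exists (Num.truncn (- x)).+1 => //=.
  by rewrite in_itv/= andbT ltrNl truncnS_gt.
- move=> _ [r ->]; rewrite m1E m2E !cpl ?AB ?line_transport_distr//.
  exact: measurable_line_transport.
- move=> n; rewrite m1E -ge0_fin_numE// fin_num_measure//; apply: measurableI => //.
  by apply: measurable_preimageT => //; exact: measurable_line_transport.
Qed.

End Quantile.

(* A sequence of bits is coded by the real number with these base 4 digits; as
   only the digits 0 and 1 occur, they are recovered by the greedy algorithm. *)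
Section DigitCoding.
Variable R : realType.

Definition digit_sum (b : nat -> bool) (n : nat) : R :=
  \sum_(i < n) (b i)%:R * (4^-1) ^+ i.+1.

Definition digit_code (b : nat -> bool) : R := sup (range (digit_sum b)).

Fixpoint digit_rem (n : nat) (r : R) : R :=
  if n is m.+1 then
    let r' := digit_rem m r in if (4^-1) ^+ m.+1 <= r' then r' - (4^-1) ^+ m.+1 else r'
  else r.

Definition digit (n : nat) (r : R) : bool := (4^-1) ^+ n.+1 <= digit_rem n r.

Lemma digit_sumS b n : digit_sum b n.+1 = digit_sum b n + (b n)%:R * (4^-1) ^+ n.+1.
Proof. by rewrite /digit_sum big_ord_recr. Qed.

Lemma digit_sum_mono b n m : (n <= m)%N -> digit_sum b n <= digit_sum b m.
Proof.
move=> /subnK <-; elim: (m - n)%N => // k IH.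
rewrite addSn digit_sumS; apply: (le_trans IH); rewrite lerDl mulr_ge0//.
Qed.

(** With digits at most 1, what follows the first n digits adds up to at most 4^-n / 3. This is less
    than the unit 4^-n of the last digit read, so the greedy algorithm is never misled. *)
Lemma digit_sum_tail b n k :
  digit_sum b (k + n) + (4^-1) ^+ (k + n) / 3 <= digit_sum b n + (4^-1) ^+ n / 3.
Proof.
elim: k => // k IH; apply: le_trans IH; rewrite addSn digit_sumS exprS.
have e0 : 0 <= (4^-1 : R) ^+ (k + n) by rewrite exprn_ge0.
by case: (b _); rewrite ?mul1r ?mul0r; lra.
Qed.

Lemma digit_sum_le b n m : digit_sum b m <= digit_sum b n + (4^-1) ^+ n / 3.
Proof.
have e0 k : 0 <= (4^-1 : R) ^+ k / 3 by rewrite divr_ge0// exprn_ge0.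
have [mn|/ltnW nm] := leqP m n.
  by apply: (le_trans (digit_sum_mono b mn)); rewrite lerDl.
have := digit_sum_tail b n (m - n); rewrite subnK// => h.
by apply: le_trans h; rewrite lerDl.
Qed.

Lemma digit_code_bounds b n :
  digit_sum b n <= digit_code b <= digit_sum b n + (4^-1) ^+ n / 3.
Proof.
apply/andP; split.
  apply: ub_le_sup; last by exists n.
  by exists (digit_sum b 0 + (4^-1) ^+ 0 / 3) => _ [m _ <-]; exact: digit_sum_le.
apply: ge_sup; first by exists (digit_sum b 0); exists 0%N.
by move=> _ [m _ <-]; exact: digit_sum_le.
Qed.

Lemma digit_code01 b : 0 <= digit_code b <= 1.
Proof.
have := digit_code_bounds b 0; rewrite /digit_sum big_ord0 expr0 => /andP[h1 h2].
by apply/andP; split => //; lra.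
Qed.

Lemma digit_code_le b r : (digit_code b <= r) <-> forall n, digit_sum b n <= r.
Proof.
split=> [h n|h]; first by apply: le_trans h; case/andP: (digit_code_bounds b n).
apply: ge_sup; first by exists (digit_sum b 0); exists 0%N.
by move=> _ [m _ <-].
Qed.

Lemma digit_remE b n : digit_rem n (digit_code b) = digit_code b - digit_sum b n.
Proof.
elim: n => [|n IH] /=; first by rewrite /digit_sum big_ord0 subr0.
have e0 : 0 < (4^-1 : R) ^+ n.+1 by rewrite exprn_gt0.
have := digit_code_bounds b n.+1; rewrite IH digit_sumS.
case: (b n); rewrite ?mul1r ?mul0r => /andP[h1 h2].
  by rewrite ifT; [ring|lra].
by rewrite ifF ?addr0//; apply/negbTE; rewrite -ltNge; lra.
Qed.

Lemma digitK b n : digit n (digit_code b) = b n.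
Proof.
have e0 : 0 < (4^-1 : R) ^+ n.+1 by rewrite exprn_gt0.
rewrite /digit digit_remE; have := digit_code_bounds b n.+1; rewrite digit_sumS.
case: (b n); rewrite ?mul1r ?mul0r => /andP[h1 h2]; first by lra.
by apply/negbTE; rewrite -ltNge; lra.
Qed.

Lemma measurable_digit_rem n : measurable_fun [set: R] (digit_rem n).
Proof.
elim: n => [|n IH] /=; first exact: measurable_id.
apply: measurable_fun_ifT => //.
  by apply: measurable_fun_ler => //; exact: measurable_cst.
by apply: measurable_funB => //; exact: measurable_cst.
Qed.

Lemma measurable_digit n : measurable_fun [set: R] (digit n).
Proof.
apply: measurable_fun_ler; first exact: measurable_cst.
exact: measurable_digit_rem.
Qed.

Lemma measurable_digit_code d (T : measurableType d) (b : T -> nat -> bool) :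
  (forall n, measurable_fun [set: T] (fun x => b x n)) ->
  measurable_fun [set: T] (fun x => digit_code (b x)).
Proof.
move=> mb; apply: measurable_fun_of_le => r.
rewrite (_ : [set _ | _] = \bigcap_n [set x | digit_sum (b x) n <= r]); last first.
  by apply/seteqP; split=> x /=; [move=> /digit_code_le h n _; exact: h|
    move=> h; apply/digit_code_le => n; exact: h].
apply: bigcapT_measurable => n; apply: measurable_set_le.
elim: n => [|n IH].
  rewrite (_ : (fun x => _) = cst 0) //.
  by apply/funext => x; rewrite /digit_sum big_ord0.
rewrite (_ : (fun x => _) = (fun x => digit_sum (b x) n + (if b x n then (4^-1) ^+ n.+1 else 0))).
  by apply: measurable_funD => //; apply: measurable_fun_ifT.
by apply/funext => x; rewrite digit_sumS; case: (b x n); rewrite ?mul1r ?mul0r.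
Qed.

End DigitCoding.

Section HeisCoding.
Variable R : realType.

Definition nth_rat (m : nat) : R := ratr (odflt 0 (unpickle m : option rat)).

Definition coord (i : nat) (q : heis R) : R :=
  if i is 0%N then q.1.1 else if i is 1%N then q.1.2 else q.2.

(** The Dedekind cuts of the three coordinates, interleaved: bit 3 m + i compares coordinate i with
    the m-th rational. *)
Definition heis_bit (q : heis R) (n : nat) : bool :=
  nth_rat (n %/ 3)%N < coord (n %% 3)%N q.

Definition heis_code (q : heis R) : R := digit_code R (heis_bit q).

(** A coordinate is recovered as the supremum of its cut, with -oo as the neutral value; a countable
    supremum of measurable functions of r is measurable. *)
Definition decode_coord (i : nat) (r : R) : R :=
  fine (esups (fun m => if digit (m * 3 + i)%N r then (nth_rat m)%:E else -oo%E) 0%N).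

Definition heis_decode (r : R) : heis R :=
  (decode_coord 0 r, decode_coord 1 r, decode_coord 2 r).

Lemma measurable_coord i : measurable_fun [set: heis R] (coord i).
Proof.
case: i => [|[|i]]; [exact: measurable_heis11|exact: measurable_heis12|exact: measurable_heis2].
Qed.

Lemma measurable_heis_code : measurable_fun [set: heis R] heis_code.
Proof.
apply: measurable_digit_code => n.
apply: (@eq_measurable_fun _ _ _ _ _ (fun q => ~~ (coord (n %% 3) q <= nth_rat (n %/ 3)))).
  by move=> q _; rewrite -ltNge.
apply: measurable_neg; apply: measurable_fun_ler; first exact: measurable_coord.
exact: measurable_cst.
Qed.

Lemma heis_code01 q : 0 <= heis_code q <= 1.
Proof. exact: digit_code01. Qed.

Lemma measurable_decode_coord i : measurable_fun [set: R] (decode_coord i).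
Proof.
apply: (measurableT_comp (fine_measurable measurableT)).
apply: measurable_fun_esups => m.
by apply: measurable_fun_ifT => //; exact: measurable_digit.
Qed.

Lemma measurable_heis_decode : measurable_fun [set: R] heis_decode.
Proof. by apply: measurable_heisP; exact: measurable_decode_coord. Qed.

Lemma decode_coordK i q : (i < 3)%N -> decode_coord i (heis_code q) = coord i q.
Proof.
move=> i3; rewrite /decode_coord.
have E m : digit (m * 3 + i)%N (heis_code q) = (nth_rat m < coord i q).
  by rewrite digitK /heis_bit divnMDl// divn_small// addn0 modnMDl modn_small.
rewrite (_ : esups _ _ = (coord i q)%:E)//.
apply/eqP; rewrite eq_le; apply/andP; split.
  apply: ge_ereal_sup => _ [m _ <-] /=; rewrite E; case: ifPn => [h|_]; last exact: leNye.
  by rewrite lee_fin ltW.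
apply/lee_subgt0Pr => e e0.
have lt : coord i q - e < coord i q by rewrite ltrBlDr ltrDl.
have [r] := rat_in_itvoo lt; rewrite in_itv/= => /andP[r1 r2].
apply: (@le_trans _ _ (ratr r)%:E); first by rewrite -EFinB lee_fin ltW.
apply: ereal_sup_ubound; exists (pickle r) => //=.
have nE : nth_rat (pickle r) = ratr r by rewrite /nth_rat pickleK.
by rewrite E nE r2.
Qed.

Lemma heis_codeK : cancel heis_code heis_decode.
Proof.
move=> q; rewrite /heis_decode !decode_coordK//=.
by case: q => -[].
Qed.

End HeisCoding.

(** The injective Borel code reduces the target to the line: transport A to the law of the code on
    B, then decode. *)
Lemma rearrangement (R : realType) (mu : probability (heis R) R) (A B : set (heis R)) :
  (forall t, mu [set q : heis R | q.1.1 = t] = 0%E) ->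
  measurable A -> measurable B -> mu A = mu B -> B !=set0 ->
  exists s : heis R -> heis R, [/\ measurable_fun [set: heis R] s,
    forall q, B (s q) &
    forall C, measurable C -> mu (A `&` s @^-1` C) = mu (B `&` C)].
Proof.
move=> atom mA mB AB [b0 Bb0].
have mf := measurable_heis11 (R:=R).
have mj := measurable_heis_code (R:=R).
pose T := line_transport mu A B (fun q : heis R => q.1.1) (@heis_code R).
have mT : measurable_fun [set: heis R] T by exact: measurable_line_transport.
pose s1 q := heis_decode (T q).
have ms1 : measurable_fun [set: heis R] s1.
  exact: (measurableT_comp (@measurable_heis_decode R) mT).
have s1P C : measurable C -> mu (A `&` s1 @^-1` C) = mu (B `&` C).
  move=> mC; have mD : measurable (@heis_decode R @^-1` C).
    by apply: measurable_preimageT => //; exact: measurable_heis_decode.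
  have := @line_transport_pushforward _ _ R mu A B _ _ mA mB AB mf mj atom (@heis_code01 R) _ mD.
  rewrite -[_ @^-1` (_ @^-1` _)]/(s1 @^-1` C) => ->; congr (mu (_ `&` _)).
  by apply/seteqP; split=> q /=; rewrite heis_codeK.
have mB1 : measurable (s1 @^-1` B) by exact: measurable_preimageT.
(* The decoded map lands in B only up to a null subset of A; the default b0 makes s land in B
   everywhere. *)
pose s q := if q \in s1 @^-1` B then s1 q else b0.
have mmem : measurable_fun [set: heis R] (fun q => q \in s1 @^-1` B).
  apply: (measurable_fun_bool true); rewrite setTI.
  rewrite (_ : _ @^-1` _ = s1 @^-1` B)//.
  by apply/seteqP; split=> q /=; [move=> /set_mem|move=> h; apply: mem_set].
have ms : measurable_fun [set: heis R] s by apply: measurable_fun_ifT.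
exists s; split=> //.
  by move=> q; rewrite /s; case: ifPn => //; rewrite inE.
move=> C mC; rewrite -s1P//.
have mAs : measurable (A `&` s @^-1` C) by apply: measurableI => //; exact: measurable_preimageT.
have mAs1 : measurable (A `&` s1 @^-1` C) by apply: measurableI => //; exact: measurable_preimageT.
have N0 : mu (A `&` s1 @^-1` (~` B)) = 0%E.
  by rewrite s1P ?setICr ?measure0//; exact: measurableC.
have mN : measurable (A `&` s1 @^-1` (~` B)).
  by apply: measurableI => //; apply: measurable_preimageT => //; exact: measurableC.
have key (X Y : set (heis R)) : measurable X -> measurable Y ->
    X `<=` Y `|` (A `&` s1 @^-1` (~` B)) -> (mu X <= mu Y)%E.
  move=> mX mY XY; apply: (@le_trans _ _ (mu (Y `|` (A `&` s1 @^-1` (~` B))))).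
    by apply: le_measure; rewrite ?inE//; exact: measurableU.
  by apply: (le_trans (measureU2 _ _ _)) => //; rewrite [X in (_ + X)%E]N0 adde0.
apply/eqP; rewrite eq_le; apply/andP; split; apply: key => // q [Aq].
  rewrite /= /s; case: ifPn => [_ ?|]; first by left.
  by rewrite notin_setE => /= nB _; right.
rewrite /= /s => Cs1.
have [Bq|nB] := pselect (B (s1 q)); last by right.
by left; split => //=; rewrite ifT// inE.
Qed.

(** * Sufficiency *)

(* The cost is not known to be measurable in the second variable, so the
   library's monotonicity of the integral does not apply to it. *)
Lemma le_integral_ge0 d (T : measurableType d) (R : realType)
    (mu : {measure set T -> \bar R}) (f g : T -> \bar R) :
  (forall x, 0 <= f x)%E -> (forall x, f x <= g x)%E ->
  (\int[mu]_x f x <= \int[mu]_x g x)%E.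
Proof.
move=> f0 fg; rewrite !ge0_integralTE//; last by move=> x; exact: le_trans (fg x).
apply: le_ereal_sup => _ [h hf <-]; exists h => // x; exact: le_trans (fg x).
Qed.

Section Optimality.
Variables (R : realType) (mu : probability (heis R) R).

Lemma integral_probability_cst (r : R) : (\int[mu]_q (cst r%:E q) = r%:E)%E.
Proof.
rewrite integral_cst//.
by apply: etrans (congr1 (fun x => r%:E * x)%E (probability_setT mu)) _; rewrite mule1.
Qed.

Lemma integrable_ae_bounded (f : heis R -> R) (M : R) : measurable_fun [set: heis R] f ->
  {ae mu, forall q, `|f q| <= M} -> mu.-integrable setT (EFin \o f).
Proof.
move=> mf fM; apply/integrableP; split; first exact/measurable_EFinP.
apply: (@le_lt_trans _ _ (\int[mu]_q (cst `|M|%:E q))%E).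
  apply: ae_ge0_le_integral => //.
  - by apply: measurableT_comp => //; exact/measurable_EFinP.
  - by move=> q _ /=; rewrite lee_fin.
  - by apply: filterS fM => q h _ /=; rewrite lee_fin (le_trans h)// ler_norm.
by rewrite integral_probability_cst ltry.
Qed.

Lemma integral_eq_pushforward (S T : heis R -> heis R) (f : heis R -> R) :
  measurable_fun setT S -> measurable_fun setT T -> measurable_fun setT f ->
  (forall A, measurable A -> pushforward mu S A = pushforward mu T A) ->
  mu.-integrable setT (EFin \o (f \o S)) -> mu.-integrable setT (EFin \o (f \o T)) ->
  (\int[mu]_q (f (S q))%:E = \int[mu]_q (f (T q))%:E)%E.
Proof.
move=> mS mT mf ST iS iT.
have mf' : measurable_fun setT (EFin \o f) by exact/measurable_EFinP.
have hS := integral_pushforward mS mf' iS measurableT.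
have hT := integral_pushforward mT mf' iT measurableT.
rewrite -[LHS]hS -[RHS]hT; apply: eq_measure_integral => A mA _; exact: ST.
Qed.

Lemma ae_bounded_pushforward (S T : heis R -> heis R) (f : heis R -> R) (M : R) :
  measurable_fun setT f -> measurable_fun setT S ->
  (forall A, measurable A -> pushforward mu S A = pushforward mu T A) ->
  measurable_fun setT T -> {ae mu, forall q, `|f (T q)| <= M} ->
  {ae mu, forall q, `|f (S q)| <= M}.
Proof.
move=> mf mS ST mT.
have mB : measurable [set q | `|f q| <= M].
  by apply: measurable_set_le; apply: measurableT_comp.
have mTB : measurable (T @^-1` (~` [set q | `|f q| <= M])).
  by apply: measurable_preimageT => //; exact: measurableC.
have mSB : measurable (S @^-1` (~` [set q | `|f q| <= M])).
  by apply: measurable_preimageT => //; exact: measurableC.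
move=> /(measure_negligible mTB) h.
exists (S @^-1` (~` [set q | `|f q| <= M])); split=> //.
by rewrite -[LHS]/(pushforward mu S _) ST//; exact: measurableC.
Qed.

Lemma support_bounded : compactly_supported mu ->
  exists2 M : R, 0 <= M & {ae mu, forall q, `|q.1.1| <= M /\ `|q.1.2| <= M}.
Proof.
move=> /compact_bounded [M [_ hM]].
exists (`|M| + 1); first by rewrite addr_ge0.
exists (~` measure_support mu); split.
- by apply: measurableC; exact: measurable_support.
- exact: support_complement0.
move=> q nq sq; apply: nq.
have := hM (`|M| + 1) _ q sq; rewrite (le_lt_trans (ler_norm M)) ?ltrDl// => /(_ isT) h.
by split; apply: le_trans h; [exact: norm_heis11|exact: norm_heis12].
Qed.

Lemma straight_translation_optimal (p x0 y0 : R) (S : heis R -> heis R) :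
  0 < p -> p < 1 -> 0 < x0 + y0 -> 0 < x0 - y0 -> compactly_supported mu ->
  admissible_map mu (pushforward mu (right_translation (x0, y0, 0%R))) S ->
  (transport_cost p mu S <= transport_cost p mu (right_translation (x0, y0, 0%R)))%E.
Proof.
move=> p0 p1 s0 t0 cmu [mS SR tauS].
set T := right_translation (x0, y0, 0) in SR *.
have mT : measurable_fun setT T by exact: measurable_heis_mul.
set m := Num.sqrt ((x0 + y0) * (x0 - y0)).
have m0 : 0 < m by rewrite sqrtr_gt0 mulr_gt0.
have mp0 : 0 < m `^ p by rewrite powR_gt0.
(* The linear part of the tangent of [cost_le_linear]; it serves as the Kantorovich potential. *)
pose lam (q : heis R) := m `^ p / 2 * ((q.1.1 + q.1.2) / (x0 + y0) + (q.1.1 - q.1.2) / (x0 - y0)).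
have mlam : measurable_fun setT lam.
  have h1 := measurable_heis11 (R:=R); have h2 := measurable_heis12 (R:=R).
  apply: measurable_funM => //; apply: measurable_funD; apply: measurable_funM => //.
    exact: measurable_funD.
  exact: measurable_funB.
have [M M0 hM] := support_bounded cmu.
pose C := m `^ p / 2 * ((M + `|x0| + (M + `|y0|)) / (x0 + y0) + (M + `|x0| + (M + `|y0|)) / (x0 - y0)).
have lamC q : `|q.1.1| <= M + `|x0| -> `|q.1.2| <= M + `|y0| -> `|lam q| <= C.
  move=> h1 h2; rewrite /lam normrM (@ger0_norm _ (_ / 2)) ?divr_ge0 ?(ltW mp0)//.
  rewrite ler_pM2l ?divr_gt0//; apply: le_trans (ler_normD _ _) _.
  rewrite !normrM !normfV (gtr0_norm s0) (gtr0_norm t0).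
  by apply: lerD; rewrite ler_pM2r ?invr_gt0//;
    [apply: le_trans (ler_normD _ _) _|apply: le_trans (ler_normB _ _) _]; apply: lerD.
have bid : {ae mu, forall q, `|lam q| <= C}.
  apply: filterS hM => q [h1 h2]; apply: lamC.
    by apply: le_trans h1 _; rewrite lerDl.
  by apply: le_trans h2 _; rewrite lerDl.
have bT : {ae mu, forall q, `|lam (T q)| <= C}.
  apply: filterS hM => q [h1 h2]; apply: lamC; rewrite /T /right_translation heis_mulE /=;
    by apply: le_trans (ler_normD _ _) _; rewrite lerD2r.
have bS := ae_bounded_pushforward mlam mS SR mT bT.
have mlS : measurable_fun setT (lam \o S) by exact: measurableT_comp.
have mlT : measurable_fun setT (lam \o T) by exact: measurableT_comp.
have iid := integrable_ae_bounded mlam bid.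
have iT := integrable_ae_bounded mlT bT.
have iS := integrable_ae_bounded mlS bS.
have ST := integral_eq_pushforward mS mT mlam SR iS iT.
have ilam : (\int[mu]_q (lam q)%:E)%E \is a fin_num by exact: integrable_fin_num.
pose c := m `^ p / p - m `^ p.
pose g q := lam (S q) - lam q + c.
have mg : measurable_fun setT g.
  by apply: measurable_funD => //; apply: measurable_funB.
have tauP q : (0 < time_separation q (S q))%E -> (cost p q (S q) <= (g q)%:E)%E.
  move=> tau0; have h := cost_le_linear p0 p1 s0 t0 tau0; apply: (le_trans h).
  rewrite lee_fin le_eqVlt; apply/orP; left; apply/eqP; rewrite /g /lam /c -/m.
  by field; rewrite !gt_eqF.
(* Where tau vanishes the cost is 0 while the tangent may be negative. G dominates the cost
   everywhere and equals g almost everywhere. *)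
pose G q := Num.max 0 (g q).
have mG : measurable_fun setT G by apply: measurable_maxr.
have costG q : (cost p q (S q) <= (G q)%:E)%E.
  have [t0'|] := boolP (0 < time_separation q (S q))%E.
    by apply: le_trans (tauP _ t0') _; rewrite lee_fin /G le_max lexx orbT.
  move=> nt; apply: (@le_trans _ _ 0%E); last by rewrite lee_fin /G le_max lexx.
  by rewrite leNgt; apply: contra nt => /(cost_gt0 p0).
rewrite /transport_cost.
apply: (@le_trans _ _ (\int[mu]_q (G q)%:E)%E).
  by apply: le_integral_ge0 => // q; exact: cost_ge0.
rewrite (@ae_eq_integral _ _ _ _ setT (EFin \o g))//; last 3 first.
- exact/measurable_EFinP.
- exact/measurable_EFinP.
- apply: filterS tauS => q /tauP h _; congr (_%:E); apply/max_idPr.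
  by rewrite -lee_fin; apply: le_trans h; exact: cost_ge0.
apply: (@le_trans _ _ (m `^ p / p)%:E).
  have icst : mu.-integrable setT (EFin \o cst c) by exact: finite_measure_integrable_cst.
  have gE : (\int[mu]_q (EFin \o g) q =
      \int[mu]_q (lam (S q))%:E - \int[mu]_q (lam q)%:E + c%:E)%E.
    apply: etrans (integralD measurableT (integrableB measurableT iS iid) icst) _.
    congr (_ + _)%E; last exact: integral_probability_cst.
    exact: (integralB measurableT iS iid).
  rewrite gE ST.
  (* The translation raises the potential by exactly m^p, which cancels against the constant [c]. *)
  have -> : (\int[mu]_q (lam (T q))%:E = \int[mu]_q (lam q)%:E + (m `^ p)%:E)%E.
    rewrite -[X in (_ + X)%E]integral_probability_cst.
    rewrite -integralD//=; last exact: finite_measure_integrable_cst.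
    apply: eq_integral => q _; rewrite -EFinD; congr (_%:E).
    rewrite /lam /T /right_translation heis_mulE /=; field.
    by rewrite !gt_eqF.
  rewrite [X in (X + c%:E)%E]addeAC subee// add0e -EFinD lee_fin /c.
  by rewrite addrCA subrr addr0.
have -> : ((m `^ p / p)%:E = \int[mu]_q (cst (m `^ p / p)%:E q))%E.
  by rewrite integral_probability_cst.
apply: le_integral_ge0 => q /=; first by rewrite lee_fin divr_ge0 ?(ltW mp0) ?(ltW p0).
apply: cost_ge => //; first exact: ltW.
rewrite /T /right_translation time_separation_right.
exact: time_separation_straight.
Qed.

End Optimality.

(** * Necessity *)

Lemma bigsetU_ordP T n (F : 'I_n -> set T) x :
  (\big[setU/set0]_(i < n) F i) x <-> exists i, F i x.
Proof.
rewrite -bigcup_seq; split=> [[i _ Fi]|[i Fi]]; exists i => //.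
by rewrite /= mem_index_enum.
Qed.

Lemma common_radius (R : realType) (I : finType) (P : I -> R -> Prop) :
  (forall i d e, d <= e -> P i e -> P i d) ->
  (forall i, exists2 d, 0 < d & P i d) -> exists2 d, 0 < d & forall i, P i d.
Proof.
move=> mono h; have /choice[d hd] : forall i, exists d, 0 < d /\ P i d.
  by move=> i; have [d d0 Pd] := h i; exists d.
exists (\big[Num.min/1]_i d i).
  by apply/bigmin_gtP; split=> // i _; have [] := hd i.
move=> i; have [_] := hd i; apply: mono; exact: bigmin_le_cond.
Qed.

(** Each piece is sent to the next with its measure carried over, so the contributions of the pieces
    are only permuted by [ordS]; the rest is fixed. *)
Lemma cyclic_rearrangement (R : realType) (mu : probability (heis R) R) n
    (A : 'I_n -> set (heis R)) (m : \bar R) :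
  (forall t, mu [set q : heis R | q.1.1 = t] = 0%E) ->
  (forall i, measurable (A i)) -> trivIset setT A ->
  (forall i, mu (A i) = m) -> (forall i, A i !=set0) ->
  exists s : heis R -> heis R, [/\ measurable_fun [set: heis R] s,
    forall C, measurable C -> mu (s @^-1` C) = mu C,
    forall i q, A i q -> A (ordS i) (s q) &
    forall q, (forall i, ~ A i q) -> s q = q].
Proof.
move=> atom mA tA Am A0.
have /choice[s hs] : forall i : 'I_n, exists s : heis R -> heis R, [/\ measurable_fun [set: heis R] s,
    forall q, A (ordS i) (s q) &
    forall C, measurable C -> mu (A i `&` s @^-1` C) = mu (A (ordS i) `&` C)].
  by move=> i; apply: rearrangement => //; rewrite !Am.
pose sg q := if [pick i | q \in A i] is Some i then s i q else q.
have sgA i q : A i q -> sg q = s i q.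
  rewrite /sg; case: pickP => [j /set_mem Aj Ai|/(_ i) + Ai].
    by have -> : j = i by apply: tA => //; exists q.
  by rewrite mem_set.
have sgN q : (forall i, ~ A i q) -> sg q = q.
  by rewrite /sg; case: pickP => // j /set_mem Aj /(_ j).
have sgE C : sg @^-1` C = \big[setU/set0]_(i < n) (A i `&` s i @^-1` C) `|`
    ((~` \big[setU/set0]_(i < n) A i) `&` C).
  apply/seteqP; split=> q.
    move=> Cq; have [[i Ai]|nA] := pselect (exists i, A i q).
      by left; apply/bigsetU_ordP; exists i; split=> //=; rewrite -(sgA _ _ Ai).
    right; split; first by move=> /bigsetU_ordP.
    by move: Cq; rewrite /= sgN// => i Ai; apply: nA; exists i.
  case=> [/bigsetU_ordP[i [Ai]]|[nA Cq]]; rewrite /preimage /=; first by rewrite (sgA _ _ Ai).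
  by rewrite sgN// => i Ai; apply: nA; apply/bigsetU_ordP; exists i.
have mI C i : measurable C -> measurable (A i `&` s i @^-1` C).
  move=> mC; apply: measurableI => //; apply: measurable_preimageT => //.
  by have [] := hs i.
have mU : measurable (\big[setU/set0]_(i < n) A i) by exact: bigsetU_measurable.
have tI (B : 'I_n -> set (heis R)) : trivIset setT (fun i => A i `&` B i).
  move=> i j _ _ [q [[Ai _] [Aj _]]]; apply: tA => //; by exists q.
have split_measure (B : 'I_n -> set (heis R)) C : (forall i, measurable (A i `&` B i)) ->
    measurable C ->
    mu (\big[setU/set0]_(i < n) (A i `&` B i) `|` ((~` \big[setU/set0]_(i < n) A i) `&` C)) =
    (\sum_(i < n) mu (A i `&` B i) + mu ((~` \big[setU/set0]_(i < n) A i) `&` C))%E.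
  move=> mB mC; rewrite measureU; last 3 first.
  - exact: bigsetU_measurable.
  - by apply: measurableI => //; exact: measurableC.
  - apply/seteqP; split=> // q [/bigsetU_ordP[i [Ai _]] [nA _]]; apply: nA.
    by apply/bigsetU_ordP; exists i.
  by rewrite measure_bigsetU_ord.
exists sg; split=> //.
- move=> _ C mC; rewrite setTI sgE; apply: measurableU.
    by apply: bigsetU_measurable => i _; exact: mI.
  by apply: measurableI => //; exact: measurableC.
- move=> C mC; rewrite sgE split_measure//; last by move=> i; exact: mI.
  have CE : C = \big[setU/set0]_(i < n) (A i `&` C) `|`
      ((~` \big[setU/set0]_(i < n) A i) `&` C).
    apply/seteqP; split=> q.
      move=> Cq; have [[i Ai]|nA] := pselect (exists i, A i q).
        by left; apply/bigsetU_ordP; exists i.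
      by right; split=> // /bigsetU_ordP.
    by case=> [/bigsetU_ordP[i []]|[]].
  rewrite [in RHS]CE split_measure//; last by move=> i; exact: measurableI.
  congr (_ + _)%E; rewrite [RHS](reindex_inj (@ordS_inj n)).
  by apply: eq_bigr => i _; have [_ _ ->] := hs i.
- by move=> i q Ai; rewrite (sgA _ _ Ai); have [] := hs i.
Qed.

(** A step function with value f i on A i and F elsewhere is inserted below c, which is not assumed
    measurable, and integrated exactly. *)
Lemma integral_step (R : realType) (mu : probability (heis R) R) n
    (A : 'I_n -> set (heis R)) (m F : R) (f : 'I_n -> R) (c : heis R -> \bar R) :
  (forall i, measurable (A i)) -> trivIset setT A -> (forall i, mu (A i) = m%:E) ->
  0 <= F -> (forall q, 0 <= c q)%E ->
  (forall i, 0 <= f i) ->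
  (forall i q, A i q -> ((f i)%:E <= c q)%E) ->
  (forall q, (forall i, ~ A i q) -> (F%:E <= c q)%E) ->
  ((F + m * (\sum_(i < n) f i - n%:R * F))%:E <= \int[mu]_q c q)%E.
Proof.
move=> mA tA Am F0 c0 f0 fc Fc.
pose g q := F + \sum_(i < n) (f i - F) * \1_(A i) q.
have gA i q : A i q -> g q = f i.
  move=> Ai; rewrite /g (bigD1 i)//= big1 ?addr0.
    by rewrite indicE mem_set// mulr1 addrC subrK.
  move=> j ji; rewrite indicE memNset ?mulr0// => Aj.
  by move/eqP: ji; apply; apply: tA => //; exists q.
have gN q : (forall i, ~ A i q) -> g q = F.
  by move=> nA; rewrite /g big1 ?addr0// => i _; rewrite indicE memNset ?mulr0.
have gc q : ((g q)%:E <= c q)%E.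
  have [[i Ai]|nA] := pselect (exists i, A i q); first by rewrite (gA _ _ Ai) fc.
  have nA' i : ~ A i q by move=> Ai; apply: nA; exists i.
  by rewrite gN// Fc.
have g0 q : (0 <= (g q)%:E)%E.
  rewrite lee_fin; have [[i Ai]|nA] := pselect (exists i, A i q).
    by rewrite (gA _ _ Ai).
  by rewrite gN// => i Ai; apply: nA; exists i.
apply: le_trans (le_integral_ge0 mu g0 gc).
have iA i : mu.-integrable setT (EFin \o \1_(A i)).
  apply: (@integrable_ae_bounded _ _ _ 1) => //.
  by apply: aeW => q; rewrite indicE; case: (_ \in _); rewrite ?normr1 ?normr0.
have iZ i : mu.-integrable setT (fun q => (f i - F)%:E * (EFin \o \1_(A i)) q)%E.
  exact: integrableZl.
have icst : mu.-integrable setT (EFin \o cst F) by exact: finite_measure_integrable_cst.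
have isum : mu.-integrable setT (fun q => \sum_(i < n) ((f i - F)%:E * (EFin \o \1_(A i)) q))%E.
  by apply: integrable_sum => // i _; exact: iZ.
have -> : (\int[mu]_q (g q)%:E = \int[mu]_q ((EFin \o cst F) q +
   \sum_(i < n) ((f i - F)%:E * (EFin \o \1_(A i)) q)))%E.
  apply: eq_integral => q _; rewrite /g EFinD; congr (_ + _)%E.
  by rewrite -sumEFin; apply: eq_bigr => i _; rewrite EFinM.
rewrite integralD// integral_sum//.
have -> : (\int[mu]_q (EFin \o cst F) q = F%:E)%E by exact: integral_probability_cst.
rewrite (eq_bigr (fun i => (m * (f i - F))%:E)); last first.
  move=> i _; rewrite integralZl//.
  have -> : (\int[mu]_q (EFin \o \1_(A i)) q = m%:E)%E.
    by rewrite -(Am i) -[X in mu X]setIT; exact: integral_indic.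
  by rewrite -EFinM mulrC.
rewrite sumEFin -EFinD lee_fin -mulr_sumr sumrB sumr_const card_ord -[F *+ n]mulr_natl.
by [].
Qed.

(** * Polygonal loops in the quadratic lower model of the cost *)

Definition jet (R : realType) (F A B k C : R) (h : heis R) : R :=
  F + A * h.1.1 + B * h.1.2 + k * h.2 - C * (h.1.1 ^+ 2 + h.1.2 ^+ 2 + h.2 ^+ 2).

(** The left side is of second order in the angle, the right side of first order. In terms of the
    half angle t, dividing by sin t leaves 4 C sin t (1 + cos^2 t) < k cos t, which follows from 8 C
    sin t < k cos t. *)
Lemma polygon_angle (R : realType) (k C : R) : 0 < k -> 0 <= C ->
  exists n : nat, [/\ (1 < n)%N, 0 < sin (2 * pi / n%:R : R) &
    C * (2 - 2 * cos (2 * pi / n%:R) + sin (2 * pi / n%:R) ^+ 2) < k / 2 * sin (2 * pi / n%:R)].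
Proof.
move=> k0 C0.
have cont : k * cos t - 8 * C * sin t @[t --> (0 : R)] --> k * cos 0 - 8 * C * sin 0.
  apply: cvgB; (apply: cvgM; first exact: cvg_cst).
    exact: continuous_cos.
  exact: continuous_sin.
have cos0' : cos t @[t --> (0 : R)] --> cos (0 : R) by exact: continuous_cos.
have pos : 0 < k * cos 0 - 8 * C * sin 0 by rewrite cos0 sin0 mulr1 mulr0 subr0.
have c00 : 0 < cos (0 : R) by rewrite cos0.
have /nbhs_ballP[d /= d0 hd] :
    nbhs (0 : R) [set t | 0 < k * cos t - 8 * C * sin t /\ 0 < cos t].
  exact: filterI (cvgr_gt _ cont _ pos) (cvgr_gt _ cos0' _ c00).
have [n hn] := inv_nat_lt (divr_gt0 d0 (@pi_gt0 R)).
have pi0 := @pi_gt0 R.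
(* Two more than n, so that the half angle t is below pi and there are at least two vertices. *)
exists n.+2; set t := pi / n.+2%:R : R.
have t0 : 0 < t by rewrite divr_gt0.
have td : t < d.
  rewrite /t mulrC -ltr_pdivlMr//; apply: le_lt_trans hn.
  by rewrite lef_pV2 ?posrE// ler_nat.
have tpi : t < pi.
  by rewrite /t ltr_pdivrMr// ltr_pMr// ltr1n.
have [h1 h2] : (0 < k * cos t - 8 * C * sin t) /\ 0 < cos t.
  by apply: hd; rewrite /ball/= sub0r normrN gtr0_norm.
have s0 : 0 < sin t by apply: sin_gt0_pi; rewrite t0.
have -> : 2 * pi / n.+2%:R = t + t by rewrite /t; field.
rewrite sinD cosD; have := cos2Dsin2 t.
set s := sin t in s0 h1 *; set c := cos t in h1 h2 * => cs.
split=> //; first by rewrite addr_gt0 ?mulr_gt0.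
have -> : 2 - 2 * (c * c - s * s) + (s * c + c * s) ^+ 2 = s * (4 * s * (1 + c ^+ 2)).
  have c2 : c * c = 1 - s ^+ 2 by rewrite -cs; ring.
  by rewrite c2; ring.
have c1 : c ^+ 2 <= 1 by rewrite -cs lerDl sqr_ge0.
have h3 : C * (4 * s * (1 + c ^+ 2)) <= C * (8 * s).
  apply: ler_wpM2l => //.
  have -> : 8 * s = 4 * s * 2 by ring.
  by apply: ler_wpM2l; [rewrite mulr_ge0// ltW|lra].
have -> : C * (s * (4 * s * (1 + c ^+ 2))) = s * (C * (4 * s * (1 + c ^+ 2))) by ring.
have -> : k / 2 * (s * c + c * s) = s * (k * c) by field.
by rewrite ltr_pM2l//; lra.
Qed.

Lemma cos_ordS (R : realType) n (i : 'I_n) (f : R -> R) (th : R) :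
  f (n%:R * th) = f 0 -> f ((ordS i)%:R * th) = f (i%:R * th + th).
Proof.
move=> fn; have -> : i%:R * th + th = i.+1%:R * th by rewrite -natr1; ring.
rewrite /=; have := ltn_ord i; rewrite leq_eqVlt => /orP[/eqP E|h].
  by rewrite E modnn fn mul0r.
by rewrite modn_small.
Qed.

Lemma circle_injective (R : realType) n (i j : 'I_n) :
  cos (i%:R * (2 * pi / n%:R)) = cos (j%:R * (2 * pi / n%:R)) :> R ->
  sin (i%:R * (2 * pi / n%:R)) = sin (j%:R * (2 * pi / n%:R)) :> R -> i = j.
Proof.
wlog ij : i j / (i < j)%N.
  move=> h c s; apply/val_inj; have [ij|ij|//] := ltngtP (val i) (val j).
    exact: congr1 (h _ _ ij c s).
  exact: congr1 (esym (h _ _ ij (esym c) (esym s))).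
move=> c s; exfalso.
have n0 : (0 < n)%N by exact: leq_ltn_trans (ltn_ord i).
set a := i%:R * _ in c s; set b := j%:R * _ in c s.
have n0' : (0 : R) < n%:R by rewrite ltr0n.
(* The half difference of the angles lies in ]0, pi[, while equal points force cos (2 x) = 1, that
   is sin x = 0. *)
pose x := (b - a) / 2.
have xE : x = (j - i)%N%:R / n%:R * pi.
  by rewrite /x /a /b natrB 1?ltnW//; field; rewrite gt_eqF.
have pi0 := @pi_gt0 R.
have x0 : 0 < sin x.
  apply: sin_gt0_pi; rewrite xE mulr_gt0 ?divr_gt0 ?ltr0n ?subn_gt0//=.
  rewrite gtr_pMl// ltr_pdivrMr// mul1r ltr_nat.
  by apply: leq_ltn_trans (ltn_ord j); exact: leq_subr.
have : cos (x + x) = 1.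
  rewrite (_ : x + x = b - a); last by rewrite /x; field.
  by rewrite cosB -c -s -!expr2 cos2Dsin2.
have := cos2Dsin2 x; rewrite cosD => h1 h2.
have : sin x ^+ 2 = 0 by move: h1 h2; rewrite -!expr2; lra.
by move/eqP; rewrite sqrf_eq0 gt_eqF.
Qed.

Lemma polygon_loop (R : realType) (F A B k C r : R) :
  0 < F -> k != 0 -> 0 <= C -> 0 < r -> exists2 n : nat, (0 < n)%N &
  forall d, 0 < d -> exists g : 'I_n -> heis R,
   [/\ forall i, `|g i| < d, injective g,
     forall i, let h := heis_mul (heis_inv (g i)) (g (ordS i)) in
       [/\ `|h.1.1| < r, `|h.1.2| < r, `|h.2| < r & 0 < jet F A B k C h] &
     n%:R * F < \sum_(i < n) jet F A B k C (heis_mul (heis_inv (g i)) (g (ordS i)))].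
Proof.
move=> F0 k0 C0 r0.
have ak0 : 0 < `|k| by rewrite normr_gt0.
have [n [n1 st0 gain]] := polygon_angle ak0 C0; exists n; first exact: ltnW.
move=> d d0; set th := 2 * pi / n%:R in st0 gain.
set ct := cos th in gain; set st := sin th in st0 gain.
(* Orientation of the polygon: the vertical part of each side is - e^2 eta sin(th) / 2, and this
   choice makes its product with k positive. *)
pose eta : R := - Num.sg k.
have keta : k * eta = - `|k| by rewrite /eta mulrN mulrC -normrEsg.
have eta2 : eta ^+ 2 = 1 by rewrite /eta sqrrN sqr_sg k0.
pose D := `|A| * 2 + `|B| * 2 + `|k| + C * 9 + 1.
have D0 : 0 < D.
  have := normr_ge0 A; have := normr_ge0 B; have := ltW ak0; rewrite /D; lra.
(* Radius of the polygon. The bounds give, in order, vertices within d, sides within r, e <= 1 to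
   compare e^4 with e^2, and a positive jet on every side. *)
pose e := Num.min (Num.min (d / 2) (r / 3)) (Num.min (2^-1) (F / (2 * D))).
have e0 : 0 < e.
  have h : 0 < 2 * D by lra.
  by rewrite /e !lt_min (divr_gt0 F0 h) invr_gt0; lra.
have ed : e < d.
  by apply: (@le_lt_trans _ _ (d / 2)); [rewrite /e !ge_min lexx|lra].
have er : 2 * e < r.
  by apply: (@le_lt_trans _ _ (2 * (r / 3))); [rewrite ler_pM2l// /e !ge_min lexx !orbT|lra].
have e1 : e <= 1.
  by apply: (@le_trans _ _ 2^-1); [rewrite /e !ge_min lexx !orbT|lra].
have eF : D * e < F.
  apply: (@le_lt_trans _ _ (D * (F / (2 * D)))).
    by rewrite ler_pM2l// /e !ge_min lexx !orbT.
  rewrite (_ : D * _ = F / 2); last by field; rewrite gt_eqF.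
  lra.
clearbody e.
pose u (i : 'I_n) := cos (i%:R * th); pose v (i : 'I_n) := sin (i%:R * th).
have n0 : (0 : R) < n%:R by rewrite ltr0n ltnW.
have nth : n%:R * th = 2 * pi by rewrite /th; field; rewrite gt_eqF.
have cos2pi : cos (n%:R * th) = cos 0.
  by rewrite nth (_ : 2 * pi = pi + pi) ?cosDpi ?cospi ?opprK ?cos0//; ring.
have sin2pi : sin (n%:R * th) = sin 0.
  by rewrite nth (_ : 2 * pi = pi + pi) ?sinDpi ?sinpi ?oppr0 ?sin0//; ring.
have uS i : u (ordS i) = u i * ct - v i * st by rewrite /u (cos_ordS _ cos2pi) cosD.
have vS i : v (ordS i) = v i * ct + u i * st by rewrite /v (cos_ordS _ sin2pi) sinD addrC.
have uv i : u i ^+ 2 + v i ^+ 2 = 1 by exact: cos2Dsin2.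
have u1 i : `|u i| <= 1 by exact: cos_max.
have v1 i : `|v i| <= 1 by exact: sin_max.
have uvI i j : u i = u j -> v i = v j -> i = j by exact: circle_injective.
clearbody u v.
have cst : ct ^+ 2 + st ^+ 2 = 1 by exact: cos2Dsin2.
pose g i : heis R := (e * u i, e * eta * v i, 0).
have aeta : `|eta| = 1.
  by apply/eqP; rewrite -(@eqrXn2 _ 2)// ?expr1n -?normrX ?eta2 ?normr1.
have hE i : heis_mul (heis_inv (g i)) (g (ordS i)) =
    (e * (u (ordS i) - u i), e * eta * (v (ordS i) - v i), - (e ^+ 2 * eta * st / 2)).
  rewrite /g /heis_inv /heis_mul /=; congr (_, _, _); [by ring|by ring|].
  rewrite uS vS; apply/eqP; rewrite -subr_eq0; apply/eqP.
  transitivity (e ^+ 2 * eta * st / 2 * (1 - (u i ^+ 2 + v i ^+ 2))); first by field.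
  by rewrite uv subrr mulr0.
have chord i : (u (ordS i) - u i) ^+ 2 + (v (ordS i) - v i) ^+ 2 = 2 - 2 * ct.
  transitivity ((u i ^+ 2 + v i ^+ 2) * (ct ^+ 2 + st ^+ 2 + 1 - 2 * ct)).
    by rewrite uS vS; ring.
  by rewrite uv cst; ring.
(* Net gain of one side: |k| times its vertical part, minus C times its squared chord and squared
   vertical part. The linear terms are differences of u and v and cancel around the loop. *)
pose Q := e ^+ 2 * (`|k| * st / 2 - C * (2 - 2 * ct + e ^+ 2 * st ^+ 2 / 4)).
have jE i : jet F A B k C (heis_mul (heis_inv (g i)) (g (ordS i))) =
    F + A * e * (u (ordS i) - u i) + B * e * eta * (v (ordS i) - v i) + Q.
  rewrite hE /jet /= /Q -(chord i).
  have -> : `|k| = - (k * eta) by rewrite keta opprK.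
  have -> : e ^+ 2 * (- (k * eta) * st / 2 - C * ((u (ordS i) - u i) ^+ 2 +
    (v (ordS i) - v i) ^+ 2 + e ^+ 2 * st ^+ 2 / 4)) = e ^+ 2 * (- (k * eta) * st / 2 -
    C * ((u (ordS i) - u i) ^+ 2 + eta ^+ 2 * (v (ordS i) - v i) ^+ 2 +
     eta ^+ 2 * (e ^+ 2 * st ^+ 2 / 4))) by rewrite eta2 !mul1r.
  by field.
have Q0 : 0 < Q.
  apply: mulr_gt0; first by rewrite exprn_gt0.
  have : C * (2 - 2 * ct + e ^+ 2 * st ^+ 2 / 4) <= C * (2 - 2 * ct + st ^+ 2).
    apply: ler_wpM2l => //; rewrite lerD2l.
    have : e ^+ 2 * st ^+ 2 <= st ^+ 2.
      by rewrite ler_piMl ?sqr_ge0// -[leRHS](expr1n _ 2) lerXn2r ?nnegrE// ltW.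
    have := sqr_ge0 st; lra.
  have : `|k| / 2 * st = `|k| * st / 2 by field.
  lra.
have du i : `|u (ordS i) - u i| <= 2.
  by apply: le_trans (ler_normB _ _) _; have := u1 i; have := u1 (ordS i); lra.
have dv i : `|v (ordS i) - v i| <= 2.
  by apply: le_trans (ler_normB _ _) _; have := v1 i; have := v1 (ordS i); lra.
have st1 : `|st| <= 1 by exact: sin_max.
exists g; split.
- move=> i; apply: le_lt_trans ed; apply: norm_heis_le => /=.
  + by rewrite normrM (gtr0_norm e0) ler_piMr// ltW.
  + by rewrite !normrM (gtr0_norm e0) aeta mulr1 ler_piMr// ltW.
  + by rewrite normr0 ltW.
- move=> i j [] /(mulfI (lt0r_neq0 e0)) cu.
  have eeta : e * eta != 0.
    by apply: mulf_neq0; [exact: lt0r_neq0|rewrite -normr_eq0 aeta oner_eq0].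
  by move=> /(mulfI eeta) cv; exact: uvI.
- move=> i; cbv zeta; rewrite jE hE /=; split.
  + rewrite normrM (gtr0_norm e0); apply: le_lt_trans er.
    by rewrite mulrC ler_pM2r.
  + rewrite !normrM (gtr0_norm e0) aeta mulr1; apply: le_lt_trans er.
    by rewrite mulrC ler_pM2r.
  + rewrite normrN !normrM (gtr0_norm e0) aeta mulr1 (@ger0_norm _ 2^-1)// -expr2.
    apply: le_lt_trans er.
    have h1 : e ^+ 2 <= e by rewrite expr2 ler_piMr// ltW.
    have h2 : e ^+ 2 * `|st| <= e ^+ 2 by rewrite ler_piMr// sqr_ge0.
    lra.
  + have h1 : `|A * e * (u (ordS i) - u i)| <= `|A| * 2 * e.
      by rewrite !normrM (gtr0_norm e0) mulrAC ler_pM2r// ler_wpM2l.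
    have h2 : `|B * e * eta * (v (ordS i) - v i)| <= `|B| * 2 * e.
      by rewrite !normrM (gtr0_norm e0) aeta mulr1 mulrAC ler_pM2r// ler_wpM2l.
    have := ler_norm (- (A * e * (u (ordS i) - u i))).
    have := ler_norm (- (B * e * eta * (v (ordS i) - v i))).
    rewrite !normrN => h3 h4.
    have : 0 <= (`|k| + C * 9 + 1) * e.
      by apply: mulr_ge0; [rewrite !addr_ge0// mulr_ge0|exact: ltW].
    move: eF; rewrite /D; lra.
have su : \sum_(i < n) u (ordS i) = \sum_(i < n) u i.
  by rewrite [RHS](reindex_inj (@ordS_inj n)).
have sv : \sum_(i < n) v (ordS i) = \sum_(i < n) v i.
  by rewrite [RHS](reindex_inj (@ordS_inj n)).
clearbody Q; rewrite (eq_bigr _ (fun i _ => jE i)) !big_split/= -!mulr_sumr !sumrB su sv.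
rewrite !subrr !mulr0 !addr0 !sumr_const card_ord -[F *+ n]mulr_natl ltrDl.
by rewrite pmulrn_lgt0 // ltnW.
Qed.

(** Continuity of the group increment lets the vertices be thickened to balls, so that sets of
    positive mass can be moved. *)
Lemma jet_near (R : realType) (F A B k C r y : R) (q q' : heis R) :
  let h := heis_mul (heis_inv q) q' in
  `|h.1.1| < r -> `|h.1.2| < r -> `|h.2| < r -> y < jet F A B k C h ->
  exists2 d, 0 < d & forall a b, ball q d a -> ball q' d b ->
    let g := heis_mul (heis_inv a) b in
    [/\ `|g.1.1| < r, `|g.1.2| < r, `|g.2| < r & y < jet F A B k C g].
Proof.
move=> h h1 h2 h3 hy.
pose f1 (w : heis R * heis R) := w.2.1.1 - w.1.1.1.
pose f2 (w : heis R * heis R) := w.2.1.2 - w.1.1.2.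
pose f3 (w : heis R * heis R) := w.2.2 - w.1.2 + 2^-1 * (w.2.1.1 * w.1.1.2 - w.1.1.1 * w.2.1.2).
have fE w : heis_mul (heis_inv w.1) w.2 = (f1 w, f2 w, f3 w).
  case: w => -[[? ?] ?] [[? ?] ?]; rewrite /f1 /f2 /f3 /heis_inv /heis_mul /=.
  by congr (_, _, _); ring.
have cfst (U V : topologicalType) : continuous (@fst U V) by move=> x; exact: cvg_fst.
have csnd (U V : topologicalType) : continuous (@snd U V) by move=> x; exact: cvg_snd.
have c111 : continuous (fun w : heis R * heis R => w.1.1.1).
  by move=> w; exact: (continuous_comp (continuous_comp (cfst _ _ _) (cfst _ _ _)) (cfst _ _ _)).
have c112 : continuous (fun w : heis R * heis R => w.1.1.2).
  by move=> w; exact: (continuous_comp (continuous_comp (cfst _ _ _) (cfst _ _ _)) (csnd _ _ _)).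
have c12 : continuous (fun w : heis R * heis R => w.1.2).
  by move=> w; exact: (continuous_comp (cfst _ _ _) (csnd _ _ _)).
have c211 : continuous (fun w : heis R * heis R => w.2.1.1).
  by move=> w; exact: (continuous_comp (continuous_comp (csnd _ _ _) (cfst _ _ _)) (cfst _ _ _)).
have c212 : continuous (fun w : heis R * heis R => w.2.1.2).
  by move=> w; exact: (continuous_comp (continuous_comp (csnd _ _ _) (cfst _ _ _)) (csnd _ _ _)).
have c22 : continuous (fun w : heis R * heis R => w.2.2).
  by move=> w; exact: (continuous_comp (csnd _ _ _) (csnd _ _ _)).
have cf1 : continuous f1 by move=> w; apply: cvgB; [exact: c211|exact: c111].
have cf2 : continuous f2 by move=> w; apply: cvgB; [exact: c212|exact: c112].
have cf3 : continuous f3.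
  move=> w; apply: cvgD; first by apply: cvgB; [exact: c22|exact: c12].
  apply: cvgM; first exact: cvg_cst.
  by apply: cvgB; apply: cvgM; [exact: c211|exact: c112|exact: c111|exact: c212].
pose j w := jet F A B k C (f1 w, f2 w, f3 w).
have cj : continuous j.
  move=> w; apply: cvgB.
    apply: cvgD; [apply: cvgD; [apply: cvgD|]|]; (try exact: cvg_cst);
      (apply: cvgM; first exact: cvg_cst); [exact: cf1|exact: cf2|exact: cf3].
  apply: cvgM; first exact: cvg_cst.
  by apply: cvgD; [apply: cvgD|]; rewrite /=;
    (under eq_fun do rewrite expr2); rewrite expr2; apply: cvgM;
    by [exact: cf1|exact: cf2|exact: cf3].
have hE : h = (f1 (q, q'), f2 (q, q'), f3 (q, q')) by rewrite -fE.
rewrite hE /= in h1 h2 h3; rewrite hE -/(j _) in hy.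
have nf (f : heis R * heis R -> R) : continuous f -> `|f (q, q')| < r ->
    \forall w \near (q, q'), `|f w| < r.
  move=> cf fr; exact: (cvgr_lt _ (cvg_norm (cf (q, q'))) _ fr).
have hn : nbhs (q, q') [set w | (`|f1 w| < r /\ `|f2 w| < r) /\ (`|f3 w| < r /\ y < j w)].
  apply: filterI; apply: filterI; [exact: nf|exact: nf|exact: nf|].
  exact: cvgr_gt _ (cj (q, q')) _ hy.
move/nbhs_ballP : hn => [d d0 hd]; exists d; first exact: d0.
move=> a b qa qb; have [[g1 g2] [g3 gy]] := hd (a, b) (conj qa qb).
have gE : heis_mul (heis_inv a) b = (f1 (a, b), f2 (a, b), f3 (a, b)) := fE (a, b).
by move=> g; rewrite /g gE.
Qed.

Section Necessity.
Variables (R : realType) (mu : probability (heis R) R).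

Lemma ae_const (P : Prop) : {ae mu, forall q, P} -> P.
Proof.
move=> [N [mN N0 PN]]; apply: contrapT => nP.
have : (mu setT <= mu N)%E.
  by apply: le_measure; rewrite ?inE// => q _; exact: PN.
suff -> : mu setT = 1%E by rewrite N0 lee_fin ler10.
exact: probability_setT.
Qed.

Lemma dominated_null (N : set (heis R)) : mu `<< @heis_lebesgue R ->
  measurable N -> heis_lebesgue N = 0%E -> mu N = 0%E.
Proof.
move=> dom mN N0; apply: (dom N) => // A mA AN.
have [L LE] := heis_lebesgue_measure R; rewrite LE.
apply/eqP; rewrite eq_le measure_ge0 andbT -N0 LE.
by apply: le_measure; rewrite ?inE.
Qed.

Lemma vertical_plane_null : mu `<< @heis_lebesgue R ->
  forall t, mu [set q : heis R | q.1.1 = t] = 0%E.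
Proof.
move=> dom t; apply: dominated_null => //.
  by apply: (measurable_preimageT (measurable_heis11 (R:=R)) (measurable_set1 t)).
rewrite (_ : [set _ | _] = ([set t] `*` setT) `*` setT); last first.
  by apply/seteqP; split=> q /=; [|case=> -[]].
rewrite /heis_lebesgue product_measure1E//; last exact: measurableX.
have h : (@lebesgue_measure R \x @lebesgue_measure R)%E ([set t] `*` setT) = 0%E.
  rewrite product_measure1E//.
  exact: etrans (congr1 (fun x => (x * @lebesgue_measure R setT)%E) (lebesgue_measure_set1 t)) (mul0e _).
exact: etrans (congr1 (fun x => (x * @lebesgue_measure R setT)%E) h) (mul0e _).
Qed.

Lemma support_lebesgue_gt0 : mu `<< @heis_lebesgue R ->
  (0 < heis_lebesgue (measure_support mu))%E.
Proof.
move=> dom; have [L LE] := heis_lebesgue_measure R.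
rewrite LE lt_neqAle measure_ge0 andbT; apply/negP => /eqP E.
have := dominated_null dom (measurable_support mu); rewrite LE => /(_ (esym E)) h.
by have := support_measure1 mu; rewrite h => /eqP; rewrite eq_sym onee_eq0.
Qed.

Lemma heis_inv_mul (q a b : heis R) :
  heis_mul (heis_inv (heis_mul q a)) (heis_mul q b) = heis_mul (heis_inv a) b.
Proof.
by have := heis_mulA q a (heis_mul (heis_inv a) b); rewrite heis_mulVK => ->; rewrite heis_mulKV. Qed.

Lemma separated_ball (q q' : heis R) : q <> q' ->
  exists2 d : R, 0 < d & forall x, ball q d x -> ball q' d x -> False.
Proof.
move=> qq'; have n0 : 0 < `|q - q'|.
  by rewrite normr_gt0 subr_eq0; apply/eqP.
exists (`|q - q'| / 2) => [|x]; first by rewrite divr_gt0.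
rewrite -ball_normE /= => h1 h2.
have := ler_distD x q q'; rewrite (distrC x q'); lra.
Qed.

Lemma twisted_translation_not_optimal (p x0 y0 z0 : R) : 0 < p ->
  compactly_supported mu -> mu `<< @heis_lebesgue R ->
  (0 < time_separation (0%R, 0%R, 0%R) (x0, y0, z0))%E -> z0 != 0 ->
  exists2 S, admissible_map mu (pushforward mu (right_translation (x0, y0, z0))) S &
   (transport_cost p mu (right_translation (x0, y0, z0)) < transport_cost p mu S)%E.
Proof.
move=> p0 cmu dom tau0 z00.
have [F [A [B [k [C [r [F0 k0 C0 r0 [ub lb]]]]]]]] := cost_quadratic p0 tau0 z00.
have [n n0 loop] := polygon_loop A B F0 k0 C0 r0.
have [d d0 translates] := common_translates n cmu (support_lebesgue_gt0 dom).
have [g [gd ginj gh gsum]] := loop d d0; have [q0 hq] := translates g gd.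
pose Q i := heis_mul q0 (g i).
pose J i := jet F A B k C (heis_mul (heis_inv (g i)) (g (ordS i))).
have J0 i : 0 < J i by have [] := gh i.
have sumJ : n%:R * F < \sum_(i < n) J i := gsum.
have nF0 : 0 < n%:R * F by rewrite mulr_gt0// ltr0n.
have sJ0 : 0 < \sum_(i < n) J i by exact: lt_trans sumJ.
(* Shrinking each J i by t < 1 leaves room for moving the endpoints, while t times the sum of the J
   i is the midpoint between n F and that sum. *)
pose t := (n%:R * F / (\sum_(i < n) J i) + 1) / 2.
have t0 : 0 < t by rewrite divr_gt0// addr_gt0// divr_gt0.
have t1 : t < 1.
  have : n%:R * F / (\sum_(i < n) J i) < 1 by rewrite ltr_pdivrMr// mul1r.
  rewrite /t; lra.
pose f i := t * J i.
have f0 i : 0 < f i by rewrite mulr_gt0.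
have sumf : n%:R * F < \sum_(i < n) f i.
  rewrite -mulr_sumr (_ : t * _ = (n%:R * F + \sum_(i < n) J i) / 2); first by lra.
  by rewrite /t; field; rewrite gt_eqF.
have [d1 d10 hd1] : exists2 d, 0 < d & forall i : 'I_n, forall a b,
    ball (Q i) d a -> ball (Q (ordS i)) d b -> let h := heis_mul (heis_inv a) b in
    [/\ `|h.1.1| < r, `|h.1.2| < r, `|h.2| < r & f i < jet F A B k C h].
  apply: (@common_radius R _ (fun i d => forall a b,
    ball (Q i) d a -> ball (Q (ordS i)) d b -> let h := heis_mul (heis_inv a) b in
    [/\ `|h.1.1| < r, `|h.1.2| < r, `|h.2| < r & f i < jet F A B k C h])).
    by move=> i a b ab h x y xa ya; apply: h;
      [exact: le_ball xa|exact: le_ball ya].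
  move=> i; apply: jet_near; rewrite /Q heis_inv_mul; have [h1 h2 h3 h4] := gh i => //.
  by rewrite /f -/(J i) gtr_pMl.
(* The vertices are distinct, so small balls around them are disjoint. *)
have [d2 d20 hd2] : exists2 d, 0 < d & forall ij : 'I_n * 'I_n, ij.1 <> ij.2 ->
    forall x, ball (Q ij.1) d x -> ball (Q ij.2) d x -> False.
  apply: (@common_radius R _ (fun ij d => ij.1 <> ij.2 ->
    forall x, ball (Q ij.1) d x -> ball (Q ij.2) d x -> False)).
    by move=> ij a b ab h ne x xa ya; apply: (h ne x); [exact: le_ball xa|exact: le_ball ya].
  move=> [i j] /=; have [->|ij] := eqVneq i j; first by exists 1.
  have QQ : Q i <> Q j.
    move=> E; move/eqP: ij; apply; apply: ginj.
    by rewrite -(heis_mulKV q0 (g i)) -/(Q i) E heis_mulKV.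
  by have [e e0 he] := separated_ball QQ; exists e.
pose dl := Num.min d1 d2; have dl0 : 0 < dl by rewrite lt_min d10.
pose A0 i := ball (Q i) dl.
(* The vertices lie in the support, so all balls have positive mass; [shrink] then cuts out pieces
   of the same mass m. *)
have [m m0 hm] : exists2 m : R, 0 < m & forall i, (m%:E <= mu (A0 i))%E.
  apply: (@common_radius R _ (fun i m => (m%:E <= mu (A0 i))%E)).
    by move=> i a b ab; apply: le_trans; rewrite lee_fin.
  move=> i; have pos : (0 < mu (A0 i))%E.
    by apply: (hq i); [exact: open_heis_ball|exact: ballxx].
  have fin : mu (A0 i) \is a fin_num by apply: fin_num_measure; exact: measurable_heis_ball.
  by exists (fine (mu (A0 i))); rewrite ?fineK//; apply: fine_gt0; rewrite pos ltey_eq fin.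
have atom := vertical_plane_null dom.
have /choice[A1 hA1] : forall i, exists A1, [/\ measurable A1, A1 `<=` A0 i & mu A1 = m%:E].
  move=> i; apply: (shrink (measurable_heis11 (R:=R)) atom _ (ltW m0) (hm i)).
  exact: measurable_heis_ball.
have mA1 i : measurable (A1 i) by have [] := hA1 i.
have A1m i : mu (A1 i) = m%:E by have [] := hA1 i.
have A1b i x : A1 i x -> ball (Q i) d1 x /\ ball (Q i) d2 x.
  have [_ h _] := hA1 i; move=> /h; rewrite /A0 => hx.
  by split; apply: le_ball hx; rewrite /dl ge_min lexx ?orbT.
have tA1 : trivIset setT A1.
  move=> i j _ _ [x [/A1b[_ xi] /A1b[_ xj]]]; apply: contrapT => ij.
  exact: (hd2 (i, j) ij x).
have A1n i : A1 i !=set0.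
  apply/set0P/negP => /eqP E; have := A1m i; rewrite E measure0 => -[] m00.
  by move: m0; rewrite -m00 ltxx.
have [s [ms smu sA sN]] := cyclic_rearrangement atom mA1 tA1 A1m A1n.
set T := right_translation (x0, y0, z0).
have mT : measurable_fun setT T by exact: measurable_heis_mul.
(* The upper bound and the lower model at h = 0 coincide. *)
have costF q : cost p q (T q) = F%:E.
  apply/eqP; rewrite eq_le /cost /T /right_translation time_separation_right.
  apply/andP; split; first exact: ub.
  have := lb 0 0 0; rewrite normr0 => /(_ r0 r0 r0).
  rewrite (_ : heis_mul _ _ = (x0, y0, z0)); last by congr (_, _, _); ring.
  by rewrite (_ : F + _ + _ + _ - _ = F)//; ring.
have cost_s i q : A1 i q -> ((f i)%:E <= cost p q (T (s q)))%E.
  move=> Ai; have [qi _] := A1b _ _ Ai; have [si _] := A1b _ _ (sA _ _ Ai).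
  have [h1 h2 h3 h4] := hd1 i _ _ qi si.
  rewrite -(heis_mulVK q (s q)) /T /right_translation cost_right.
  set h := heis_mul _ _ in h1 h2 h3 h4 *.
  apply: (@le_trans _ _ (jet F A B k C h)%:E); first by rewrite lee_fin ltW.
  by move: h h1 h2 h3 {h4} => [[a b] c] /= h1 h2 h3; exact: lb.
have cost_n q : (forall i, ~ A1 i q) -> (F%:E <= cost p q (T (s q)))%E.
  by move=> /sN ->; rewrite costF.
exists (T \o s).
  split.
  - exact: measurableT_comp.
  - move=> D mD; rewrite /pushforward; apply: (smu (T @^-1` D)).
    exact: measurable_preimageT.
  - apply: aeW => q; apply: (@cost_gt0 _ p) => //=.
    have [[i Ai]|nA] := pselect (exists i, A1 i q).
      by apply: lt_le_trans (cost_s _ _ Ai); rewrite lte_fin.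
    by apply: lt_le_trans (cost_n _ _); [rewrite lte_fin|move=> i Ai; apply: nA; exists i].
rewrite /transport_cost (eq_integral (cst F%:E)) => [|q _]; last exact: costF.
rewrite integral_probability_cst.
have := integral_step mA1 tA1 A1m (ltW F0) (fun q => cost_ge0 q (T (s q)) p0)
  (fun i => ltW (f0 i)) cost_s cost_n.
apply: lt_le_trans; rewrite lte_fin ltrDl mulr_gt0// subr_gt0.
exact: sumf.
Qed.

End Necessity.

Theorem theorem46 (R : realType) (p : R) (hp : 0 < p < 1)
    (mu0 : probability (heis R) R) (hsupp : compactly_supported mu0)
    (hac : mu0 `<< @heis_lebesgue R) (x0 y0 z0 : R) :
  forward_optimal_map p mu0
    (pushforward mu0 (right_translation (x0, y0, z0)))
    (right_translation (x0, y0, z0))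
  <->
  z0 = 0 /\
  {ae mu0, forall q : heis R, let: (x, y, z) := q in
     minkowski_future (x, y) (x + x0, y + y0)}.
Proof.
have [p0 p1] := andP hp; set T := right_translation (x0, y0, z0).
have tauT q : time_separation q (T q) = time_separation (0, 0, 0) (x0, y0, z0).
  exact: time_separation_right.
split=> [[[mT _ tauT0] opt]|[z00 cone]].
  have tau0 : (0 < time_separation (0%R, 0%R, 0%R) (x0, y0, z0))%E.
    by apply: (@ae_const _ mu0); apply: filterS tauT0 => q; rewrite tauT.
  have [s0 t0 _] := time_separation_gt0_minkowski tau0.
  split.
    apply: contrapT => /eqP z00.
    have [S admS] := twisted_translation_not_optimal p0 hsupp hac tau0 z00.
    by rewrite ltNge opt.
  apply: aeW => -[[x y] z]; rewrite /minkowski_future /=.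
  rewrite (addrC x) (addrC y) !addrK; split; last by lra.
  by rewrite (_ : - _ + _ = - ((x0 + y0) * (x0 - y0))) ?oppr_lt0 ?mulr_gt0//; ring.
(* The cone condition does not depend on the point, so holding almost everywhere for a probability
   measure makes it true. *)
have [s0 t0] : 0 < x0 + y0 /\ 0 < x0 - y0.
  apply: (@ae_const _ mu0); apply: filterS cone => -[[x y] z].
  rewrite /minkowski_future /= (addrC x) (addrC y) !addrK => -[h x00].
  have h' : 0 < (x0 + y0) * (x0 - y0).
    by rewrite (_ : _ * _ = - (- x0 ^+ 2 + y0 ^+ 2)) ?oppr_gt0//; ring.
  have [|s0] := ltP 0 (x0 + y0).
    by move=> s0; split=> //; move: h'; rewrite pmulr_rgt0.
  have : x0 - y0 <= 0.
    by rewrite leNgt; apply/negP => t0; move: h'; rewrite pmulr_lgt0// ltNge s0.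
  lra.
rewrite {}/T z00 in tauT *; split; last first.
  by move=> S; exact: straight_translation_optimal.
split=> //; first exact: measurable_heis_mul.
apply: aeW => q; rewrite tauT; apply: lt_le_trans (time_separation_straight s0 t0).
by rewrite lte_fin sqrtr_gt0 mulr_gt0.
Qed.
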